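(* Let $K$ be a finite extension of $\mathbb{Q}_p$ of degree $h$ with residue field $\mathbb{F}_q$, and $G=\operatorname{GL}_2(\mathbb{F}_q)$. There is a constant $C$ depending only on $K$ (the norm $\|\cdot\|$ on $R$ being fixed) such that the following holds. Let $W$ be a representation of $G$ with a central character, let $U$ be a representation of $G$ that is the reduction in characteristic $p$ of an algebraic irreducible representation in characteristic $0$ of $\operatorname{Res}_{K/\mathbb{Q}_p}\operatorname{GL}_2$, and let $V=W\otimes U$. Let $0\le n\le q-1$, $m\in\mathbb{Z}/(q-1)\mathbb{Z}$ and $a_{n,m}(V)=[V:L_n(m)]$. Then $$\left|a_{n,m}(V)-\frac{\omega(n)\dim V}{q^2-1}\right|\le C\,\|W\|\,(\dim U)^{1-1/h}$$ if $n+2m=\alpha(V)\pmod{q-1}$, and $a_{n,m}(V)=0$ otherwise.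
   Context: $p$ is a prime, $q=p^f$ is the cardinality of the residue field of $K$, and $E$ is an algebraic closure of $\mathbb{F}_q$ with $\mathbb{F}_q\subset E$. $B\subset G$ is the subgroup of upper triangular matrices. Representations of $G$ are finite-dimensional over $E$. $S_n=\operatorname{Symm}^n(E^2)$ is the $n$-th symmetric power of the standard representation. For a representation $V=(\rho,V)$, $V(i)=V\otimes\det^i$ and $V^{[j]}=\rho\circ F^j$, where $F$ is the Frobenius $a\mapsto a^p$ on matrix entries. For $0\le n\le q-1$ with base-$p$ digits $n=\sum_{i=0}^{f-1}n_ip^i$, put $L_n=\bigotimes_i S_{n_i}^{[i]}$. The irreducible representations of $G$ are exactly the $L_n(m)$, $0\le n\le q-1$, $m\in\mathbb{Z}/(q-1)\mathbb{Z}$. $R=\operatorname{Rep}_E(G)\otimes_{\mathbb{Z}}\mathbb{R}$ is the Grothendieck ring with real coefficients, with basis $\{[L_n(m)]\}$. $[V:L_n(m)]$ is the coefficient of $[L_n(m)]$ (the multiplicity, if $V$ is a representation). $\|\cdot\|$ is a fixed norm on $R$ such that: (1) $\|VW\|\le\|V\|\|W\|$; (2) it is invariant under twist by $\det$; (3) it is invariant under Frobenius twist; (4) $|[V:L_n(m)]|\le\|V\|$ for all $n,m$. Such a norm exists, e.g. $\|V\|=\sup_{W\ne0}|VW|_{L,\infty}/|W|_{L,\infty}$ with $|V|_{L,\infty}=\max_{n,m}|[V:L_n(m)]|$. Write $\|W\|=\|[W]\|$. Characters of the center of $G$ are identified with $\mathbb{Z}/(q-1)\mathbb{Z}$, with $i$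 corresponding to $\operatorname{diag}(a,a)\mapsto a^i$. $\alpha(V)$ is the central character of $V$. $\omega(n)$ is the number of pairs $(n',m')\in\{0,\dots,q-2\}\times\mathbb{Z}/(q-1)\mathbb{Z}$ such that $L_n(m)$ is a constituent of $\mathcal{V}_{n'}(m')$; it does not depend on $m$. Here $\mathcal{V}_{n'}=\operatorname{ind}_B^G\lambda_{n'}$ is the space of functions $f:G\to E$ with $f(bg)=\lambda_{n'}(b)f(g)$, with $G$ acting by right translation, and $\lambda_{n'}\left(\begin{smallmatrix}a&b\\0&d\end{smallmatrix}\right)=d^{n'}$. Explicitly, $\omega(0)=2^f-1$, and for $n\ne0$, $\omega(n)=2^{f-r_n}$, where $r_n$ is the number of base-$p$ digits of $n$ (among $n_0,\dots,n_{f-1}$) equal to $p-1$. The irreducible algebraic representations of $\operatorname{Res}_{K/\mathbb{Q}_p}\operatorname{GL}_2$ (over $\overline{\mathbb{Q}}_p$) are the $\bigotimes_{\tau\in \operatorname{Hom}(K,\overline{\mathbb{Q}}_p)}(\operatorname{Symm}^{n_\tau}W_\tau\otimes\det_\tau^{m_\tau})$, $n_\tau\in\mathbb{Z}_{\ge0}$, $m_\tau\in\mathbb{Z}$. Here $W_\tau$ is the standard representation of $\operatorname{GL}_2$ given by $\tau$, and $\det_\tau=\det W_\tau$. The reduction in characteristic $p$ is the reduction of a ($\operatorname{GL}_2(\mathcal{O}_K)$-)stable lattice. Its semisimplification is independent of the lattice and is a representation of $G$. Only its class in $\operatorname{Rep}_E(G)$ matters. *)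

(* Defs.v *)
From HB Require Import structures.
From mathcomp Require Import all_boot all_order all_algebra all_fingroup.
From mathcomp Require Import all_field mxrepresentation.
From mathcomp Require Import mxtens freeg.
From mathcomp Require Import boolp classical_sets reals exp.
From mathcomp Require Import ring.

Set Implicit Arguments.
Unset Strict Implicit.
Unset Printing Implicit Defensive.

Import Order.TTheory GRing.Theory Num.Theory.
Local Open Scope ring_scope.

(* Z_p is the inverse limit of the Z/p^n; [x n] is the representative of the
   component modulo p^n in [0, p^n). *)
Record padic_seq (p : nat) : Type := PadicSeq {
  padic_trunc :> nat -> nat;
  padic_coherent : forall n, padic_trunc n = (padic_trunc n.+1 %% p ^ n)%N }.

(* The primality proof is a parameter so that the integral domain structure
   can be inferred from the type. *)
Definition padic_int (p : nat) (p_pr : prime p) : Type := padic_seq p.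

Section PadicIntegers.
Variables (p : nat) (p_pr : prime p).
Local Notation Zp := (padic_int p_pr).
Implicit Types x y z : Zp.

Lemma padic_eqP x y : (forall n, x n = y n) -> x = y.
Proof.
case: x y => [x cx] [y cy] /= /funext exy; case: _ / exy cy => cy.
by congr PadicSeq; exact: Prop_irrelevance.
Qed.

Lemma padic_mod x n : (x n %% p ^ n)%N = x n.
Proof. by rewrite (padic_coherent x n) modn_mod. Qed.

Lemma modn_expS m n : ((m %% p ^ n.+1) %% p ^ n = m %% p ^ n)%N.
Proof. by rewrite modn_dvdm // expnS dvdn_mull. Qed.

Lemma padic_coherent_op (op : nat -> nat -> nat) x y :
  (forall d a b, op (a %% d) (b %% d) = op a b %[mod d])%N ->
  forall n, (op (x n) (y n) %% p ^ n
    = (op (x n.+1) (y n.+1) %% p ^ n.+1) %% p ^ n)%N.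
Proof.
by move=> opP n; rewrite modn_expS (padic_coherent x n) (padic_coherent y n) opP.
Qed.

Definition padic_of_nat m : Zp :=
  PadicSeq (fun n => esym (modn_expS m n)).
Definition padic_add x y : Zp :=
  PadicSeq (padic_coherent_op x y (fun d a b => modnDm a b d)).
Definition padic_mul x y : Zp :=
  PadicSeq (padic_coherent_op x y (fun d a b => modnMm a b d)).

Lemma padic_opp_coherent x n :
  ((p ^ n - x n) %% p ^ n = ((p ^ n.+1 - x n.+1) %% p ^ n.+1) %% p ^ n)%N.
Proof.
have pn m : (0 < p ^ m)%N by rewrite expn_gt0 prime_gt0.
have xle m : (x m <= p ^ m)%N by rewrite -padic_mod ltnW // ltn_mod pn.
rewrite modn_expS; apply/eqP; rewrite -(eqn_modDr (x n)) subnK ?xle //.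
rewrite modnn (padic_coherent x n) modnDmr subnK ?xle //.
by rewrite expnS modnMl.
Qed.
Definition padic_opp x : Zp := PadicSeq (padic_opp_coherent x).

HB.instance Definition _ := gen_eqMixin Zp.
HB.instance Definition _ := gen_choiceMixin Zp.

Fact padic_addA : associative padic_add.
Proof. by move=> x y z; apply: padic_eqP => n /=; rewrite modnDmr modnDml addnA. Qed.
Fact padic_addC : commutative padic_add.
Proof. by move=> x y; apply: padic_eqP => n /=; rewrite addnC. Qed.
Fact padic_add0 : left_id (padic_of_nat 0) padic_add.
Proof. by move=> x; apply: padic_eqP => n /=; rewrite mod0n padic_mod. Qed.
Fact padic_addN : left_inverse (padic_of_nat 0) padic_opp padic_add.
Proof.
move=> x; apply: padic_eqP => n /=; rewrite modnDml subnK ?modnn ?mod0n //.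
by rewrite -padic_mod ltnW // ltn_mod expn_gt0 prime_gt0.
Qed.
HB.instance Definition _ := GRing.isZmodule.Build Zp
  padic_addA padic_addC padic_add0 padic_addN.

Fact padic_mulA : associative padic_mul.
Proof. by move=> x y z; apply: padic_eqP => n /=; rewrite modnMmr modnMml mulnA. Qed.
Fact padic_mulC : commutative padic_mul.
Proof. by move=> x y; apply: padic_eqP => n /=; rewrite mulnC. Qed.
Fact padic_mul1 : left_id (padic_of_nat 1) padic_mul.
Proof. by move=> x; apply: padic_eqP => n /=; rewrite modnMml mul1n padic_mod. Qed.
Fact padic_mulDl : left_distributive padic_mul padic_add.
Proof.
by move=> x y z; apply: padic_eqP => n /=; rewrite modnMml modnDm mulnDl.
Qed.
Fact padic_1neq0 : padic_of_nat 1 != 0.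
Proof.
apply/eqP => /(congr1 (fun x : Zp => x 1%N)) /=.
by rewrite expn1 mod0n modn_small ?prime_gt1.
Qed.
HB.instance Definition _ := GRing.Zmodule_isComNzRing.Build Zp
  padic_mulA padic_mulC padic_mul1 padic_mulDl padic_1neq0.

Definition padic_unit : pred Zp := fun x => `[< exists y, y * x = 1 >].
Definition padic_inv x : Zp :=
  if pselect (exists y, y * x = 1) is left h then projT1 (cid h) else x.
Fact padic_mulV : {in padic_unit, left_inverse 1 padic_inv *%R}.
Proof.
move=> x /asboolP xU; rewrite /padic_inv; case: pselect => // h.
exact: projT2 (cid h).
Qed.
Fact padic_unitP x y : y * x = 1 -> padic_unit x.
Proof. by move=> yx; apply/asboolP; exists y. Qed.
Fact padic_inv_out : {in [predC padic_unit], padic_inv =1 id}.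
Proof.
move=> x; rewrite inE => /asboolPn xU; rewrite /padic_inv.
by case: pselect => // h; case: xU.
Qed.
HB.instance Definition _ := GRing.ComNzRing_hasMulInverse.Build Zp
  padic_mulV padic_unitP padic_inv_out.

Lemma padic_mod_le x n m : (n <= m)%N -> (x m %% p ^ n)%N = x n.
Proof.
move=> le_nm; rewrite -(subnK le_nm); elim: (m - n)%N => [|d IH].
  by rewrite add0n padic_mod.
by rewrite addSn -{}IH [in RHS]padic_coherent modn_dvdm // dvdn_exp2l ?leq_addl.
Qed.

Fact padic_idomain (x y : Zp) : x * y = 0 -> (x == 0) || (y == 0).
Proof.
have nz (z : Zp) : z != 0 -> exists n, z n != 0%N.
  move=> /eqP z0; apply: contrapT => h; apply: z0; apply: padic_eqP => n /=.
  by rewrite mod0n; apply/eqP/negPn/negP => zn; apply: h; exists n.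
move=> xy0; apply/negPn; rewrite negb_or; apply/negP => /andP[/nz[n xn] /nz[m ym]].
have := congr1 (fun z : Zp => z (n + m)%N) xy0 => /= /eqP.
rewrite mod0n => xy.
have {}xn : ~~ (p ^ n %| x (n + m)%N)%N by rewrite /dvdn padic_mod_le ?leq_addr.
have {}ym : ~~ (p ^ m %| y (n + m)%N)%N by rewrite /dvdn padic_mod_le ?leq_addl.
have x0 : (0 < x (n + m)%N)%N by rewrite lt0n; apply: contraNneq xn => ->.
have y0 : (0 < y (n + m)%N)%N by rewrite lt0n; apply: contraNneq ym => ->.
move: xy; rewrite -/(dvdn _ _) pfactor_dvdn ?muln_gt0 ?x0 ?y0 // lognM //.
apply/negP; rewrite -ltnNge.
move: xn ym; rewrite !pfactor_dvdn // -!ltnNge => xn ym.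
exact: leq_trans (leq_add xn (ltnW ym)).
Qed.
HB.instance Definition _ :=
  GRing.ComUnitRing_isIntegral.Build Zp padic_idomain.

End PadicIntegers.

Notation Qp p_pr := {fraction padic_int p_pr}.

Section IntegralClosure.
Variables (A : comNzRingType) (L : fieldType) (f : {rmorphism A -> L}).

Definition integral_pred : {pred L} := fun x => `[< integralOver f x >].

Fact integral_subring_closed : subring_closed integral_pred.
Proof.
split=> [|x y /asboolP ix /asboolP iy|x y /asboolP ix /asboolP iy]; apply/asboolP.
- exact: integral1.
- exact: integral_sub.
- exact: integral_mul.
Qed.
HB.instance Definition _ :=
  GRing.isSubringClosed.Build L integral_pred integral_subring_closed.

Record intcl : Type := Intcl {intcl_val : L; _ : intcl_val \in integral_pred}.
HB.instance Definition _ := [isSub for intcl_val].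
HB.instance Definition _ := [Choice of intcl by <:].
HB.instance Definition _ := [SubChoice_isSubComNzRing of intcl by <:].

Definition intcl_unit : pred intcl :=
  fun x => (val x != 0) && ((val x)^-1 \in integral_pred).
Definition intcl_inv (x : intcl) : intcl :=
  if intcl_unit x then insubd x (val x)^-1 else x.
Fact intcl_mulV : {in intcl_unit, left_inverse 1 intcl_inv *%R}.
Proof.
move=> x xU; have {}xU : intcl_unit x by []; apply: val_inj.
rewrite /intcl_inv xU; case/andP: xU => x0 xV.
by rewrite rmorphM /= insubdK // mulVf // rmorph1.
Qed.
Fact intcl_unitP (x y : intcl) : y * x = 1 -> intcl_unit x.
Proof.
move=> /(congr1 val); rewrite rmorphM rmorph1 /= => yx.
have x0 : val x != 0 by apply: contra_eq_neq yx => ->; rewrite mulr0 eq_sym oner_eq0.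
by rewrite /intcl_unit x0 -[_^-1]mul1r -yx mulfK // (valP y).
Qed.
Fact intcl_inv_out : {in [predC intcl_unit], intcl_inv =1 id}.
Proof.
move=> x xU; have {}xU : ~~ intcl_unit x by []; by rewrite /intcl_inv (negbTE xU).
Qed.
HB.instance Definition _ := GRing.ComNzRing_hasMulInverse.Build intcl
  intcl_mulV intcl_unitP intcl_inv_out.

End IntegralClosure.

Section Symm.
Variable A : comNzRingType.

(* Matrix of Symm^n g in the basis (e_1^(n-i) e_2^i)_(0 <= i <= n), on column
   vectors, with e_1, e_2 dehomogenised to 1 and 'X. *)
Definition symm_mx (n : nat) (g : 'M[A]_2) : 'M[A]_n.+1 :=
  \matrix_(i, j) (((g 0 0)%:P + g 1 0 *: 'X) ^+ (n - j)
                  * ((g 0 1)%:P + g 1 1 *: 'X) ^+ j)`_i.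

Lemma symm_mx1 n : symm_mx n 1%:M = 1%:M.
Proof.
apply/matrixP => i j; rewrite !mxE /= scale0r addr0 expr1n mul1r.
by rewrite add0r scale1r coefXn.
Qed.

Definition homog (P Q : {poly A}) n (r : {poly A}) : {poly A} :=
  \sum_(k < n.+1) r`_k *: (P ^+ (n - k) * Q ^+ k).

Lemma homogMl P Q n (r : {poly A}) (a c : A) : (size r <= n.+1)%N ->
  homog P Q n.+1 ((a%:P + c *: 'X) * r) = (a *: P + c *: Q) * homog P Q n r.
Proof.
move=> sr; rewrite /homog [RHS]mulrDl.
under eq_bigr => k _ do rewrite mulrDl coefD scalerDl mul_polyC -scalerAl !coefZ.
rewrite big_split /= !mulr_sumr; congr (_ + _).
  rewrite big_ord_recr /= nth_default // mulr0 scale0r addr0.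
  apply: eq_bigr => k _; rewrite subSn -1?ltnS // exprS -!scalerAl -scalerAr.
  by rewrite scalerA mulrA.
rewrite big_ord_recl /= coefXM eqxx mulr0 scale0r add0r.
apply: eq_bigr => k _; rewrite /= subSS coefXM /= exprS -!scalerAl -scalerAr.
by rewrite scalerA mulrCA.
Qed.

Lemma size_lin (a c : A) : (size (a%:P + c *: 'X)%R <= 2)%N.
Proof.
rewrite (leq_trans (size_polyD _ _)) // geq_max size_polyC.
by rewrite (leq_trans (leq_b1 _)) //= (leq_trans (size_scale_leq _ _)) ?size_polyX.
Qed.

Lemma homog_lin P Q (a b c d : A) m n :
  let u : {poly A} := a%:P + c *: 'X in
  let v : {poly A} := b%:P + d *: 'X in
  homog P Q (m + n) (u ^+ m * v ^+ n)
    = (a *: P + c *: Q) ^+ m * (b *: P + d *: Q) ^+ n.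
Proof.
move=> u v.
have step (r : {poly A}) k (w : {poly A}) : (size w <= 2 -> size r <= k.+1 -> size (w * r)%R <= k.+2)%N.
  move=> sw sr; rewrite (leq_trans (size_polyMleq _ _)) //.
  by rewrite -subn1 leq_subLR (leq_trans (leq_add sw sr)) // addSn.
have szv k : (size (v ^+ k)%R <= k.+1)%N.
  elim: k => [|k IH]; first by rewrite size_poly1.
  by rewrite exprS step // size_lin.
have szu k : (size (u ^+ k * v ^+ n)%R <= (k + n).+1)%N.
  elim: k => [|k IH]; first by rewrite mul1r szv.
  by rewrite exprS -mulrA addSn step // size_lin.
elim: m => [|m IH]; last first.
  by rewrite addSn !exprS -!mulrA homogMl ?szu // IH.
rewrite add0n !mul1r; elim: n {szu} => [|n IH]; last first.
  by rewrite !exprS homogMl ?szv // IH.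
by rewrite /homog big_ord1 subnn !expr0 mulr1 coef1 scale1r.
Qed.

Lemma symm_mxM n g h : symm_mx n (g *m h) = symm_mx n g *m symm_mx n h.
Proof.
apply/matrixP => i j; rewrite [LHS]mxE [RHS]mxE.
have lij : (j <= n)%N by rewrite -ltnS.
have E := homog_lin ((g 0 0)%:P + g 1 0 *: 'X) ((g 0 1)%:P + g 1 1 *: 'X)
  (h 0 0) (h 0 1) (h 1 0) (h 1 1) (n - j) j.
rewrite /= subnK // in E.
have H (b : 'I_2) : ((g *m h) 0 b)%:P + (g *m h) 1 b *: 'X
    = h 0 b *: ((g 0 0)%:P + g 1 0 *: 'X) + h 1 b *: ((g 0 1)%:P + g 1 1 *: 'X).
  rewrite !mxE !big_ord_recl !big_ord0 !addr0 /=.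
  have -> : fintype.lift ord0 ord0 = 1 :> 'I_2 by apply: val_inj.
  rewrite !rmorphD !rmorphM /= -!mul_polyC !rmorphD !rmorphM /=; ring.
rewrite !H -E coef_sum; apply: eq_bigr => k _.
by rewrite coefZ [symm_mx n g i k]mxE [symm_mx n h k j]mxE mulrC.
Qed.

End Symm.

Section Tens.
Variable F : fieldType.

Lemma tensmx11 m n : (1%:M : 'M[F]_m) *t (1%:M : 'M[F]_n) = 1%:M.
Proof.
apply/matrixP => i j; case: (mxtens_indexP i) => i1 i2.
case: (mxtens_indexP j) => j1 j2; rewrite tensmxE !mxE.
by rewrite (inj_eq (can_inj (@mxtens_indexK m n))) xpair_eqE -natrM mulnb.
Qed.

Lemma tensmx_row_free m n p q (A : 'M[F]_(m, n)) (B : 'M[F]_(p, q)) :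
  row_free A -> row_free B -> row_free (A *t B).
Proof.
move=> /row_freeP[A' AA'] /row_freeP[B' BB'].
by apply/row_freeP; exists (A' *t B'); rewrite tensmx_mul AA' BB' tensmx11.
Qed.

Lemma tensmx_row_full m n p q (A : 'M[F]_(m, n)) (B : 'M[F]_(p, q)) :
  row_full A -> row_full B -> row_full (A *t B).
Proof.
move=> /row_fullP[A' AA'] /row_fullP[B' BB'].
by apply/row_fullP; exists (A' *t B'); rewrite tensmx_mul AA' BB' tensmx11.
Qed.

End Tens.

Section Representations.
Variables (E : fieldType) (gT : finGroupType).

Record rep : Type := Rep {
  rdim : nat;
  rep_mx :> mx_representation E [set: gT] rdim }.

HB.instance Definition _ := gen_eqMixin rep.
HB.instance Definition _ := gen_choiceMixin rep.

Fact rep_tens_mx_repr (V W : rep) :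
  mx_repr [set: gT] (fun g => V g *t W g).
Proof.
split=> [|g h Gg Gh]; first by rewrite !repr_mx1 tensmx11.
by rewrite tensmx_mul !repr_mxM.
Qed.
Definition rep_tens (V W : rep) : rep := Rep (MxRepresentation (rep_tens_mx_repr V W)).

Fact rep1_mx_repr : mx_repr [set: gT] (fun=> 1%:M : 'M[E]_1).
Proof. by split=> // g h _ _; rewrite mulmx1. Qed.
Definition rep1 : rep := Rep (MxRepresentation rep1_mx_repr).

(* 0 -> V' -> V -> V'' -> 0 is exact, on row vectors. *)
Definition ses (V' V V'' : rep) : Prop :=
  exists (i : 'M[E]_(rdim V', rdim V)) (s : 'M[E]_(rdim V, rdim V'')),
    [/\ row_free i, row_full s, (i :=: kermx s)%MS,
        forall g, V' g *m i = i *m V g & forall g, V g *m s = s *m V'' g].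

Lemma ses_of_rank V' V V'' (i : 'M[E]_(rdim V', rdim V)) (s : 'M[E]_(rdim V, rdim V'')) :
  row_free i -> row_full s -> i *m s = 0 -> rdim V = (rdim V' + rdim V'')%N ->
  (i :=: kermx s)%MS.
Proof.
move=> fi fs is0 dV; apply/eqmxP; rewrite -(geq_leqif (mxrank_leqif_eq _)).
  by rewrite mxrank_ker (eqP fi) (eqP fs) dV addnK.
by rewrite sub_kermx is0.
Qed.

Lemma ses_dim V' V V'' : ses V' V V'' -> rdim V = (rdim V' + rdim V'')%N.
Proof.
case=> i [s] [/eqP fi /eqP fs e _ _].
have ei : \rank i = \rank (kermx s) by case: e.
rewrite -fi ei mxrank_ker fs subnK // -[X in (X <= _)%N]fs.
exact: rank_leq_row.
Qed.

Lemma ses_mul0 d d' d'' (i : 'M[E]_(d', d)) (s : 'M[E]_(d, d'')) :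
  (i :=: kermx s)%MS -> i *m s = 0.
Proof. by move=> e; apply/sub_kermxP; rewrite e. Qed.

Lemma ses_tensl V' V V'' W : ses V' V V'' ->
  ses (rep_tens V' W) (rep_tens V W) (rep_tens V'' W).
Proof.
move=> eV; have dV := ses_dim eV; case: eV => i [s] [fi fs e ci cs].
have fi1 : row_free (i *t (1%:M : 'M_(rdim W))).
  by apply: tensmx_row_free => //; rewrite row_free_unit unitmx1.
have fs1 : row_full (s *t (1%:M : 'M_(rdim W))).
  by apply: tensmx_row_full => //; rewrite row_full_unit unitmx1.
exists (i *t 1%:M), (s *t 1%:M); split => // [|g|g].
- apply: ses_of_rank => //=; last by rewrite dV mulnDl.
  by rewrite tensmx_mul (ses_mul0 e) tens0mx.
- by rewrite !tensmx_mul ci mulmx1 mul1mx.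
- by rewrite !tensmx_mul cs mulmx1 mul1mx.
Qed.

Lemma ses_tensr V' V V'' W : ses V' V V'' ->
  ses (rep_tens W V') (rep_tens W V) (rep_tens W V'').
Proof.
move=> eV; have dV := ses_dim eV; case: eV => i [s] [fi fs e ci cs].
have fi1 : row_free ((1%:M : 'M_(rdim W)) *t i).
  by apply: tensmx_row_free => //; rewrite row_free_unit unitmx1.
have fs1 : row_full ((1%:M : 'M_(rdim W)) *t s).
  by apply: tensmx_row_full => //; rewrite row_full_unit unitmx1.
exists (1%:M *t i), (1%:M *t s); split => // [|g|g].
- apply: ses_of_rank => //=; last by rewrite dV mulnDr.
  by rewrite tensmx_mul (ses_mul0 e) tensmx0.
- by rewrite !tensmx_mul ci mulmx1 mul1mx.
- by rewrite !tensmx_mul cs mulmx1 mul1mx.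
Qed.

(* [V : L] for L irreducible: the number of factors isomorphic to L in a
   composition series of V. *)
Definition mult (V L : rep) : nat :=
  xget 0%N [set c | exists (U : seq 'M[E]_(rdim V))
                           (cU : mx_composition_series V U),
    (last 0 U :=: 1%:M)%MS /\
    c = #|[set i : 'I_(size U) | `[< mx_rsim (series_repr i cU) L >]]%SET|].

End Representations.

Section Span.
Variables (R : comNzRingType) (V : lmodType R).

Definition span_of (S : set V) : set V :=
  [set x | exists s : seq (R * V),
     (forall u, u \in s -> S u.2) /\ x = \sum_(u <- s) u.1 *: u.2].

Lemma span_of_gen S x : S x -> span_of S x.
Proof.
move=> Sx; exists [:: (1, x)]; rewrite big_seq1 scale1r; split=> // u.
by rewrite inE => /eqP ->.
Qed.

Lemma span_of0 S : span_of S 0.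
Proof. by exists [::]; rewrite big_nil. Qed.

Lemma span_ofD S x y : span_of S x -> span_of S y -> span_of S (x + y).
Proof.
move=> [s [Ss ->]] [t [St ->]]; exists (s ++ t); rewrite big_cat; split=> // u.
by rewrite mem_cat => /orP[/Ss|/St].
Qed.

Lemma span_ofZ S a x : span_of S x -> span_of S (a *: x).
Proof.
move=> [s [Ss ->]]; exists [seq (a * u.1, u.2) | u <- s]; split=> [u /mapP[v /Ss Sv ->] //|].
by rewrite big_map scaler_sumr; apply: eq_bigr => u _; rewrite scalerA.
Qed.

Lemma span_of_lin (S : set V) (f : V -> V) :
  (forall a x y, f (a *: x + y) = a *: f x + f y) ->
  (forall x, S x -> span_of S (f x)) -> forall x, span_of S x -> span_of S (f x).
Proof.
move=> fl fS x [s [Ss ->]]; elim: s Ss => [|u s IH] Ss.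
  have -> : f (\sum_(u <- [::]) u.1 *: u.2) = 0.
    rewrite big_nil; have := fl 1 0 0.
    by rewrite !scale1r addr0 => /(congr1 (fun z => z - f 0)); rewrite addrK subrr.
  exact: span_of0.
rewrite big_cons fl; apply: span_ofD; last first.
  by apply: IH => v vs; apply: Ss; rewrite inE vs orbT.
by apply: span_ofZ; apply: fS; apply: Ss; rewrite mem_head.
Qed.

End Span.

Section FreeLift.
Variables (R : comNzRingType) (K : choiceType) (M : lmodType R) (f : K -> M).

Lemma fglift_linear a (x y : {freeg K / R}) :
  fglift f (a *: x + y) = a *: fglift f x + fglift f y.
Proof.
have fB u v : fglift f (u - v) = fglift f u - fglift f v.
  exact: (lift_is_additive f).
have f0 : fglift f 0 = 0 by rewrite -[X in fglift f X](subrr 0) fB subrr.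
have aD u v : fglift f (u + v) = fglift f u + fglift f v.
  by rewrite -[v in LHS]opprK -[X in _ - X]sub0r !fB f0 sub0r opprK.
have aS (I : Type) (r : seq I) (F : I -> {freeg K / R}) :
    fglift f (\sum_(i <- r) F i) = \sum_(i <- r) fglift f (F i).
  by elim: r => [|i r IH]; rewrite ?big_nil // !big_cons aD IH.
rewrite aD; congr (_ + _); rewrite -[x in RHS]freeg_sumE -[a *: x]/(fgscale a x).
rewrite /fgscale !aS scaler_sumr; apply: eq_bigr => k _.
by rewrite !liftU scalerA.
Qed.

Lemma fglift0 : fglift f (0 : {freeg K / R}) = 0.
Proof.
have := fglift_linear 1 0 0; rewrite !scale1r addr0.
by move=> /(congr1 (fun z => z - fglift f 0)); rewrite addrK subrr.
Qed.

End FreeLift.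

Section Grothendieck.
Variables (R : comNzRingType) (E : fieldType) (gT : finGroupType).
Local Notation rep := (rep E gT).
Local Notation free := {freeg rep / R}.

Definition ses_rel : set free :=
  [set x | exists V' V V'', ses V' V V'' /\ x = << V >> - << V' >> - << V'' >>].

Definition groth_ker : {pred free} := fun x => `[< span_of ses_rel x >].

Fact groth_ker_zmod_closed : zmod_closed groth_ker.
Proof.
split=> [|x y /asboolP kx /asboolP ky]; apply/asboolP; first exact: span_of0.
by apply: span_ofD => //; rewrite -scaleN1r; exact: span_ofZ.
Qed.
HB.instance Definition _ :=
  GRing.isZmodClosed.Build free groth_ker groth_ker_zmod_closed.

Definition groth : Type := ring_quotient.Quotient.quot (groth_ker : zmodClosed free).
HB.instance Definition _ := GRing.Zmodule.on groth.
Definition gpi (x : free) : groth := \pi_(groth)%qT x.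
Definition grepr (x : groth) : free := generic_quotient.repr x.

Lemma gpiK : cancel grepr gpi. Proof. exact: reprK. Qed.

Lemma gpiB x y : gpi (x - y) = gpi x - gpi y.
Proof. by rewrite /gpi piE. Qed.

Lemma gpi_eqP x y : gpi x = gpi y <-> span_of ses_rel (x - y).
Proof.
split=> [/eqP|h]; last apply/eqP; rewrite /gpi -ring_quotient.Quotient.idealrBE.
  by move=> /asboolP.
exact/asboolP.
Qed.

Lemma gpiD x y : gpi (x + y) = gpi x + gpi y.
Proof. by rewrite /gpi piE. Qed.

Lemma grepr_gpi x : span_of ses_rel (grepr (gpi x) - x).
Proof. by apply/gpi_eqP; rewrite gpiK. Qed.

Definition groth_scale (a : R) (x : groth) : groth := gpi (a *: grepr x).

Lemma gpiZ a x : gpi (a *: x) = groth_scale a (gpi x).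
Proof.
apply/esym/gpi_eqP; rewrite -scalerBr; apply: span_ofZ.
exact: grepr_gpi.
Qed.

Fact groth_scaleA a b x : groth_scale a (groth_scale b x) = groth_scale (a * b) x.
Proof. by rewrite -[x]gpiK -!gpiZ scalerA. Qed.
Fact groth_scale1 : left_id 1 groth_scale.
Proof. by move=> x; rewrite -[x]gpiK -!gpiZ scale1r. Qed.
Fact groth_scaleDr : right_distributive groth_scale +%R.
Proof.
by move=> a x y; rewrite -[x]gpiK -[y]gpiK -gpiD -!gpiZ -gpiD -scalerDr.
Qed.
Fact groth_scaleDl x : {morph groth_scale^~ x : a b / a + b}.
Proof. by move=> a b /=; rewrite -[x]gpiK -!gpiZ -gpiD -scalerDl. Qed.
HB.instance Definition _ := GRing.Zmodule_isLmodule.Build R groth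
  groth_scaleA groth_scale1 groth_scaleDr groth_scaleDl.

Definition flin (f : rep -> rep) (x : free) : free := fglift (fun V => << f V >>) x.

Lemma flin_linear f a x y : flin f (a *: x + y) = a *: flin f x + flin f y.
Proof. exact: fglift_linear. Qed.

Lemma flinU f V : flin f << V >> = << f V >>.
Proof. by rewrite /flin liftU scale1r. Qed.

Lemma span_of_flin (f : rep -> rep) x :
  (forall V' V V'', ses V' V V'' -> ses (f V') (f V) (f V'')) ->
  span_of ses_rel x -> span_of ses_rel (flin f x).
Proof.
move=> fses; apply: span_of_lin => [a u v|u [V' [V [V'' [eV ->]]]]].
  exact: flin_linear.
apply: span_of_gen; exists (f V'), (f V), (f V''); split; first exact: fses.
rewrite -addrA -opprD addrC -[- (_ + _)]scaleN1r flin_linear -[<< V' >>]scale1r.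
by rewrite flin_linear !flinU scale1r scaleN1r addrC opprD addrA.
Qed.

Definition groth_cl (V : rep) : groth := gpi << V >>.

Lemma groth_cl_ses V' V V'' : ses V' V V'' ->
  groth_cl V = groth_cl V' + groth_cl V''.
Proof.
move=> eV; rewrite -gpiD; apply/gpi_eqP; rewrite opprD addrA.
by apply: span_of_gen; exists V', V, V''.
Qed.

Definition groth_lin (f : rep -> rep) (x : groth) : groth :=
  gpi (flin f (grepr x)).

Lemma groth_lin_cl (f : rep -> rep) V :
  (forall V' V V'', ses V' V V'' -> ses (f V') (f V) (f V'')) ->
  groth_lin f (groth_cl V) = groth_cl (f V).
Proof.
move=> fses; apply/gpi_eqP; rewrite -flinU.
have -> : flin f (grepr (groth_cl V)) - flin f << V >>
    = flin f (grepr (groth_cl V) - << V >>).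
  by rewrite addrC -[- flin _ _]scaleN1r -flin_linear scaleN1r addrC.
by apply: span_of_flin => //; exact: grepr_gpi.
Qed.

Definition fmul (x y : free) : free := fglift (fun V => flin (rep_tens V) y) x.

Definition groth_mul (x y : groth) : groth := gpi (fmul (grepr x) (grepr y)).

Lemma fmul_linearl a x y z : fmul (a *: x + y) z = a *: fmul x z + fmul y z.
Proof. exact: fglift_linear. Qed.

Lemma fmulE x y : fmul x y =
  \sum_(V <- dom x) coeff V x *: flin (rep_tens V) y.
Proof.
rewrite /fmul -[x in LHS]freeg_sumE.
elim: (dom x) => [|V s IH]; last first.
  rewrite !big_cons -IH -[<< _ *g V >>]scale1r fglift_linear scale1r.
  by rewrite liftU.
by rewrite !big_nil fglift0.
Qed.

Lemma fmul_linearr a x y z : fmul z (a *: x + y) = a *: fmul z x + fmul z y.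
Proof.
rewrite !fmulE scaler_sumr -big_split; apply: eq_bigr => V _ /=.
by rewrite flin_linear scalerDr !scalerA mulrC.
Qed.

Lemma fmulU V W : fmul << V >> << W >> = << rep_tens V W >>.
Proof. by rewrite /fmul liftU scale1r flinU. Qed.

Lemma span_of_fmulr x y : span_of ses_rel y -> span_of ses_rel (fmul x y).
Proof.
move=> ky; rewrite fmulE; elim: (dom x) => [|V s IH].
  by rewrite big_nil; exact: span_of0.
rewrite big_cons; apply: span_ofD => //; apply: span_ofZ.
by apply: span_of_flin => // V' V0 V''; exact: ses_tensr.
Qed.

Lemma span_of_fmull x y : span_of ses_rel x -> span_of ses_rel (fmul x y).
Proof.
move: x; apply: span_of_lin => [a u v|u ru]; first exact: fmul_linearl.
rewrite -[y]freeg_sumE; elim: (dom y) => [|W s IH].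
  by rewrite big_nil; apply: span_of_fmulr; exact: span_of0.
rewrite big_cons.
have -> : << coeff W y *g W >> = coeff W y *: << W >> :> free.
  by apply/eqP/freeg_eqP => V; rewrite coeffZ !coeffU mul1r.
rewrite fmul_linearr; apply: span_ofD => //; apply: span_ofZ.
have -> : fmul u << W >> = flin (fun V => rep_tens V W) u.
  by rewrite /fmul; congr (fglift _ _); apply: funext => V; rewrite flinU.
apply: span_of_flin; last exact: span_of_gen.
by move=> V' V V''; exact: ses_tensl.
Qed.

Lemma gpiM x y : groth_mul (gpi x) (gpi y) = gpi (fmul x y).
Proof.
apply/gpi_eqP.
have -> : fmul (grepr (gpi x)) (grepr (gpi y)) - fmul x y
    = fmul (grepr (gpi x) - x) (grepr (gpi y)) + fmul x (grepr (gpi y) - y).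
  rewrite [_ - x]addrC [_ - y]addrC -[- x]scaleN1r -[- y]scaleN1r.
  by rewrite fmul_linearl fmul_linearr !scaleN1r [RHS]addrC addrA addrK addrC.
apply: span_ofD; first by apply: span_of_fmull; exact: grepr_gpi.
by apply: span_of_fmulr; exact: grepr_gpi.
Qed.

Lemma groth_cl_tens V W :
  groth_cl (rep_tens V W) = groth_mul (groth_cl V) (groth_cl W).
Proof. by rewrite gpiM fmulU. Qed.

Lemma groth_mul_linearl a x y z :
  groth_mul (a *: x + y) z = a *: groth_mul x z + groth_mul y z.
Proof.
rewrite -[x]gpiK -[y]gpiK -[z]gpiK -[a *: _]gpiZ -gpiD !gpiM fmul_linearl.
by rewrite gpiD gpiZ.
Qed.

Lemma groth_mul_linearr a x y z :
  groth_mul z (a *: x + y) = a *: groth_mul z x + groth_mul z y.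
Proof.
rewrite -[x]gpiK -[y]gpiK -[z]gpiK -[a *: _]gpiZ -gpiD !gpiM fmul_linearr.
by rewrite gpiD gpiZ.
Qed.

(* Linear extension of V |-> [V : L]; independent of the representative since
   multiplicities are additive on short exact sequences. *)
Definition groth_coef (L : rep) (x : groth) : R :=
  fglift (fun V => (mult V L)%:R : R^o) (grepr x).

End Grothendieck.

Section Induced.
Variables (E : fieldType) (gT : finGroupType) (B : {set gT}) (chi : gT -> E).
Local Notation fun_space := {ffun gT -> E^o}.

Definition rtrans (g : gT) (u : fun_space) : fun_space := [ffun x => u (x * g)%g].
Definition equivar_defect (b x : gT) (u : fun_space) : E^o :=
  u (b * x)%g - chi b * u x.

Fact rtrans_is_linear g : linear (rtrans g).
Proof. by move=> a u v; apply/ffunP => x; rewrite !ffunE. Qed.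
HB.instance Definition _ g :=
  GRing.isLinear.Build E fun_space fun_space *:%R (rtrans g) (rtrans_is_linear g).

Fact equivar_defect_is_linear b x : linear (equivar_defect b x).
Proof.
move=> a u v; rewrite /equivar_defect !ffunE.
have sE (c y : E) : c *: (y : E^o) = c * y by [].
by rewrite !sE mulrDr opprD mulrBr addrACA mulrCA.
Qed.
HB.instance Definition _ b x :=
  GRing.isLinear.Build E fun_space E^o *:%R (equivar_defect b x)
    (equivar_defect_is_linear b x).

(* Functions u : gT -> E with u (b x) = chi b * u x for all b in B *)
Definition ind_space : {vspace fun_space} :=
  (\bigcap_(b in B) \bigcap_(x : gT) lker (linfun (equivar_defect b x)))%VS.

Lemma ind_spaceP (u : fun_space) :
  reflect (forall b x, b \in B -> u (b * x)%g = chi b * u x) (u \in ind_space).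
Proof.
apply: (iffP idP) => [|h]; last first.
  rewrite memvE; apply/subv_bigcapP => b bB; apply/subv_bigcapP => x _.
  by rewrite -memvE memv_ker lfunE /= /equivar_defect h // subrr.
rewrite memvE => /subv_bigcapP h b x bB.
have /subv_bigcapP/(_ x isT) := h b bB; rewrite -memvE memv_ker lfunE /=.
by rewrite subr_eq0 => /eqP.
Qed.

Lemma ind_space_rtrans g u : u \in ind_space -> rtrans g u \in ind_space.
Proof.
by move=> /ind_spaceP h; apply/ind_spaceP => b x bB; rewrite !ffunE -mulgA; exact: h.
Qed.

(* Matrix of the right translation by g in a basis of [ind_space], on column
   vectors *)
Definition ind_mx (g : gT) : 'M[E]_(\dim ind_space) :=
  \matrix_(i, j) coord (vbasis ind_space) i (rtrans g (vbasis ind_space)`_j).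

Fact ind_mx_repr : mx_repr [set: gT] ind_mx.
Proof.
have bV (j : 'I_(\dim ind_space)) : (vbasis ind_space)`_j \in ind_space.
  by rewrite vbasis_mem // mem_nth // size_tuple.
split=> [|g h _ _]; apply/matrixP => i j; rewrite !mxE.
  have -> : rtrans 1 (vbasis ind_space)`_j = (vbasis ind_space)`_j.
    by apply/ffunP => x; rewrite ffunE mulg1.
  have vf : free (vbasis ind_space) by exact: basis_free (vbasisP _).
  by rewrite (coord_free j i vf) eq_sym.
have -> : rtrans (g * h) (vbasis ind_space)`_j
    = rtrans g (rtrans h (vbasis ind_space)`_j).
  by apply/ffunP => x; rewrite !ffunE mulgA.
rewrite [rtrans h _](coord_vbasis (ind_space_rtrans h (bV j))).
rewrite !linear_sum; apply: eq_bigr => l _.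
by rewrite !linearZ /= !mxE mulrC.
Qed.
Definition rep_ind : rep E gT := Rep (MxRepresentation ind_mx_repr).

End Induced.

Section GL2.
Variables (k : finFieldType) (E : fieldType) (iota : {rmorphism k -> E}).
Local Notation G := {'GL_2[k]}.
Local Notation rep := (rep E G).
Local Notation q := #|k|.

Definition gl_mx (g : G) : 'M[k]_2 := GLval g.

Lemma gl_mxM g h : gl_mx (g * h)%g = gl_mx g *m gl_mx h. Proof. by []. Qed.
Lemma gl_mx_det g : \det (gl_mx g) != 0.
Proof. by rewrite -unitfE; have := GL_unit g. Qed.

Fact gl_symm_mx_repr n :
  mx_repr [set: G] (fun g => symm_mx n (map_mx iota (gl_mx g))).
Proof.
split=> [|g h _ _]; last by rewrite gl_mxM map_mxM symm_mxM.
by rewrite /gl_mx GL_1E map_mx1 symm_mx1.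
Qed.
Definition rep_symm n : rep := Rep (MxRepresentation (gl_symm_mx_repr n)).

Fact gl_det_mx_repr (m : int) :
  mx_repr [set: G] (fun g => (iota (\det (gl_mx g)) ^ m)%:M : 'M[E]_1).
Proof.
split=> [|g h _ _]; first by rewrite /gl_mx GL_1E det1 rmorph1 exp1rz.
by rewrite gl_mxM det_mulmx rmorphM /= expfzMl scalar_mxM.
Qed.
Definition rep_det (m : int) : rep := Rep (MxRepresentation (gl_det_mx_repr m)).

Definition twist (V : rep) (m : int) : rep := rep_tens V (rep_det m).

Definition borel : {set G} := [set b | gl_mx b 1 0 == 0].

(* ind_B^G of the character (a b; 0 d) |-> d^n *)
Definition princ_series (n : nat) : rep :=
  rep_ind borel (fun b => iota (gl_mx b 1 1) ^+ n).

Definition has_central_char (V : rep) (i : int) : Prop :=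
  forall (g : G) (a : k), gl_mx g = a%:M -> V g = (iota a ^ i)%:M.

(* Only the class modulo q - 1 is determined (when V != 0). *)
Definition central_char (V : rep) : int := xget 0 [set i | has_central_char V i].

Section Frobenius.
Variables (p : nat) (pk : p \in [pchar k]).

Fact gl_frob_unit (g : G) : map_mx (pFrobenius_aut pk) (GLval g) \is a GRing.unit.
Proof. by rewrite -[_ \is a _]/(_ \in unitmx) map_unitmx; exact: GL_unit. Qed.
Definition gl_frob (g : G) : G := FinRing.Unit (gl_frob_unit g).

Lemma gl_frob1 : gl_frob 1%g = 1%g.
Proof. by apply: val_inj; rewrite /= map_mx1. Qed.

Lemma gl_frobM g h : gl_frob (g * h)%g = (gl_frob g * gl_frob h)%g.
Proof. by apply: val_inj; rewrite /= map_mxM. Qed.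

Fact frob_mx_repr (V : rep) : mx_repr [set: G] (fun g => V (gl_frob g)).
Proof.
case: V => d [r [r1 rM]]; split=> [|g h _ _]; first exact: etrans (congr1 r gl_frob1) r1.
by apply: etrans (congr1 r (gl_frobM g h)) _; rewrite rM // in_setT.
Qed.
Definition rep_frob (V : rep) : rep := Rep (MxRepresentation (frob_mx_repr V)).

Definition res_degree : nat := logn p q.

(* L_n(m): the i-th base-p digit of n gives the factor Frobenius-twisted i times. *)
Definition rep_irr (n : nat) (m : int) : rep :=
  twist (\big[@rep_tens E G/rep1 E G]_(i < res_degree)
           iter i rep_frob (rep_symm ((n %/ p ^ i) %% p)%N)) m.

(* omega(n); 'I_q.-1 represents both {0, ..., q - 2} and Z/(q-1)Z. *)
Definition omega (n : nat) : nat :=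
  #|[set x : 'I_q.-1 * 'I_q.-1 |
      (0 < mult (twist (princ_series x.1) x.2%:Z) (rep_irr n 0))%N]|.

Section Norm.
Variable R : realType.
Local Notation groth := (groth R E G).

Record is_groth_norm (N : groth -> R) : Prop := IsGrothNorm {
  groth_norm_eq0 : forall x, N x = 0 -> x = 0;
  groth_normD : forall x y, N (x + y) <= N x + N y;
  groth_normZ : forall a x, N (a *: x) = `|a| * N x;
  groth_normM : forall x y, N (groth_mul x y) <= N x * N y;
  groth_norm_det : forall x, N (groth_mul x (groth_cl R (rep_det 1))) = N x;
  groth_norm_frob : forall x, N (groth_lin rep_frob x) = N x;
  groth_norm_coef : forall x n m, (n < q)%N ->
    `|groth_coef (rep_irr n m) x| <= N x }.

End Norm.
End Frobenius.
End GL2.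

(* Matrix-valued functions on an arbitrary type T, used for representations of
   the infinite group GL_2(O_K). *)
Section MatrixFamilies.
Variables (T : Type) (F : fieldType).

Record mfam : Type := MFam { mfdim : nat; mfmx :> T -> 'M[F]_mfdim }.

Definition mfam_tens (r s : mfam) : mfam := MFam (fun g => r g *t s g).
Definition mfam1 : mfam := MFam (fun=> 1%:M : 'M[F]_1).

Definition mfam_irr (r : mfam) : Prop :=
  (0 < mfdim r)%N /\
  forall U : 'M[F]_(mfdim r), (forall g, stablemx U (r g)) -> U = 0 \/ row_full U.

(* [mfam_ss r s]: s is a semisimplification of r. *)
Inductive mfam_ss : mfam -> mfam -> Prop :=
| MfamSs0 (r s : T -> 'M[F]_0) : mfam_ss (MFam r) (MFam s)
| MfamSsS d1 d2 (a : T -> 'M[F]_d1) (b b' : T -> 'M[F]_d2) (c : T -> 'M[F]_(d2, d1))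
    (P Q : 'M[F]_(d1 + d2)) (r s : T -> 'M[F]_(d1 + d2)) :
    mfam_irr (MFam a) -> mfam_ss (MFam b) (MFam b') ->
    P \in unitmx -> Q \in unitmx ->
    (forall g, r g = invmx P *m block_mx (a g) 0 (c g) (b g) *m P) ->
    (forall g, s g = invmx Q *m block_mx (a g) 0 0 (b' g) *m Q) ->
    mfam_ss (MFam r) (MFam s).

End MatrixFamilies.

Section LocalField.
Variables (p : nat) (p_pr : prime p).
Variable K : fieldExtType (Qp p_pr).

Definition Zp_K : padic_int p_pr -> K := in_alg K \o @tofrac (padic_int p_pr).
HB.instance Definition _ := GRing.RMorphism.on Zp_K.

Definition OK : Type := intcl Zp_K.
HB.instance Definition _ := GRing.ComUnitRing.on OK.

Record GL2_OK : Type := GL2OK { gl2_mx :> 'M[OK]_2; _ : gl2_mx \in unitmx }.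

Variables (k : finFieldType) (red : {rmorphism OK -> k}).

Fact gl2_red_unit (g : GL2_OK) : map_mx red (gl2_mx g) \in unitmx.
Proof.
by case: g => g /= ug; rewrite unitmxE det_map_mx rmorph_unit.
Qed.
Definition gl2_red (g : GL2_OK) : {'GL_2[k]} := FinRing.Unit (gl2_red_unit g).

Variables (Qb : fieldType) (jota : {rmorphism Qp p_pr -> Qb}).

Definition Zp_Qb : padic_int p_pr -> Qb := jota \o @tofrac (padic_int p_pr).
HB.instance Definition _ := GRing.RMorphism.on Zp_Qb.

Definition OQb : Type := intcl Zp_Qb.
HB.instance Definition _ := GRing.ComUnitRing.on OQb.

Definition is_embedding (s : {rmorphism K -> Qb}) : Prop :=
  forall a : Qp p_pr, s (a%:A) = jota a.

Definition enum_embeddings (I : finType) (tau : I -> {rmorphism K -> Qb}) : Prop :=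
  [/\ forall i, is_embedding (tau i),
      forall i j, tau i =1 tau j -> i = j
    & forall s, is_embedding s -> exists i, tau i =1 s].

(* The irreducible algebraic representation
   \bigotimes_tau (Symm^(n_tau) W_tau \otimes det_tau^(m_tau))
   of Res_(K/Q_p) GL_2, restricted to GL_2(O_K). *)
Definition alg_rep (I : finType) (tau : I -> {rmorphism K -> Qb})
    (n : I -> nat) (m : I -> int) : mfam GL2_OK Qb :=
  \big[@mfam_tens GL2_OK Qb/mfam1 GL2_OK Qb]_(i : I)
    MFam (fun g : GL2_OK => let h := map_mx (tau i) (map_mx val g) in
            (\det h) ^ (m i) *: symm_mx (n i) h).

Variables (E : fieldType) (pi : {rmorphism OQb -> E}).

(* [r] is the reduction along [pi] of a GL_2(O_K)-stable lattice of [V], the one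
   spanned over O_Qb by the columns of [P]. *)
Definition lattice_reduction (V : mfam GL2_OK Qb) (r : mfam GL2_OK E) : Prop :=
  exists (P : 'M[Qb]_(mfdim V)) (A : GL2_OK -> 'M[OQb]_(mfdim V)),
    [/\ P \in unitmx,
        forall g, map_mx val (A g) = invmx P *m V g *m P
      & r = MFam (fun g => map_mx pi (A g))].

(* [U] has the same semisimplification as the reduction of a stable lattice in
   an irreducible algebraic representation of Res_(K/Q_p) GL_2. *)
Definition is_reduction (I : finType) (tau : I -> {rmorphism K -> Qb})
    (U : rep E {'GL_2[k]}) : Prop :=
  exists (n : I -> nat) (m : I -> int) (r s : mfam GL2_OK E),
    [/\ lattice_reduction (alg_rep tau n m) r, mfam_ss r s
      & mfam_ss (MFam (fun g => U (gl2_red g))) s].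

End LocalField.

(* Main.v *)
Require Import Defs.
From HB Require Import structures.
From mathcomp Require Import all_boot all_order all_algebra all_fingroup.
From mathcomp Require Import all_field mxrepresentation mxtens freeg cyclic.
From mathcomp Require Import boolp classical_sets reals exp.
From mathcomp Require Import ring lra zify.

(* Let M = q^2 - 1 and P_N = [S_(N+M)] - [S_N]. If W has central character i and
   N' = i + p^j N mod q - 1, then
     [W] [S_(N+M)^[j]] = [W] [S_N^[j]] + dim W * P_N',
   because both sides of the corresponding identity without signs have the same
   characteristic polynomials (Brauer-Nesbitt). Dickson's exact sequence
   0 -> V_N -> S_N -> S_(N-q-1)(1) -> 0 gives P_N = sum_(i < q-1) V_(N-2i)(i), and
   principal series are multiplicity free, as a Singer cycle acts on them with
   distinct eigenvalues; hence L_n(m) has coefficient omega(n) in P_N if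
   n + 2m = N mod q - 1, and 0 otherwise.
   Ring morphisms from O_K to a field of characteristic p are Frobenius twists of
   the residue map, so [U] is a product of at most h classes S_(n_i)^[j_i](e_i).
   Writing the largest n_i as a + b M with a < M, the identity reduces it to a.
   The error is at most a constant times the norm of the product of [W] and the
   other factors, which is O(||W|| prod (n_i + 1)) over these factors, and this
   is O(||W|| (dim U)^(1 - 1/h)). It involves dim W, which is at most ||W|| since
   [W] acts as dim W on the nonzero element sum_(N < q-1) P_N. *)

Set Implicit Arguments.
Unset Strict Implicit.
Unset Printing Implicit Defensive.

Import Order.TTheory GRing.Theory Num.Theory.
Local Open Scope ring_scope.

(** * Characteristic polynomials *)

(** Traces in characteristic p see multiplicities only modulo p; characteristic polynomials
    determine them exactly and stay inside E, so no Brauer lift is chosen. The price is that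
    identities of classes are stated between two lists of genuine representations. M is a multiple
    of the order of every eigenvalue, since eigenvalues of g lie in the field with q^2 elements.
    With u = b/a of order o, a period of M terms w a^N u^l is a union of full cycles of u, so its
    polynomial depends on w a^N only through the o-th power. This is where the central character of
    W enters, and why W multiplies P_N' by a mere number. A Frobenius twist permutes the cycle of u,
    so the twist j survives on the right only in the index N'. Each period adds M dim W to the
    dimension and omega(n) dim W to the coefficient: this is the main term omega(n) dim V / M. The
    exponent comes from the factor that is reduced: if x is the largest dimension and D the product
    of the others, then D <= x^(h-1), that is D <= (D x)^(1-1/h). *)

Lemma char_poly_lblock (R : comNzRingType) m n (A : 'M[R]_m) C (B : 'M[R]_n) :
  char_poly (block_mx A 0 C B) = char_poly A * char_poly B.
Proof.
by rewrite /char_poly /char_poly_mx map_block_mx map_mx0 scalar_mx_block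
  opp_block_mx add_block_mx !subr0 det_lblock.
Qed.

Lemma char_poly_intertwine (R : comUnitRingType) n (P A A' : 'M[R]_n) :
  P \in unitmx -> A *m P = P *m A' -> char_poly A = char_poly A'.
Proof.
move=> uP AP; pose Pp := map_mx (@polyC R) P.
pose Qp := map_mx (@polyC R) (invmx P).
have QP : \det Qp * \det Pp = 1 by rewrite -det_mulmx -map_mxM mulVmx // map_mx1 det1.
have : char_poly_mx A *m Pp = Pp *m char_poly_mx A'.
  by rewrite mulmxBl mulmxBr scalar_mxC -!map_mxM AP.
move/(congr1 determinant); rewrite !det_mulmx mulrC => /(congr1 ( *%R (\det Qp))).
by rewrite !mulrA QP !mul1r.
Qed.

Lemma char_poly_conj (R : comUnitRingType) n (P A : 'M[R]_n) :
  P \in unitmx -> char_poly (invmx P *m A *m P) = char_poly A.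
Proof.
by move=> uP; apply: (@char_poly_intertwine _ _ (invmx P));
  rewrite ?unitmx_inv // mulmxK.
Qed.

(** A section [t] of [s] completes [i] to a basis in which [A] is block triangular with diagonal
    blocks [A'] and [A'']. *)
Lemma char_poly_exact (F : fieldType) n' n n'' (A' : 'M[F]_n') (A : 'M_n)
    (A'' : 'M_n'') (i : 'M_(n', n)) (s : 'M_(n, n'')) :
  row_free i -> row_full s -> (i :=: kermx s)%MS ->
  A' *m i = i *m A -> A *m s = s *m A'' ->
  char_poly A = char_poly A' * char_poly A''.
Proof.
move=> fi fs e iA sA.
have dn : n = (n' + n'')%N.
  have: \rank i = \rank (kermx s) by rewrite e.
  rewrite mxrank_ker (eqP fi) (eqP fs) => ->.
  by rewrite subnK // -{1}(eqP fs) rank_leq_row.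
subst n; have is0 := ses_mul0 e.
have /row_freeP[j ij] := fi; have /row_fullP[t ts] := fs.
pose P := col_mx i t.
(* The inverse comes from a right inverse [j] of [i], corrected so that [t] kills it. *)
have uP : P \in unitmx.
  have : P *m row_mx (j - s *m t *m j) s = 1%:M.
    rewrite mul_col_row !mulmxBr !mulmxA is0 !mul0mx ij subr0 ts mul1mx subrr.
    by rewrite -scalar_mx_block.
  by case/mulmx1_unit.
have : (t *m A - A'' *m t <= i)%MS.
  by rewrite e; apply/sub_kermxP; rewrite mulmxBl -!mulmxA sA ts mulmxA ts mul1mx mulmx1 subrr.
case/submxP => c /eqP; rewrite subr_eq => /eqP tA.
rewrite -(char_poly_lblock _ c); symmetry.
apply: (@char_poly_intertwine _ _ P) => //.
by rewrite mul_block_col mul0mx addr0 iA mul_col_mx tA addrC.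
Qed.

Lemma char_poly0 (R : comNzRingType) (A : 'M[R]_0) : char_poly A = 1.
Proof. by rewrite /char_poly det_mx00. Qed.

Lemma char_poly_scalar (R : comNzRingType) n (c : R) :
  char_poly (c%:M : 'M_n) = ('X - c%:P) ^+ n.
Proof.
rewrite char_poly_trig; last first.
  by apply/is_trig_mxP => i j ij; rewrite mxE -val_eqE ltn_eqF.
by under eq_bigr => i _ do rewrite mxE eqxx mulr1n; rewrite prodr_const card_ord.
Qed.

Section ClosedField.
Variable F : closedFieldType.

Lemma eigs_subproof n (A : 'M[F]_n) :
  {r : seq F | char_poly A = \prod_(z <- r) ('X - z%:P)}.
Proof.
have [r Er] := closed_field_poly_normal (char_poly A).
by exists r; rewrite [LHS]Er (monicP (char_poly_monic A)) scale1r.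
Qed.
Definition eigs n (A : 'M[F]_n) : seq F := sval (eigs_subproof A).

Lemma char_poly_eigs n (A : 'M[F]_n) : char_poly A = \prod_(z <- eigs A) ('X - z%:P).
Proof. exact: svalP (eigs_subproof A). Qed.

Lemma size_eigs n (A : 'M[F]_n) : size (eigs A) = n.
Proof.
by have := size_char_poly A; rewrite char_poly_eigs size_prod_XsubC => -[].
Qed.

Lemma mem_eigs n (A : 'M[F]_n) z : (z \in eigs A) = eigenvalue A z.
Proof. by rewrite eigenvalue_root_char char_poly_eigs root_prod_XsubC. Qed.

Lemma mxtrace_eigs n (A : 'M[F]_n) : \tr A = \sum_(z <- eigs A) z.
Proof.
case: n A => [|n] A.
  by rewrite /mxtrace big_ord0; have := size_eigs A; case: (eigs A) => // _; rewrite big_nil.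
apply: oppr_inj; rewrite -char_poly_trace // char_poly_eigs.
by have := @coefPn_prod_XsubC _ (eigs A); rewrite size_eigs => ->.
Qed.

Lemma trigonalize n (A : 'M[F]_n) :
  exists P T : 'M_n, [/\ P \in unitmx, is_trig_mx T & P *m A = T *m P].
Proof.
elim: n A => [|n IH] A.
  exists 1%:M, 0; split; rewrite ?unitmx1 //; first by apply/is_trig_mxP => -[].
  by rewrite mul0mx mul1mx; apply/matrixP => -[].
have : eigs A != [::] by rewrite -size_eq0 size_eigs.
case Ea: (eigs A) => [//|a s] _.
have /eigenvalueP[v vA v0] : eigenvalue A a by rewrite -mem_eigs Ea mem_head.
(* To complete [v] to a basis, take the row base of the rank-one matrix [v]: it is invertible and
   its first row is proportional to [v]. *)
have [Q uQ [c c0 vQ]] : exists2 Q : 'M_(1 + n), Q \in unitmx &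
    exists2 c, c != 0 & v = c *: row 0 Q.
  exists (row_ebase v); first exact: row_ebase_unit.
  exists (col_ebase v 0 0).
    by have := col_ebase_unit v; rewrite unitmxE det_mx11 unitfE.
  rewrite -{1}(mulmx_ebase v) rank_rV v0 [col_ebase v]mx11_scalar -mulmxA mul_scalar_mx.
  rewrite [in RHS]mxE mulr1n rowE; congr (_ *: _); congr (_ *m _); apply/rowP => j; rewrite
    !mxE.
  by rewrite eqxx /= andbT eq_sym.
have rA : row 0 Q *m A = a *: row 0 Q.
  by apply: (scalerI c0); rewrite scalemxAl -vQ vA vQ !scalerA mulrC.
have blk (M : 'M[F]_(1 + n)) : row 0 M = a *: delta_mx 0 0 ->
    M = block_mx a%:M 0 (dlsubmx M) (drsubmx M).
  move=> rM; rewrite -[LHS]submxK; congr block_mx; apply/matrixP => i j.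
    have := congr1 (fun N : 'rV_(1 + n) => N 0 (lshift n j)) rM.
    by rewrite !mxE !ord1 (_ : lshift n 0 = 0) ?eqxx ?mulr1n ?mulr1 //; apply: val_inj.
  have := congr1 (fun N : 'rV_(1 + n) => N 0 (rshift 1 j)) rM.
  by rewrite !mxE !ord1 (_ : lshift n 0 = 0) /= ?mulr0 //; apply: val_inj.
pose B := Q *m A *m invmx Q : 'M_(1 + n).
have EB : B = block_mx a%:M 0 (dlsubmx B) (drsubmx B).
  apply: blk; rewrite !row_mul rA -scalemxAl -row_mul mulmxV // rowE mulmx1.
  by congr (_ *: _).
have [P [T [uP tT PT]]] := IH (drsubmx B).
pose P1 : 'M_(1 + n) := block_mx 1%:M 0 0 P.
have uP1 : P1 \in unitmx by rewrite unitmxE det_lblock det1 mul1r -unitmxE.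
pose T1 : 'M_(1 + n) := block_mx a%:M 0 (P *m dlsubmx B) T.
have tT1 : is_trig_mx T1.
  rewrite is_trig_block_mx ?eqxx //= tT andbT; apply/is_trig_mxP => i j.
  by rewrite !ord1.
have PT1 : P1 *m block_mx a%:M 0 (dlsubmx B) (drsubmx B) = T1 *m P1.
  by rewrite !mulmx_block !mul1mx !mulmx0 !mul0mx !mulmx1 !addr0 !add0r PT.
exists (P1 *m Q), T1; split => //.
  by rewrite unitmx_mul uQ uP1.
have -> : P1 *m Q *m A = P1 *m B *m Q by rewrite !mulmxA mulmxKV.
by rewrite EB mulmxA PT1.
Qed.

(** After triangularising both factors, the tensor product is triangular for the lexicographic
    order, which is the order of the indices [i1 * n + i2]. *)
Lemma char_poly_tens m n (A : 'M[F]_m) (B : 'M[F]_n) :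
  char_poly (A *t B) = \prod_(a <- eigs A) \prod_(b <- eigs B) ('X - (a * b)%:P).
Proof.
have [P [T [uP tT PT]]] := trigonalize A; have [Q [S [uQ tS QS]]] := trigonalize B.
have trig_eigs k (M N U : 'M[F]_k) : U \in unitmx -> is_trig_mx N -> U *m M = N *m U ->
    perm_eq (eigs M) [seq N i i | i <- enum 'I_k].
  move=> uU tN UN; apply: prod_XsubC_eq; rewrite -char_poly_eigs big_map big_enum /=.
  by rewrite -char_poly_trig //; apply/esym/(char_poly_intertwine uU).
have -> : char_poly (A *t B) = char_poly (T *t S).
  apply/esym/(@char_poly_intertwine _ _ (P *t Q)); first by rewrite -row_free_unit
    tensmx_row_free ?row_free_unit.
  by rewrite !tensmx_mul PT QS.
rewrite char_poly_trig; last first.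
  apply/is_trig_mxP => i j; case: (mxtens_indexP i) => i1 i2; case: (mxtens_indexP j) => j1 j2.
  rewrite tensmxE /= => ij; have [lt1|] := ltnP i1 j1.
    by rewrite (is_trig_mxP tT) ?mul0r.
  rewrite leq_eqVlt => /predU1P[e1|lt1].
    by rewrite [S _ _](is_trig_mxP tS) ?mulr0 // -(ltn_add2l (i1 * n)) -{2}e1.
  have : (i1 * n + i2 < i1 * n)%N.
    apply: (leq_trans ij); apply: leq_trans (leq_mul lt1 (leqnn n)).
    by rewrite mulSn addnC leq_add2r ltnW.
  by rewrite ltnNge leq_addr.
rewrite (perm_big _ (trig_eigs _ _ _ _ uP tT PT)) big_map big_enum /=.
under [RHS]eq_bigr => i _ do rewrite (perm_big _ (trig_eigs _ _ _ _ uQ tS QS)) big_map big_enum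
  /=.
rewrite pair_big /= (reindex (fun ij => mxtens_index ij)) /=; last first.
  by exists (@mxtens_unindex m n) => x _; rewrite ?mxtens_indexK ?mxtens_unindexK.
by apply: eq_bigr => -[i j] _ /=; rewrite tensmxE.
Qed.

End ClosedField.

(** * Brauer-Nesbitt theorem *)

Section BrauerNesbitt.
Variables (F : closedFieldType) (gT : finGroupType).
Local Notation rep := (rep F gT).
Implicit Types V W L : rep.

Local Notation irr V := (mx_irreducible (rep_mx V)).
Local Notation sim V W := (mx_rsim (rep_mx V) (rep_mx W)).

Lemma irr_hom_rsim V L (B : 'M_(rdim V, rdim L)) :
  irr V -> irr L -> B != 0 -> (forall g, V g *m B = B *m L g) -> sim V L.
Proof.
move=> /mx_irrP[V0 iV] /mx_irrP[L0 iL] nzB homB.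
have modK : mxmodule V (kermx B).
  by apply/mxmoduleP => g _; rewrite sub_kermx -mulmxA homB mulmxA mulmx_ker mul0mx.
have modI : mxmodule L <<B>>%MS.
  rewrite (eqmx_module _ (genmxE _)); apply/mxmoduleP => g _.
  by rewrite -homB submxMl.
have fB : row_free B.
  rewrite -kermx_eq0; apply: contraTT nzB => nzK; rewrite negbK.
  by have /row_fullP[t tK] := iV _ modK nzK; rewrite -[B]mul1mx -tK -mulmxA mulmx_ker mulmx0.
have uB : row_full B.
  by have := iL _ modI; rewrite -mxrank_eq0 genmxE mxrank_eq0 => /(_ nzB);
    rewrite -sub1mx genmxE sub1mx.
by exists B => //; rewrite -(eqP fB) -[in RHS](eqP uB).
Qed.

Lemma gring_mxE V a : gring_mx V a = \sum_(j < #|[set: gT]|) a 0 j *: V (enum_val j).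
Proof.
rewrite /gring_mx /= mulmx_sum_row linear_sum; apply: eq_bigr => j _.
by rewrite linearZ /= rowK mxvecK.
Qed.

(** Burnside's theorem: over an algebraically closed field an irreducible representation is
    absolutely irreducible, so the group algebra maps onto all matrices. *)
Lemma irr_gring_surj V (A : 'M_(rdim V)) : irr V -> exists a, gring_mx V a = A.
Proof.
move/(group_closure_closed_field) => /andP[_ /row_fullP[X XE]].
by exists (mxvec A *m X); rewrite /gring_mx /= -mulmxA XE mulmx1 mxvecK.
Qed.

(** The group algebra is handled through rows of coefficients; right multiplication by [b] is then
    its matrix in the regular representation. *)
Definition gring_one : 'rV[F]_#|[set: gT]| := gring_row 1%:M.
Definition gring_mul (a b : 'rV[F]_#|[set: gT]|) := a *m gring_mx (regular_repr F [set: gT]%G)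
  b.

Lemma gring_mx_one V : gring_mx V gring_one = 1%:M.
Proof. exact: gring_op1. Qed.

Lemma gring_mx_mul V a b : gring_mx V (gring_mul a b) = gring_mx V a *m gring_mx V b.
Proof. exact: gring_mxA. Qed.

(** Otherwise whatever kills [L] kills [V]. Let [e] act on [L] as a diagonal matrix unit and let [w]
    be a nonzero row of the action of [e] on [V]. If [d u = 0] in [L], then [e u] kills [L], hence
    [V], so [w u = 0]. Thus [d a -> w a] is a well defined nonzero morphism from [L] to [V], against
    Schur's lemma. *)
Lemma irr_separated V L : irr V -> irr L -> ~ sim L V ->
  exists2 a, gring_mx L a = 0 & gring_mx V a != 0.
Proof.
move=> irrV irrL nVL; apply: contrapT => nex.
have kerLV a : gring_mx L a = 0 -> gring_mx V a = 0.
  by move=> La; apply/eqP/negPn/negP => Va; apply: nex; exists a.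
pose ek (k : 'I_(rdim L)) := projT1 (cid (irr_gring_surj (delta_mx k k) irrL)).
have ekE k : gring_mx L (ek k) = delta_mx k k by rewrite /ek; case: cid.
(* The [ek k] sum to the identity on [L], hence on [V], so they cannot all kill [V]. *)
have [o eo] : exists k, gring_mx V (ek k) != 0.
  apply: contrapT => no; have /kerLV/eqP : gring_mx L (\sum_k ek k - gring_one) = 0.
    rewrite linearB linear_sum /= gring_mx_one; apply/eqP; rewrite subr_eq0; apply/eqP.
    by rewrite [RHS]mx1_sum_delta; apply: eq_bigr.
  rewrite linearB linear_sum /= gring_mx_one big1 ?sub0r ?oppr_eq0.
    by case/mx_irrP: irrV => V0 _; rewrite -mxrank_eq0 mxrank1 eqn0Ngt V0.
  by move=> k _; apply/eqP/negPn/negP => Vk; apply: no; exists k.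
have [i wn0] : exists i, row i (gring_mx V (ek o)) != 0.
  apply: contrapT => no; case/eqP: eo; apply/row_matrixP => i; rewrite row0.
  by apply/eqP/negPn/negP => ?; apply: no; exists i.
set w := row i _ in wn0; set e := ek o in eo w wn0.
pose d : 'rV[F]_(rdim L) := delta_mx 0 o.
(* [X'] and [X] are the orbit maps [a -> d a] and [a -> w a]. As the kernel of [X'] lies in that of
   [X], the latter factors as [X' *m B], and [B] is the morphism sought. *)
pose X' := \matrix_(j < #|[set: gT]|) (d *m L (enum_val j)).
pose X := \matrix_(j < #|[set: gT]|) (w *m V (enum_val j)).
have X'E u : u *m X' = d *m gring_mx L u.
  rewrite gring_mxE mulmx_sum_row mulmx_sumr; apply: eq_bigr => j _.
  by rewrite rowK -scalemxAr.
have XE u : u *m X = w *m gring_mx V u.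
  rewrite gring_mxE mulmx_sum_row mulmx_sumr; apply: eq_bigr => j _.
  by rewrite rowK -scalemxAr.
have sK : (kermx X' <= kermx X)%MS.
  apply/row_subP => k; apply/sub_kermxP; set u := row k _.
  have : u *m X' = 0 by rewrite -row_mul mulmx_ker row0.
  rewrite X'E XE => du; have /kerLV : gring_mx L (gring_mul e u) = 0.
    rewrite gring_mx_mul ekE -(mul_delta_mx (0 : 'I_1)) -mulmxA.
    by rewrite -/d du mulmx0.
  by rewrite gring_mx_mul /w -row_mul => ->; rewrite row0.
have X'B : X' *m (pinvmx X' *m X) = X.
  apply/eqP; rewrite -subr_eq0 mulmxA -[X in _ - X]mul1mx -mulmxBl; apply/eqP/sub_kermxP.
  by apply: submx_trans sK; apply/sub_kermxP; rewrite mulmxBl mul1mx mulmxKpV ?subrr.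
have fX' : row_full X'.
  rewrite -sub1mx; apply/row_subP => k.
  have [a La] := irr_gring_surj (delta_mx o k) irrL.
  by apply/submxP; exists a; rewrite X'E La mul_delta_mx row1.
apply: nVL; apply: (@irr_hom_rsim _ _ (pinvmx X' *m X)) => // [|h].
  apply: contraNneq wn0 => B0; rewrite -[w]mulmx1 -(gring_mx_one V) -XE -X'B B0.
  by rewrite !mulmx0.
have /row_fullP[t tX'] := fX'.
apply: (can_inj (g := fun Y => t *m Y) (f := fun Y => X' *m Y)) => [Y|].
  by rewrite mulmxA tX' mul1mx.
rewrite /= [RHS]mulmxA X'B mulmxA; apply/row_matrixP => j; rewrite row_mul.
pose l := enum_rank_in (group1 [set: gT]%G) (enum_val j * h)%g.
have -> : row j (X' *m L h) = row l X'.
  by rewrite row_mul !rowK -mulmxA -repr_mxM ?inE // enum_rankK_in ?inE.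
by rewrite -row_mul X'B row_mul !rowK -mulmxA -repr_mxM ?inE // enum_rankK_in ?inE.
Qed.

(** Linear independence of the matrix coefficients of non-isomorphic irreducibles. For [a] killing
    the head [L] but not [V], testing on [c a b] removes the term of [L]; by induction [M V] times
    [V c] times [V a] vanishes for all [c]. Since [V c] is an arbitrary matrix and [V a] is nonzero,
    [M V = 0]. *)
Lemma irr_trace_free (s : seq rep) (M : forall V, 'M[F]_(rdim V)) :
  uniq s -> {in s, forall V, irr V} -> {in s &, forall V W, V != W -> ~ sim V W} ->
  (forall a, \sum_(V <- s) \tr (M V *m gring_mx V a) = 0) -> {in s, forall V, M V = 0}.
Proof.
elim: s M => [//|L s IH] M /= /andP[Ls us] irrs nsim tr0.
have irrL : irr L by apply: irrs; rewrite mem_head.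
have M0 : {in s, forall V, M V = 0}.
  move=> V Vs; have irrV : irr V by apply: irrs; rewrite inE Vs orbT.
  have [a La Va] : exists2 a, gring_mx L a = 0 & gring_mx V a != 0.
    apply: irr_separated => //; apply: nsim; rewrite ?inE ?eqxx ?Vs ?orbT //.
    by apply: contraNneq Ls => ->.
  have MV0 c : M V *m gring_mx V c *m gring_mx V a = 0.
    apply: (IH (fun W => M W *m gring_mx W c *m gring_mx W a)) => //.
    - by move=> W Ws; apply: irrs; rewrite inE Ws orbT.
    - by move=> W W' Ws Ws'; apply: nsim; rewrite inE ?Ws ?Ws' orbT.
    - move=> b; have := tr0 (gring_mul c (gring_mul a b)).
      rewrite big_cons !gring_mx_mul La mul0mx !mulmx0 mxtrace0 add0r => trs.
      by rewrite -[RHS]trs; apply: eq_bigr => W _; rewrite !gring_mx_mul !mulmxA.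
  apply/matrixP => i j; rewrite [RHS]mxE; apply: contraNeq Va => Mij.
  apply/eqP/matrixP => k l; rewrite [RHS]mxE.
  have [c Vc] := irr_gring_surj (delta_mx j k) irrV.
  have := MV0 c; rewrite Vc -mulmxA => /matrixP/(_ i l)/eqP.
  rewrite [X in _ == X]mxE [X in X == _]mxE (bigD1 j) //= big1 => [|x xj]; last first.
    by rewrite mxE big1 ?mulr0 // => y _; rewrite mxE (negbTE xj) mul0r.
  rewrite mxE (bigD1 k) //= big1 => [|x xk]; last by rewrite mxE (negbTE xk) andbF mul0r.
  by rewrite mxE !eqxx mul1r !addr0 mulf_eq0 (negbTE Mij) => /eqP.
move=> V; rewrite inE => /predU1P[->|]; last exact: M0.
apply/matrixP => i j; rewrite [RHS]mxE.
have [a La] := irr_gring_surj (delta_mx j i) irrL.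
have := tr0 a; rewrite big_cons [X in _ + X]big_seq_cond big1 => [|W /andP[Ws _]]; last first.
  by rewrite M0 // mul0mx mxtrace0.
rewrite addr0 La /mxtrace (bigD1 i) //= big1 => [|x xi]; last first.
  by rewrite mxE big1 // => y _; rewrite mxE (negbTE xi) andbF mulr0.
rewrite mxE (bigD1 j) //= big1 => [|x xj]; last by rewrite mxE (negbTE xj) mulr0.
by rewrite mxE !eqxx mulr1 !addr0.
Qed.

End BrauerNesbitt.

Lemma natr_inj_modp (F : fieldType) p (pF : p \in [pchar F]) m n : m%:R = n%:R :> F -> (m = n
  %[mod p])%N.
Proof.
wlog le_nm : m n / (n <= m)%N => [W|] e.
  by case: (leqP n m) => [/W|/ltnW/W]; [apply | move=> h; apply/esym/h].
by apply/eqP; rewrite eqn_mod_dvd // (dvdn_pcharf pF) natrB // e subrr.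
Qed.

(** * Composition factors are determined by characteristic polynomials *)

Section CompositionCounts.
Variables (F : closedFieldType) (gT : finGroupType).
Local Notation rep := (rep F gT).
Implicit Types V W L : rep.

Local Notation irr V := (mx_irreducible (rep_mx V)).
Local Notation sim V W := (mx_rsim (rep_mx V) (rep_mx W)).

Lemma flatten_nseq_eigs n (A : 'M[F]_n) c :
  char_poly A ^+ c = \prod_(z <- flatten (nseq c (eigs A))) ('X - z%:P).
Proof.
elim: c => [|c IH]; first by rewrite big_nil.
by rewrite exprS /= big_cat /= IH -char_poly_eigs.
Qed.

Lemma sum_flatten_nseq_eigs n (A : 'M[F]_n) c :
  \sum_(z <- flatten (nseq c (eigs A))) z = c%:R * \tr A.
Proof.
elim: c => [|c IH]; first by rewrite big_nil mul0r.
by rewrite /= big_cat /= IH -mxtrace_eigs mulrS mulrDl mul1r.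
Qed.

(** Equal products have the same roots with multiplicity, and the traces are the sums of these
    roots. *)
Lemma char_poly_prod_trace (s : seq rep) (c c' : rep -> nat) g :
  \prod_(V <- s) char_poly (V g) ^+ c V = \prod_(V <- s) char_poly (V g) ^+ c' V ->
  \sum_(V <- s) (c V)%:R * \tr (V g) = \sum_(V <- s) (c' V)%:R * \tr (V g).
Proof.
pose ef (f : rep -> nat) := flatten [seq flatten (nseq (f V) (eigs (V g))) | V <- s].
have prodE f : \prod_(V <- s) char_poly (V g) ^+ f V = \prod_(z <- ef f) ('X - z%:P).
  rewrite big_flatten big_map; apply: eq_bigr => V _; exact: flatten_nseq_eigs.
have sumE f : \sum_(V <- s) (f V)%:R * \tr (V g) = \sum_(z <- ef f) z.
  by rewrite big_flatten big_map; apply: eq_bigr => V _; rewrite sum_flatten_nseq_eigs.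
by rewrite !prodE !sumE => /prod_XsubC_eq e; apply: perm_big.
Qed.

Variables (p : nat) (pF : p \in [pchar F]).

Lemma exprp_inj (A B : {poly F}) : A ^+ p = B ^+ p -> A = B.
Proof.
move=> AB; apply/eqP; rewrite -subr_eq0.
have pP : p \in [pchar {poly F}] by rewrite pchar_poly.
have : (A - B) ^+ p = 0 by rewrite -(pFrobenius_autE pP) rmorphB /= !pFrobenius_autE AB subrr.
by move/eqP; rewrite expf_eq0 => /andP[].
Qed.

(* Traces determine the multiplicities modulo p; once the common residues are
   divided out, both sides are p-th powers, and induction on the size applies. *)
Lemma char_poly_prod_inj (s : seq rep) (c c' : rep -> nat) :
  uniq s -> {in s, forall V, irr V} -> {in s &, forall V W, V != W -> ~ sim V W} ->
  (forall g, \prod_(V <- s) char_poly (V g) ^+ c V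
    = \prod_(V <- s) char_poly (V g) ^+ c' V) ->
  {in s, c =1 c'}.
Proof.
move=> us irrs nsim.
have p1 : (1 < p)%N by apply: prime_gt1; exact: pcharf_prime pF.
pose N := (\max_(V <- s) maxn (c V) (c' V)).+1.
have : {in s, forall V, (c V < N)%N /\ (c' V < N)%N}.
  move=> V Vs; have le : (maxn (c V) (c' V) <= \max_(V <- s) maxn (c V) (c' V))%N.
    by rewrite (bigD1_seq V) //= leq_maxl.
  by rewrite !ltnS; split; apply: leq_trans le; rewrite ?leq_maxl ?leq_maxr.
move: N => N; elim: N c c' => [|N IH] c c' lt e V Vs; first by case: (lt V Vs).
have tr0 a : \sum_(V <- s) \tr (((c V)%:R - (c' V)%:R)%:M *m gring_mx V a) = 0.
  transitivity (\sum_(V <- s) \sum_j a 0 j * (((c V)%:R - (c' V)%:R) * \tr (V (enum_val j)))).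
    apply: eq_bigr => W _; rewrite mul_scalar_mx mxtraceZ gring_mxE linear_sum mulr_sumr.
    by apply: eq_bigr => j _; rewrite /= mxtraceZ mulrCA.
  rewrite exchange_big big1 //= => j _; rewrite -mulr_sumr.
  under eq_bigr => W _ do rewrite mulrBl.
  by rewrite sumrB (char_poly_prod_trace (e _)) subrr mulr0.
have cong W : W \in s -> (c W = c' W %[mod p])%N.
  move=> Ws; apply: (natr_inj_modp pF); apply/eqP; rewrite -subr_eq0; apply/eqP.
  have := irr_trace_free us irrs nsim tr0 Ws.
  have /mx_irrP[W0 _] := irrs W Ws.
  by move/matrixP/(_ (Ordinal W0) (Ordinal W0)); rewrite !mxE eqxx mulr1n.
have div_lt m : (m < N.+1)%N -> (m %/ p < N)%N \/ m = 0%N /\ N = 0%N.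
  case: m => [|m] mN; last by left; apply: leq_trans (ltn_Pdiv p1 _) _.
  by case: N {IH lt e cong mN} => [|N]; [right | left; rewrite div0n].
have [ltc ltc'] := lt V Vs.
have [lN|[-> N0]] := div_lt _ ltc; last first.
  by apply/eqP; rewrite eq_sym -leqn0 -ltnS -N0.
have N0 : (0 < N)%N by apply: leq_trans lN.
have dE : {in s, forall W, c W %/ p = c' W %/ p}%N.
  apply: IH => [W Ws|g].
    by have [/div_lt[?|[_ N0']] /div_lt[?|[_ N0'']]] := lt W Ws; rewrite ?N0' ?N0'' in N0.
  apply: exprp_inj; rewrite -!prodrXl.
  have := e g.
  have modE (f : rep -> nat) : \prod_(V <- s) char_poly (V g) ^+ f V =
      \prod_(V <- s) char_poly (V g) ^+ (f V %% p) *
      \prod_(V <- s) (char_poly (V g) ^+ (f V %/ p)) ^+ p.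
    rewrite -big_split; apply: eq_bigr => W _ /=.
    by rewrite -exprM -exprD addnC -divn_eq.
  rewrite (modE c) (modE c').
  have -> : \prod_(V <- s) char_poly (V g) ^+ (c V %% p) =
      \prod_(V <- s) char_poly (V g) ^+ (c' V %% p).
    by apply: eq_big_seq => W Ws; rewrite cong.
  apply: mulfI; rewrite monic_neq0 // monic_prod // => W _.
  by rewrite monic_exp // char_poly_monic.
by rewrite (divn_eq (c V) p) dE // cong // -divn_eq.
Qed.

Lemma char_poly_sim V W g : sim V W -> char_poly (V g) = char_poly (W g).
Proof.
case: V => n r; case: W => n' r' /= [B e fB homB]; subst n'.
by apply: (@char_poly_intertwine _ _ B); rewrite -?row_free_unit // homB ?inE.
Qed.

Local Notation "V =~ W" := (`[< sim V W >]) (at level 70).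

Lemma simb_eqr V W W' : sim W W' -> (V =~ W) = (V =~ W').
Proof.
move=> WW'; apply/asboolP/asboolP => h; apply: (mx_rsim_trans h) => //.
exact: mx_rsim_sym.
Qed.

Lemma sim_representatives (t : seq rep) : {in t, forall V, irr V} ->
  exists s, [/\ uniq s, {in s, forall V, irr V},
    {in s &, forall V W, V != W -> ~ sim V W} &
    {in t, forall V, exists2 W, W \in s & sim V W}].
Proof.
elim: t => [|V t IH] irrt; first by exists [::].
case: IH => [W Wt|s [us irrs nsim st]]; first by apply: irrt; rewrite inE Wt orbT.
have [[W Ws VW]|no] := pselect (exists2 W, W \in s & sim V W).
  by exists s; split=> // X; rewrite inE => /predU1P[->|/st //]; exists W.
exists (V :: s); split.
- rewrite /= us andbT; apply/negP => Vs; apply: no; exists V => //.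
  exact: mx_rsim_refl.
- by move=> W; rewrite inE => /predU1P[->|/irrs //]; apply: irrt; rewrite mem_head.
- move=> X Y; rewrite !inE => /predU1P[->|Xs] /predU1P[->|Ys]; rewrite ?eqxx //.
  + by move=> _ XY; apply: no; exists Y.
  + by move=> _ XY; apply: no; exists X => //; exact: mx_rsim_sym.
  + exact: nsim.
- move=> X; rewrite inE => /predU1P[->|/st[W Ws XW]].
    by exists V; [rewrite mem_head | exact: mx_rsim_refl].
  by exists W => //; rewrite inE Ws orbT.
Qed.

Section Representatives.
Variable s : seq rep.
Hypotheses (us : uniq s) (nsim : {in s &, forall V W, V != W -> ~ sim V W}).

(** [iterop] reads as a power or as a multiple according to the law, so that one statement serves
    characteristic polynomials and classes. *)
Lemma big_sim_count (T : Type) (idx : T) (op : Monoid.com_law idx) (f : rep -> T)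
    (t : seq rep) : (forall V W, sim V W -> f V = f W) ->
  {in t, forall V, exists2 W, W \in s & sim V W} ->
  \big[op/idx]_(V <- t) f V
    = \big[op/idx]_(W <- s) iterop (count (fun V => V =~ W) t) op (f W) idx.
Proof.
move=> fsim; have iteropS n x : iterop n.+1 op x idx = op x (iterop n op x idx).
  by rewrite !Monoid.iteropE iterS.
elim: t => [|V t IH] st; first by rewrite big_nil big1.
rewrite big_cons IH => [|X Xt]; last by apply: st; rewrite inE Xt orbT.
have [W Ws VW] := st V (mem_head _ _).
rewrite [RHS](bigD1_seq W) // [in LHS](bigD1_seq W) //= Monoid.mulmA.
rewrite [V =~ W](asboolT VW) add1n iteropS (fsim _ _ VW); congr (op _ _).
rewrite big_seq_cond [RHS]big_seq_cond; apply: eq_bigr => X /andP[Xs XW].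
suff -> : V =~ X = false by [].
apply/asboolP => VX; apply: (nsim Xs Ws XW).
exact: mx_rsim_trans (mx_rsim_sym VX) VW.
Qed.
End Representatives.

Lemma count_irr_unique (t t' : seq rep) :
  {in t, forall V, irr V} -> {in t', forall V, irr V} ->
  (forall g, \prod_(V <- t) char_poly (V g) = \prod_(V <- t') char_poly (V g)) ->
  forall L, count (fun V => V =~ L) t = count (fun V => V =~ L) t'.
Proof.
move=> irrt irrt' e L.
have irrtt : {in t ++ t', forall V, irr V}.
  by move=> V; rewrite mem_cat => /orP[/irrt|/irrt'].
have [s [us irrs nsim st]] := sim_representatives irrtt.
have prodE t0 g : {subset t0 <= t ++ t'} -> \prod_(V <- t0) char_poly (V g)
    = \prod_(W <- s) char_poly (W g) ^+ count (fun V => V =~ W) t0.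
  move=> sub; apply: (@big_sim_count s us nsim {poly F} 1 _ (fun V : rep => char_poly (V g))
    t0).
    by move=> V W; exact: char_poly_sim.
  by move=> V /sub; exact: st.
have cs : {in s, (fun W => count (fun V => V =~ W) t) =1 (fun W => count (fun V => V =~ W) t')}.
  apply: char_poly_prod_inj => // g; rewrite -!prodE // => V Vt;
    by rewrite mem_cat Vt ?orbT.
have [[V Vtt VL]|no] := pselect (exists2 V, V \in t ++ t' & sim V L).
  have [W Ws VW] := st V Vtt; have WL := mx_rsim_trans (mx_rsim_sym VW) VL.
  have cL t0 : count (fun V => V =~ L) t0 = count (fun V => V =~ W) t0.
    by apply: eq_count => X /=; rewrite (simb_eqr _ WL).
  by rewrite !cL cs.
have c0 t0 : {subset t0 <= t ++ t'} -> count (fun V => V =~ L) t0 = 0%N.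
  move=> sub; apply/eqP; rewrite eqn0Ngt -has_count; apply/hasP => -[V /sub Vt /asboolP VL].
  by apply: no; exists V.
by rewrite !c0 // => V Vt; rewrite mem_cat Vt ?orbT.
Qed.

Fact rep0_mx_repr : mx_repr [set: gT] (fun=> 1%:M : 'M[F]_0).
Proof. by split=> // g h _ _; rewrite mulmx1. Qed.
Definition rep0 : rep := Rep (MxRepresentation rep0_mx_repr).

(** In dimension 0 the sequence from [V] to [V] to [V] is exact, so [V] = 2 [V]. *)
Lemma groth_cl_dim0 (R : comNzRingType) V : rdim V = 0%N -> groth_cl R V = 0.
Proof.
case: V => n r /= n0; subst n; set V := Rep r.
have : ses V V V.
  have mx0 (A : 'M[F]_0) : A = 0 by apply/matrixP => -[].
  exists (0 : 'M_0), (0 : 'M_0); split; rewrite ?/row_free ?/row_full ?mxrank0 //.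
  - by rewrite /= [kermx _]mx0.
  - by move=> g; rewrite mulmx0 mul0mx.
  - by move=> g; rewrite mulmx0 mul0mx.
by move/(groth_cl_ses R)/eqP; rewrite -subr_eq0 opprD addrA subrr sub0r oppr_eq0 => /eqP.
Qed.

(** An isomorphism is a short exact sequence whose third term is [rep0]. *)
Lemma groth_cl_sim (R : comNzRingType) V W : sim V W -> groth_cl R V = groth_cl R W.
Proof.
case=> B dV fB homB; rewrite (@groth_cl_ses R _ _ V W rep0); first by rewrite [groth_cl R
  rep0]groth_cl_dim0 ?addr0.
exists B, (0 : 'M_(_, 0)); split=> // [||g|g].
- by rewrite /row_full mxrank0.
- apply: (@ses_of_rank _ _ V W rep0) => //=; last by rewrite addn0.
    by rewrite /row_full mxrank0.
  by rewrite mulmx0.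
- by rewrite homB ?inE.
- by rewrite mul0mx mulmx0.
Qed.

Section Series.
Variable V : rep.
Variables A B : 'M[F]_(rdim V).
Hypotheses (modA : mxmodule V A) (modB : mxmodule V B) (sAB : (A <= B)%MS).

(** Translates a step of a composition series, given by row spaces, into the exact sequences that
    define the Grothendieck group. *)
Lemma ses_section : ses (Rep (submod_repr modA)) (Rep (submod_repr modB))
                        (Rep (section_repr modA modB)).
Proof.
pose i : 'M_(\rank A, \rank B) := in_submod B (val_submod 1%:M).
pose W := <<in_factmod A B>>%MS.
pose s : 'M_(\rank B, \rank W) := in_submod W (in_factmod A (val_submod 1%:M)).
have vA : (val_submod (1%:M : 'M_(\rank A)) :=: A)%MS by exact: val_submod1.
have vB : (val_submod (1%:M : 'M_(\rank B)) :=: B)%MS by exact: val_submod1.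
have fW m (X : 'M_(m, _)) : (X <= B)%MS -> (in_factmod A X <= W)%MS.
  by move=> XB; rewrite genmxE submxMr.
have iE : val_submod i = val_submod 1%:M by rewrite in_submodK // vA.
have sE m (X : 'M_(m, \rank B)) : val_submod (X *m s) = in_factmod A (val_submod X).
  rewrite [LHS]val_submodE -mulmxA -[s *m _]val_submodE in_submodK ?fW ?vB //.
  by rewrite [val_submod X]val_submodE [LHS]mulmxA.
have fi : row_free i.
  by rewrite /row_free mxrank_in_submod ?vA ?vA // -{2}(eqmx_rank vA).
have rW : (\rank W + \rank A)%N = \rank B.
  by rewrite genmxE mxrank_in_factmod (addsmx_idPr sAB).
have fs : row_full s.
  rewrite /row_full mxrank_in_submod ?fW ?vB // -(eqn_add2r (\rank A)) rW.
  by rewrite mxrank_in_factmod (adds_eqmx (eqmx_refl A) vB) (addsmx_idPr sAB).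
have is0 : i *m s = 0.
  apply: (@val_submod_inj _ _ W); rewrite sE iE linear0; apply/eqP.
  by rewrite in_factmod_eq0 vA.
exists i, s; split=> // [|g|g].
- by apply: (@ses_of_rank _ _ (Rep (submod_repr modA)) (Rep (submod_repr modB)) (Rep
  (section_repr modA modB))); rewrite //= addnC.
- apply: (@val_submod_inj _ _ B); rewrite /= val_submodJ ?inE // iE.
  rewrite val_submodE -mulmxA -val_submodE iE -val_submodE.
  by rewrite -[submod_mx modA g]mul1mx val_submodJ ?inE.
- apply: (@val_submod_inj _ _ W); rewrite /= sE val_submodJ ?inE //.
  rewrite -[submod_mx modB g]mul1mx val_submodJ ?inE // in_factmodJ ?inE //.
  by congr (_ *m _); rewrite -[s]mul1mx sE.
Qed.
End Series.

End CompositionCounts.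

Section Factors.
Variables (F : closedFieldType) (gT : finGroupType).
Local Notation rep := (rep F gT).
Implicit Types V W L : rep.
Local Notation irr V := (mx_irreducible (rep_mx V)).
Local Notation sim V W := (mx_rsim (rep_mx V) (rep_mx W)).
Local Notation "V =~ W" := (`[< sim V W >]) (at level 70).
Variables (p : nat) (pF : p \in [pchar F]).

Lemma char_poly_ses V' V V'' g : ses V' V V'' ->
  char_poly (V g) = char_poly (V' g) * char_poly (V'' g).
Proof.
by case=> i [s] [fi fs e iV sV]; exact: (char_poly_exact fi fs e (iV g) (sV g)).
Qed.

Definition series_factors V U (cU : mx_composition_series V U) : seq rep :=
  [seq Rep (series_repr i cU) | i <- iota 0 (size U)].

Lemma series_factors_irr V U (cU : mx_composition_series V U) :
  {in series_factors cU, forall L, irr L}.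
Proof.
move=> L /mapP[i]; rewrite mem_iota add0n => iU ->.
exact: mx_series_repr_irr.
Qed.

Lemma series_factors_sum V U (cU : mx_composition_series V U) :
  (last 0 U :=: 1%:M)%MS ->
  (forall g, char_poly (V g) = \prod_(L <- series_factors cU) char_poly (L g)) /\
  (forall R : comNzRingType, groth_cl R V = \sum_(L <- series_factors cU) groth_cl R L).
Proof.
move=> lU; pose t j := [seq Rep (series_repr i cU) | i <- iota 0 j].
have main j (modj : mxmodule V (0 :: U)`_j) : (j <= size U)%N ->
    (forall g, char_poly (submod_repr modj g) = \prod_(L <- t j) char_poly (L g)) /\
    (forall R : comNzRingType,
      groth_cl R (Rep (submod_repr modj)) = \sum_(L <- t j) groth_cl R L).
  elim: j modj => [|j IH] modj jU.
    have r0 : \rank ((0 :: U)`_0) = 0%N by rewrite mxrank0.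
    split=> [g|R]; rewrite big_nil; last by rewrite groth_cl_dim0.
    by move: (submod_repr modj g); rewrite r0 => M; exact: char_poly0.
  have [_ maxU] := cU; have [/ltmxW sU _] := maxU j jU.
  have := ses_section (mx_subseries_module' j (proj1 cU)) (mx_subseries_module j (proj1 cU)) sU.
  rewrite (bool_irrelevance (mx_subseries_module j (proj1 cU)) modj) => eU.
  have [IH1 IH2] := IH (mx_subseries_module' j (proj1 cU)) (ltnW jU).
  have tS : t j.+1 = rcons (t j) (Rep (series_repr j cU)).
    by rewrite /t -addn1 iotaD map_cat cats1.
  split=> [g|R]; rewrite tS big_rcons /=.
  - by rewrite (char_poly_ses g eU) /= IH1 mulrC; congr (_ * _).
  - rewrite (groth_cl_ses R eU) IH2; congr (_ + groth_cl R _).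
    by rewrite /series_repr /subseries_repr (bool_irrelevance (mx_subseries_module j (proj1
      cU)) modj).
have modn := mx_subseries_module' (size U) (proj1 cU).
have [h1 h2] := main _ modn (leqnn _).
have simV : mx_rsim (submod_repr modn) (rep_mx V).
  by apply: rsim_submod1; rewrite -last_nth.
split=> [g|R]; first by rewrite -h1; apply/esym/(@char_poly_sim _ _ (Rep (submod_repr modn)) V).
by rewrite -h2; apply/esym/groth_cl_sim.
Qed.

Lemma composition_series_exists V :
  exists U (cU : mx_composition_series V U), (last 0 U :=: 1%:M)%MS.
Proof.
have := @mx_Schreier _ _ _ _ (rep_mx V) [::] isT isT.
(* [mx_Schreier] yields the series only under a double negation. *)
by move/classicP => /contrapT[U [cU lU _]]; exists U, cU.
Qed.

(** [mult] counts in a series picked by [xget]. Another series has the same product of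
    characteristic polynomials, hence the same count; the default 0 never occurs, as a series
    exists. *)
Lemma mult_series V L U (cU : mx_composition_series V U) : (last 0 U :=: 1%:M)%MS ->
  mult V L = count (fun W => W =~ L) (series_factors cU).
Proof.
move=> lU; rewrite /mult; set S := (X in xget _ X).
have cS U' (cU' : mx_composition_series V U') : (last 0 U' :=: 1%:M)%MS ->
    #|[set i : 'I_(size U') | `[< mx_rsim (series_repr i cU') L >]]%SET|
      = count (fun W => W =~ L) (series_factors cU).
  move=> lU'; transitivity (count (fun W => W =~ L) (series_factors cU')).
    rewrite cardsE -sum1_card -sum1_count big_map.
    have -> : iota 0 (size U') = index_iota 0 (size U') by rewrite /index_iota subn0.
    by rewrite big_mkord.
  apply: (count_irr_unique pF (series_factors_irr (cU := _)) (series_factors_irr (cU := _))) =>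
    g.
  by rewrite -(proj1 (series_factors_sum cU' lU')) -(proj1 (series_factors_sum cU lU)).
case: xgetP => [c _ [U' [cU' [lU' ->]]]|/(_ _) no]; first exact: cS.
by case: (no #|[set i : 'I_(size U) | `[< mx_rsim (series_repr i cU) L >]]%SET|); exists U, cU.
Qed.

Lemma composition_factors V : exists t : seq rep,
  [/\ {in t, forall L, irr L},
      forall g, char_poly (V g) = \prod_(L <- t) char_poly (L g),
      forall R : comNzRingType, groth_cl R V = \sum_(L <- t) groth_cl R L &
      forall L, mult V L = count (fun W => W =~ L) t].
Proof.
have [U [cU lU]] := composition_series_exists V.
have [h1 h2] := series_factors_sum cU lU.
exists (series_factors cU); split=> // [|L]; first exact: series_factors_irr.
exact: mult_series.
Qed.

Lemma factors_of_list (s : seq rep) : exists t : seq rep,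
  [/\ {in t, forall L, irr L},
      forall g, \prod_(V <- s) char_poly (V g) = \prod_(L <- t) char_poly (L g),
      forall R : comNzRingType, \sum_(V <- s) groth_cl R V = \sum_(L <- t) groth_cl R L &
      forall L, (\sum_(V <- s) mult V L)%N = count (fun W => W =~ L) t].
Proof.
elim: s => [|V s [t [irrt cht grt mt]]].
  by exists [::]; split=> // *; rewrite !big_nil.
have [t' [irrt' cht' grt' mt']] := composition_factors V.
exists (t' ++ t); split=> [L|g|R|L].
- by rewrite mem_cat => /orP[/irrt'|/irrt].
- by rewrite big_cons big_cat cht' cht.
- by rewrite big_cons big_cat grt' grt.
- by rewrite big_cons count_cat mt' mt.
Qed.

(** A list stands for the direct sum of its members; an identity with signs is brought to this form
    by moving its negative terms across. *)
Lemma brauer_nesbitt (s s' : seq rep) :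
  (forall g, \prod_(V <- s) char_poly (V g) = \prod_(V <- s') char_poly (V g)) ->
  (forall R : comNzRingType, \sum_(V <- s) groth_cl R V = \sum_(V <- s') groth_cl R V) /\
  (forall L, \sum_(V <- s) mult V L = \sum_(V <- s') mult V L)%N.
Proof.
move=> e; have [t [irrt cht grt mt]] := factors_of_list s.
have [t' [irrt' cht' grt' mt']] := factors_of_list s'.
have ct : forall L, count (fun V => V =~ L) t = count (fun V => V =~ L) t'.
  by apply: (count_irr_unique pF irrt irrt') => g; rewrite -cht -cht' e.
split=> [R|L]; last by rewrite mt mt' ct.
rewrite grt grt'.
have irrtt : {in t ++ t', forall V, irr V}.
  by move=> V; rewrite mem_cat => /orP[/irrt|/irrt'].
have [r [ur irrr nsim rt]] := sim_representatives irrtt.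
have sumE t0 : {subset t0 <= t ++ t'} -> \sum_(V <- t0) groth_cl R V
    = \sum_(W <- r) iterop (count (fun V => V =~ W) t0) +%R (groth_cl R W) 0.
  move=> sub; apply: (@big_sim_count _ _ r ur nsim (groth R F gT) 0 _ (fun V : rep => groth_cl
    R V) t0).
    by move=> V W; exact: groth_cl_sim.
  by move=> V /sub; exact: rt.
rewrite !sumE; last 2 first.
- by move=> V Vt; rewrite mem_cat Vt orbT.
- by move=> V Vt; rewrite mem_cat Vt.
by apply: eq_bigr => W _; rewrite ct.
Qed.

Lemma groth_cl_char_poly (R : comNzRingType) V W :
  (forall g, char_poly (V g) = char_poly (W g)) -> groth_cl R V = groth_cl R W.
Proof.
move=> e; have [] := @brauer_nesbitt [:: V] [:: W] _.
  by move=> g; rewrite !big_seq1.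
by move/(_ R); rewrite !big_seq1.
Qed.

Lemma mult_ses V' V V'' L : ses V' V V'' -> mult V L = (mult V' L + mult V'' L)%N.
Proof.
move=> eV; have [] := @brauer_nesbitt [:: V] [:: V'; V''] _.
  by move=> g; rewrite big_seq1 big_cons big_seq1; exact: char_poly_ses.
by move=> _ /(_ L); rewrite big_seq1 big_cons big_seq1.
Qed.

Lemma mult_char_poly_dvd V L : forall g, char_poly (L g) ^+ mult V L %| char_poly (V g).
Proof.
have [t [irrt cht _ mt]] := composition_factors V.
move=> g; rewrite cht mt; elim: t {irrt cht mt} => [|W t IH].
  by rewrite big_nil expr0 dvd1p.
rewrite big_cons /= exprD; apply: dvdp_mul => //.
case: asboolP => [/char_poly_sim ->|_]; first by rewrite expr1.
by rewrite expr0 dvd1p.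
Qed.

Lemma mult_irr V L : (0 < mult V L)%N -> irr L.
Proof.
have [t [irrt _ _ ->]] := composition_factors V.
rewrite -has_count => /hasP[W /irrt iW /asboolP WL].
exact/(mx_rsim_irr WL).
Qed.

End Factors.

(** * The Grothendieck ring *)

Section Eigs.
Variable F : closedFieldType.

Lemma eigs_tens m n (A : 'M[F]_m) (B : 'M[F]_n) :
  perm_eq (eigs (A *t B)) [seq a * b | a <- eigs A, b <- eigs B].
Proof.
by apply: prod_XsubC_eq; rewrite -char_poly_eigs char_poly_tens big_allpairs_dep.
Qed.

Lemma eigs_scalar n (c : F) : eigs (c%:M : 'M_n) = nseq n c.
Proof.
have : perm_eq (eigs (c%:M : 'M_n)) (nseq n c).
  apply: prod_XsubC_eq; rewrite -char_poly_eigs char_poly_scalar.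
  by rewrite big_nseq -Monoid.iteropE.
move=> /perm_all e; have /all_pred1P -> : all (pred1 c) (eigs (c%:M : 'M_n)).
  by rewrite e all_pred1_nseq.
by rewrite size_eigs.
Qed.
End Eigs.

Section GrothendieckRing.
Variables (R : comNzRingType) (F : closedFieldType) (gT : finGroupType).
Local Notation rep := (rep F gT).
Local Notation groth := (groth R F gT).
Implicit Types (V W L : rep) (x y z : groth).

Definition groth_fun (phi : rep -> R) (x : groth) : R := fglift (phi : rep -> R^o) (grepr x).

Section Fun.
Variable phi : rep -> R.
Hypothesis phiD : forall V' V V'', ses V' V V'' -> phi V = phi V' + phi V''.

(** Additivity of [phi] makes its linear extension vanish on [ses_rel], hence the choice made by
    [grepr] is immaterial. *)
Lemma groth_fun_gpi (x : {freeg rep / R}) : groth_fun phi (gpi x) = fglift (phi : rep -> R^o) x.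
Proof.
pose l := fglift (phi : rep -> R^o).
have lD a u v : l (a *: u + v) = a * l u + l v by exact: fglift_linear.
have lB u v : l (u - v) = l u - l v.
  have -> : u - v = -1 *: v + u by rewrite scaleN1r addrC.
  by rewrite lD mulN1r addrC.
apply/eqP; rewrite -subr_eq0 -lB; case: (grepr_gpi x) => s [Ss ->].
elim: s Ss => [|u s IH] Ss; first by rewrite big_nil /l fglift0.
rewrite big_cons lD; have [V' [V [V'' [eV ->]]]] := Ss u (mem_head _ _).
have lU W : l << W >> = phi W by rewrite /l liftU scale1r.
rewrite !lB !lU (phiD eV) addrAC addrK subrr mulr0 add0r.
by apply/IH => v vs; apply: Ss; rewrite inE vs orbT.
Qed.

Lemma groth_fun_cl V : groth_fun phi (groth_cl R V) = phi V.
Proof. by rewrite groth_fun_gpi liftU scale1r. Qed.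

Lemma groth_fun_linear a x y :
  groth_fun phi (a *: x + y) = a * groth_fun phi x + groth_fun phi y.
Proof.
rewrite -[x]gpiK -[y]gpiK -[a *: _]gpiZ -gpiD !groth_fun_gpi.
exact: (@fglift_linear R _ R^o).
Qed.

Lemma groth_funB x y : groth_fun phi (x - y) = groth_fun phi x - groth_fun phi y.
Proof.
have -> : x - y = -1 *: y + x by rewrite scaleN1r addrC.
by rewrite groth_fun_linear mulN1r addrC.
Qed.

Lemma groth_fun0 : groth_fun phi 0 = 0.
Proof. by rewrite -[X in groth_fun _ X](subrr 0) groth_funB subrr. Qed.

Lemma groth_funD x y : groth_fun phi (x + y) = groth_fun phi x + groth_fun phi y.
Proof. by rewrite -[x]scale1r groth_fun_linear mul1r scale1r. Qed.

Lemma groth_funZ a x : groth_fun phi (a *: x) = a * groth_fun phi x.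
Proof. by rewrite -[a *: x]addr0 groth_fun_linear groth_fun0 addr0. Qed.

Lemma groth_fun_sum I (r : seq I) (P : pred I) (f : I -> groth) :
  groth_fun phi (\sum_(i <- r | P i) f i) = \sum_(i <- r | P i) groth_fun phi (f i).
Proof. exact: (big_morph _ groth_funD groth_fun0). Qed.
End Fun.

Lemma groth_ind (P : groth -> Prop) : P 0 ->
  (forall a V x, P x -> P (a *: groth_cl R V + x)) -> forall x, P x.
Proof.
move=> P0 PS x; rewrite -[x]gpiK -[grepr x]freeg_sumE.
elim: (dom _) => [|V s IH].
  by rewrite big_nil; have -> : gpi (0 : {freeg rep / R}) = 0; first by rewrite -[X in gpi
    X](subrr 0) gpiB subrr.
rewrite big_cons gpiD.
have -> : << coeff V (grepr x) *g V >> = coeff V (grepr x) *: << V >> :> {freeg rep / R}.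
  by apply/eqP/freeg_eqP => W; rewrite coeffZ !coeffU mul1r.
by rewrite gpiZ; exact: PS.
Qed.

Lemma groth_mul0l x : groth_mul 0 x = 0.
Proof. by have := groth_mul_linearl (-1) (0 : groth) 0 x; rewrite scaler0 addr0 scaleN1r addNr.
  Qed.

Lemma groth_mul0r x : groth_mul x 0 = 0.
Proof. by have := groth_mul_linearr (-1) (0 : groth) 0 x; rewrite scaler0 addr0 scaleN1r addNr.
  Qed.

Lemma groth_mulZr a x y : groth_mul x (a *: y) = a *: groth_mul x y.
Proof. by rewrite -[a *: y]addr0 groth_mul_linearr groth_mul0r addr0. Qed.

Lemma groth_mulDr x y z : groth_mul x (y + z) = groth_mul x y + groth_mul x z.
Proof. by rewrite -[y]scale1r groth_mul_linearr !scale1r. Qed.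

Lemma groth_mulDl x y z : groth_mul (y + z) x = groth_mul y x + groth_mul z x.
Proof. by rewrite -[y]scale1r groth_mul_linearl !scale1r. Qed.

Lemma groth_mul_sumr I (r : seq I) (P : pred I) (f : I -> groth) x :
  groth_mul x (\sum_(i <- r | P i) f i) = \sum_(i <- r | P i) groth_mul x (f i).
Proof. by apply: (big_morph (groth_mul x)) => [u v|]; rewrite ?groth_mulDr ?groth_mul0r. Qed.

Variables (p : nat) (pF : p \in [pchar F]).

(** Bilinearity reduces the ring axioms to classes of representations, and there it is enough to
    compare products of eigenvalues: no explicit isomorphism of tensor products is written. *)
Lemma groth_mulC : commutative (@groth_mul R F gT).
Proof.
elim/groth_ind => [y|a V x IH y]; first by rewrite groth_mul0l groth_mul0r.
rewrite groth_mul_linearl groth_mul_linearr IH; congr (_ *: _ + _).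
elim/groth_ind: y => [|b W z IHz]; first by rewrite groth_mul0l groth_mul0r.
rewrite groth_mul_linearl groth_mul_linearr IHz; congr (_ *: _ + _).
rewrite -!groth_cl_tens; apply: (groth_cl_char_poly pF) => g.
rewrite /= !char_poly_tens exchange_big; apply: eq_bigr => u _; apply: eq_bigr => v _.
by rewrite mulrC.
Qed.

Lemma groth_mulA : associative (@groth_mul R F gT).
Proof.
elim/groth_ind => [y z|a U x IH y z]; first by rewrite !groth_mul0l.
rewrite !groth_mul_linearl IH; congr (_ *: _ + _).
elim/groth_ind: y => [|b V y IHy]; first by rewrite groth_mul0l !groth_mul0r groth_mul0l.
rewrite groth_mul_linearr !groth_mul_linearl groth_mul_linearr IHy; congr (_ *: _ + _).
elim/groth_ind: z {IH IHy} => [|c W z IHz]; first by rewrite !groth_mul0r.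
rewrite !groth_mul_linearr IHz; congr (_ *: _ + _).
rewrite -!groth_cl_tens; apply: (groth_cl_char_poly pF) => g.
rewrite /= [LHS]char_poly_tens [RHS]char_poly_tens (perm_big _ (eigs_tens _ _)) /=
  big_allpairs_dep /=.
apply: eq_bigr => u _; rewrite (perm_big _ (eigs_tens _ _)) /= big_allpairs_dep /=.
by apply: eq_bigr => v _; apply: eq_bigr => w _; rewrite mulrA.
Qed.

Lemma groth_mul1l : left_id (groth_cl R (rep1 F gT)) (@groth_mul R F gT).
Proof.
elim/groth_ind => [|a V x IH]; first by rewrite groth_mul0r.
rewrite groth_mul_linearr IH; congr (_ *: _ + _).
rewrite -!groth_cl_tens; apply: (groth_cl_char_poly pF) => g.
rewrite /= char_poly_tens eigs_scalar big_seq1 char_poly_eigs.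
by apply: eq_bigr => v _; rewrite mul1r.
Qed.

End GrothendieckRing.

Lemma groth_coefE (R : comNzRingType) (F : closedFieldType) (gT : finGroupType)
    (L : rep F gT) : @groth_coef R F gT L = groth_fun (fun V => (mult V L)%:R).
Proof. by []. Qed.

Section Additive.
Variables (R : comNzRingType) (F : closedFieldType) (gT : finGroupType).
Implicit Types V L : rep F gT.

Lemma mult_additive p (pF : p \in [pchar F]) L V' V V'' : ses V' V V'' ->
  (mult V L)%:R = (mult V' L)%:R + (mult V'' L)%:R :> R.
Proof. by move=> eV; rewrite (mult_ses pF _ eV) natrD. Qed.

Lemma rdim_additive V' V V'' : ses V' V V'' ->
  (rdim V)%:R = (rdim V')%:R + (rdim V'')%:R :> R.
Proof. by move=> eV; rewrite (ses_dim eV) natrD. Qed.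
End Additive.

(** * Periodicity of symmetric powers *)

Lemma symm_mx_unit (A : comUnitRingType) n (P : 'M[A]_2) : P \in unitmx -> symm_mx n P \in
  unitmx.
Proof.
move=> uP; have : symm_mx n P *m symm_mx n (invmx P) = 1%:M.
  by rewrite -symm_mxM mulmxV // symm_mx1.
by case/mulmx1_unit.
Qed.

(** When [T 0 1 = 0], the polynomial giving column [j] is a multiple of ['X^j]; its lowest
    coefficient is the diagonal entry. *)
Lemma symm_mx_trig (A : comNzRingType) n (T : 'M[A]_2) : is_trig_mx T ->
  is_trig_mx (symm_mx n T) /\
  forall i, symm_mx n T i i = T 0 0 ^+ (n - i) * T 1 1 ^+ i.
Proof.
move=> /is_trig_mxP tT; have T01 : T 0 1 = 0 by exact: tT.
have E i j : symm_mx n T i j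
    = if (i < j)%N then 0 else (((T 0 0)%:P + T 1 0 *: 'X) ^+ (n - j))`_(i - j) * T 1 1 ^+ j.
  rewrite mxE T01 add0r exprZn -scalerAr coefZ coefMXn.
  by case: ifP => _; rewrite ?mulr0 // mulrC.
split=> [|i]; first by apply/is_trig_mxP => i j ij; rewrite E ij.
rewrite E ltnn subnn -horner_coef0 horner_exp !hornerE.
by congr (_ ^+ _ * _); rewrite ?mulr0 ?addr0.
Qed.

Lemma char_poly_symm_trig (A : comUnitRingType) n (P T g : 'M[A]_2) :
  P \in unitmx -> is_trig_mx T -> P *m g = T *m P ->
  char_poly (symm_mx n g) = \prod_(i < n.+1) ('X - (T 0 0 ^+ (n - i) * T 1 1 ^+ i)%:P).
Proof.
move=> uP tT Pg; have [tS dS] := symm_mx_trig n tT.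
transitivity (char_poly (symm_mx n T)).
  by symmetry; apply: (char_poly_intertwine (symm_mx_unit n uP)); rewrite -!symm_mxM Pg.
by rewrite char_poly_trig //; apply: eq_bigr => i _; rewrite dS.
Qed.

Lemma prod_prim_root (F : fieldType) o (u c : F) : o.-primitive_root u -> c != 0 ->
  \prod_(i < o) ('X - (c * u ^+ i)%:P) = 'X^o - (c ^+ o)%:P.
Proof.
move=> pu c0; have o0 := prim_order_gt0 pu.
pose rs := [seq c * u ^+ i | i <- index_iota 0 o].
have -> : \prod_(i < o) ('X - (c * u ^+ i)%:P) = \prod_(z <- rs) ('X - z%:P).
  by rewrite big_map big_mkord.
have := @all_roots_prod_XsubC _ ('X^o - (c ^+ o)%:P) rs.
rewrite (monicP (monicXnsubC _ o0)) scale1r => <- //.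
- by rewrite size_XnsubC // size_map size_iota subn0.
- apply/allP => z /mapP[i _ ->]; rewrite rootE !hornerE exprMn.
  by rewrite exprAC (prim_expr_order pu) expr1n mulr1 subrr.
- rewrite uniq_rootsE map_inj_in_uniq ?iota_uniq // => i j.
  rewrite !mem_index_iota /= => io jo /(mulfI c0)/eqP.
  by rewrite (eq_prim_root_expr pu) !modn_small // => /eqP.
Qed.

(** With [c = a^n] and [u = b / a], [geom_prod n.+1 c u] is the characteristic polynomial of Symm^n
    of an element with eigenvalues a and b. *)
Definition geom_prod (F : fieldType) n (c u : F) := \prod_(i < n) ('X - (c * u ^+ i)%:P).

Lemma geom_prodD (F : fieldType) m n (c u : F) :
  geom_prod (m + n) c u = geom_prod m c u * geom_prod n (c * u ^+ m) u.
Proof.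
rewrite /geom_prod big_split_ord /=; congr (_ * _); apply: eq_bigr => i _.
by rewrite exprD mulrA.
Qed.

(** Over complete cycles of [u] only [c ^+ o] is visible; this freedom is what makes the period
    insensitive to [W]. *)
Lemma geom_prod_prim (F : fieldType) o t (u c : F) : o.-primitive_root u -> c != 0 ->
  geom_prod (t * o) c u = ('X^o - (c ^+ o)%:P) ^+ t.
Proof.
move=> pu c0; elim: t => [|t IH]; first by rewrite mul0n /geom_prod big_ord0.
rewrite mulSn geom_prodD (prim_expr_order pu) mulr1 IH exprS; congr (_ * _).
exact: prod_prim_root.
Qed.

Lemma ord2P (i : 'I_2) : i = 0 \/ i = 1.
Proof. by case: i => [[|[|//]] ?]; [left|right]; apply: val_inj. Qed.

Lemma mulmx2E (A : pzSemiRingType) (X Y : 'M[A]_2) i j :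
  (X *m Y) i j = X i 0 * Y 0 j + X i 1 * Y 1 j.
Proof.
rewrite mxE big_ord_recl big_ord1.
by have -> : fintype.lift ord0 ord0 = 1 :> 'I_2 by apply: val_inj.
Qed.

(** The last clause is used for [n] equal to the characteristic, where it makes the power scalar. *)
Lemma trig_mx2X (A : comNzRingType) (S : 'M[A]_2) n : is_trig_mx S ->
  [/\ (S ^+ n) 0 0 = S 0 0 ^+ n, (S ^+ n) 1 1 = S 1 1 ^+ n, (S ^+ n) 0 1 = 0 &
      S 0 0 = S 1 1 -> (S ^+ n) 1 0 = n%:R * S 0 0 ^+ n.-1 * S 1 0].
Proof.
move=> /is_trig_mxP tS; have S01 : S 0 1 = 0 by exact: tS.
elim: n => [|n [IH00 IH11 IH01 IH10]]; first by rewrite !expr0 !mxE !mul0r.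
rewrite !exprS !mulmx2E IH00 IH11 IH01 S01 !mul0r !mulr0 !addr0 ?add0r; split=> // S00.
rewrite IH10 // -S00; case: n {IH00 IH11 IH01 IH10} => [|n] /=; first by rewrite !mul0r mulr0
  addr0 !expr0 !mulr1 mul1r.
by rewrite exprS -[in RHS]natr1; ring.
Qed.

Section GL2Eigen.
Variables (k : finFieldType) (E : closedFieldType) (iota : {rmorphism k -> E}).
Local Notation G := {'GL_2[k]}.
Local Notation q := #|k|.
Variables (p : nat) (pk : p \in [pchar k]).

Lemma pchar_iota : p \in [pchar E].
Proof. exact: (@rmorph_pchar k E iota p pk). Qed.

Lemma iota_inj : injective iota. Proof. exact: fmorph_inj. Qed.

Lemma expp_inj (x y : E) : x ^+ p = y ^+ p -> x = y.
Proof. by rewrite -!(pFrobenius_autE pchar_iota); exact: fmorph_inj. Qed.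

Lemma map_gl_frob (g : G) :
  map_mx iota (gl_mx (gl_frob pk g)) = map_mx (pFrobenius_aut pchar_iota) (map_mx iota (gl_mx
    g)).
Proof.
apply/matrixP => i j; rewrite !mxE /=.
by rewrite [iota _]rmorphXn.
Qed.

Lemma char_poly_iter_frob j (V : rep E G) (g : G) :
  char_poly (iter j (rep_frob pk) V g) = char_poly (V (iter j (gl_frob pk) g)).
Proof. by elim: j g => [//|j IH] g; rewrite [in RHS]iterSr -IH. Qed.

(** All Frobenius twists of [g] are triangularised together, with the Frobenius images of one
    ordered pair on the diagonal. *)
Definition eigen_pair (g : G) (a b : E) :=
  forall j, exists P T : 'M[E]_2,
  [/\ P \in unitmx, is_trig_mx T, T 0 0 = a ^+ (p ^ j), T 1 1 = b ^+ (p ^ j) &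
      P *m map_mx iota (gl_mx (iter j (gl_frob pk) g)) = T *m P].

Lemma trig_eigen_pair (g : G) (P T : 'M[E]_2) : P \in unitmx -> is_trig_mx T ->
  P *m map_mx iota (gl_mx g) = T *m P -> eigen_pair g (T 0 0) (T 1 1).
Proof.
move=> uP tT PT; elim=> [|j [P' [T' [uP' tT' T00 T11 PT']]]].
  by exists P, T; rewrite !expn0 !expr1.
pose fr := map_mx (m := 2) (n := 2) (pFrobenius_aut pchar_iota).
exists (fr P'), (fr T'); split.
- by rewrite map_unitmx.
- by apply/is_trig_mxP => i l il; rewrite mxE (is_trig_mxP tT') // rmorph0.
- by rewrite mxE pFrobenius_autE T00 expnSr exprM.
- by rewrite mxE pFrobenius_autE T11 expnSr exprM.
- by rewrite iterS map_gl_frob -!map_mxM PT'.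
Qed.

Lemma gl_trig (g : G) : exists a b : E, [/\ a != 0, b != 0 & eigen_pair g a b].
Proof.
have [P [T [uP tT PT]]] := trigonalize (map_mx iota (gl_mx g)).
have uT : \det T != 0.
  have : \det P * iota (\det (gl_mx g)) = \det T * \det P.
    by rewrite -det_map_mx -!det_mulmx PT.
  move=> e; apply: contraNneq (gl_mx_det g) => T0; apply: contraTT (uP) => g0.
  rewrite unitmxE unitfE negbK; move/eqP: e; rewrite T0 mul0r mulf_eq0 fmorph_eq0.
  by rewrite (negbTE g0) orbF.
move: (uT); rewrite det_trig // big_ord_recl big_ord1 mulf_eq0 negb_or.
have -> : fintype.lift ord0 ord0 = 1 :> 'I_2 by apply: val_inj.
case/andP=> a0 b0; exists (T 0 0), (T 1 1); split=> //.
exact: (trig_eigen_pair uP tT PT).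
Qed.

Lemma char_poly_symm_frob g a b j n : eigen_pair g a b -> a != 0 ->
  char_poly (iter j (rep_frob pk) (rep_symm iota n) g)
    = geom_prod n.+1 (a ^+ (p ^ j) ^+ n) ((b / a) ^+ (p ^ j)).
Proof.
move=> ab a0; have [P [T [uP tT T00 T11 PT]]] := ab j.
rewrite char_poly_iter_frob (char_poly_symm_trig n uP tT PT).
apply: eq_bigr => i _; congr ('X - _%:P); rewrite T00 T11 expr_div_n exprMn exprVn.
have iN : (i <= n)%N by rewrite -ltnS.
have -> : a ^+ (p ^ j) ^+ n = a ^+ (p ^ j) ^+ (n - i) * a ^+ (p ^ j) ^+ i.
  by rewrite -exprD subnK.
by rewrite -mulrA; congr (_ * _); rewrite mulrCA mulfV ?mulr1 // !expf_neq0.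
Qed.

Lemma iotaX_card x : iota x ^+ q = iota x.
Proof. by rewrite -rmorphXn expf_card. Qed.

Lemma q_pfactor : q = (p ^ res_degree k p)%N.
Proof. exact: (card_pprimeChar pk). Qed.

Lemma q_gt1 : (1 < q)%N. Proof. exact: card_finNzRing_gt1. Qed.

Lemma pchar_nat_q : [pchar E].-nat q.
Proof.
rewrite q_pfactor pnatX; apply/orP; left.
by rewrite pnatE ?pchar_iota //; exact: pcharf_prime pk.
Qed.

Lemma horner_expq (f : {poly k}) x : (map_poly iota f).[x ^+ q] = (map_poly iota f).[x] ^+ q.
Proof.
elim/poly_ind: f => [|f c IH]; first by rewrite rmorph0 !horner0 expr0n gtn_eqF // (ltnW q_gt1).
rewrite rmorphD rmorphM /= map_polyX map_polyC !hornerMXaddC IH /= exprDn_pchar ?pchar_nat_q //.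
by rewrite exprMn iotaX_card.
Qed.

Lemma expq_inj (x y : E) : x ^+ q = y ^+ q -> x = y.
Proof.
rewrite q_pfactor; elim: (res_degree k p) => [|f IH]; first by rewrite expn0 !expr1.
by rewrite expnSr !exprM => /expp_inj.
Qed.

(** The characteristic polynomial has coefficients in [k], so [x -> x ^+ q] maps its roots [a] and
    [b] to roots. It fixes both or exchanges them; if both had the same image they would be equal,
    by injectivity. *)
Lemma eigen_card_aux g a b : eigen_pair g a b -> [/\ a ^+ q ^+ q = a & b ^+ q ^+ q = b].
Proof.
move=> /(_ 0%N)[P [T [uP tT T00 T11 PT]]].
rewrite !expn0 !expr1 in T00 T11.
have cE x : (x \in [:: a; b]) = root (map_poly iota (char_poly (gl_mx g))) x.
  rewrite map_char_poly (_ : char_poly _ = char_poly T); last first.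
    by symmetry; exact: (char_poly_intertwine uP).
  rewrite char_poly_trig // big_ord_recl big_ord1 T00.
  have -> : fintype.lift ord0 ord0 = 1 :> 'I_2 by apply: val_inj.
  by rewrite T11 rootM !root_XsubC !inE.
have cq x : x \in [:: a; b] -> x ^+ q \in [:: a; b].
  rewrite !cE !rootE horner_expq => /eqP ->.
  by rewrite expr0n gtn_eqF // (ltnW q_gt1).
have := cq a; have := cq b; rewrite !inE !eqxx orbT /=.
move=> /(_ isT)/orP[/eqP bq|/eqP bq] /(_ isT)/orP[/eqP aq|/eqP aq].
- have -> : b = a by apply: expq_inj; rewrite bq aq.
  by rewrite !aq.
- by rewrite aq bq aq.
- by rewrite !aq !bq.
- have -> : a = b by apply: expq_inj; rewrite bq aq.
  by rewrite !bq.
Qed.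

Lemma eigen_card g a b : eigen_pair g a b -> a != 0 -> b != 0 ->
  a ^+ (q ^ 2 - 1) = 1 /\ b ^+ (q ^ 2 - 1) = 1.
Proof.
move=> /eigen_card_aux[aq bq] a0 b0.
have q2 : (0 < q ^ 2)%N by rewrite expn_gt0 (ltnW q_gt1).
have aux (x : E) : x != 0 -> x ^+ q ^+ q = x -> x ^+ (q ^ 2 - 1) = 1.
  move=> x0; rewrite -exprM -[(q * q)%N]/(q ^ 2)%N -{1}(subnK q2) exprD expr1 => e.
  by apply: (mulIf x0); rewrite mul1r.
by split; apply: aux.
Qed.

Lemma gl_mxX (g : G) n : gl_mx (g ^+ n)%g = gl_mx g ^+ n.
Proof.
elim: n => [|n IH]; first by rewrite expr0 expg0 /gl_mx GL_1E.
by rewrite expgS exprS gl_mxM IH.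
Qed.

(** The o-th power is triangular with equal diagonal entries but may keep a unipotent part, which
    the p-th power removes. The scalar lies in [k] because it is an entry of a power of [g]. *)
Lemma gl_scalar_pow g a b o : eigen_pair g a b -> a ^+ o = b ^+ o ->
  exists2 c, gl_mx (g ^+ (o * p))%g = c%:M & iota c = a ^+ (o * p).
Proof.
move=> /(_ 0%N)[P [T [uP tT T00 T11 PT]]] ab.
rewrite !expn0 !expr1 in T00 T11; rewrite /= in PT.
have T01 : T 0 1 = 0 by exact: (is_trig_mxP tT).
have PTn n : P *m map_mx iota (gl_mx (g ^+ n)%g) = T ^+ n *m P.
  elim: n => [|n IH]; first by rewrite gl_mxX !expr0 map_mx1 mulmx1 mul1mx.
  by rewrite expgS gl_mxM map_mxM mulmxA PT -mulmxA IH mulmxA exprS.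
have [S00 S11 S01 _] := trig_mx2X o tT; set S := T ^+ o in S00 S11 S01.
have tS : is_trig_mx S.
  by apply/is_trig_mxP => i j; case: (ord2P i) => ->; case: (ord2P j) => ->.
have eS : S 0 0 = S 1 1 by rewrite S00 S11 T00 T11.
have [U00 U11 U01 /(_ eS) U10] := trig_mx2X p tS.
have Tn : T ^+ (o * p) = (a ^+ (o * p))%:M.
  rewrite exprM -/S; apply/matrixP => i j; rewrite [RHS]mxE.
  case: (ord2P i) => ->; case: (ord2P j) => ->; rewrite ?U00 ?U11 ?U01 ?U10 -?eS ?S00 ?T00 /=.
  - by rewrite -exprM.
  - by [].
  - by rewrite (pcharf0 pchar_iota) !mul0r.
  - by rewrite -exprM.
have gn : map_mx iota (gl_mx (g ^+ (o * p))%g) = (a ^+ (o * p))%:M.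
  by rewrite -[LHS](mulKmx uP) PTn Tn -scalar_mxC mulKmx.
pose c := gl_mx (g ^+ (o * p))%g 0 0.
have ic : iota c = a ^+ (o * p).
  by have /matrixP/(_ 0 0) := gn; rewrite !mxE eqxx mulr1n.
exists c => //; apply/matrixP => i l; apply: iota_inj.
by have /matrixP/(_ i l) := gn; rewrite !mxE rmorphMn /= ic.
Qed.

Lemma fin_unit_expf (c : k) : c != 0 -> c ^+ (q - 1) = 1.
Proof.
move=> c0; apply: (mulIf c0); rewrite mul1r -exprSr.
by rewrite subn1 prednK ?expf_card // (ltnW q_gt1).
Qed.

Lemma iota_exprz_mod (c : k) (x y : int) : c != 0 -> (x = y %[mod q%:Z - 1])%Z ->
  iota c ^ x = iota c ^ y.
Proof.
move=> c0 /eqP; rewrite eqz_mod_dvd => /dvdzP[t xy].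
have ic0 : iota c != 0 by rewrite fmorph_eq0.
have -> : x = y + t * (q%:Z - 1) by rewrite -xy addrC subrK.
have q1E : q%:Z - 1 = (q - 1)%N by rewrite -subzn // (ltnW q_gt1).
rewrite expfzDr // [t * _]mulrC -exprz_exp q1E -exprnP -rmorphXn fin_unit_expf //.
by rewrite rmorph1 exp1rz mulr1.
Qed.

Lemma eigenvalue_pow n (A : 'M[E]_n.+1) w m s : w \in eigs A -> A ^+ m = s%:M -> w ^+ m = s.
Proof.
rewrite mem_eigs => /eigenvalueP[v vA v0] Am.
have vAm l : v *m A ^+ l = w ^+ l *: v.
  elim: l => [|l IH]; first by rewrite !expr0 mulmx1 scale1r.
  by rewrite exprSr mulmxA IH -scalemxAl vA scalerA exprSr.
move: (vAm m); rewrite Am mul_mx_scalar => /eqP; rewrite -subr_eq0 -scalerBl scaler_eq0.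
by rewrite (negbTE v0) orbF subr_eq0 => /eqP.
Qed.

Lemma rep_eigs_pow (gT : finGroupType) (W : rep E gT) g w m s :
  w \in eigs (W g) -> W (g ^+ m)%g = s%:M -> w ^+ m = s.
Proof.
case: W => -[|d] r /= ws.
  by move: (size_eigs (r g)) ws; case: (eigs _).
by rewrite repr_mxX ?inE // => rX; exact: eigenvalue_pow ws rX.
Qed.

Lemma coprime_pq1 j o : (o %| q ^ 2 - 1)%N -> coprime (p ^ j) o.
Proof.
move=> od; apply: coprimeXl; apply: (coprime_dvdr od).
have p_pr := pcharf_prime pk; rewrite prime_coprime //; apply/negP => pd.
have pq : (p %| q ^ 2)%N.
  have f0 : (0 < res_degree k p)%N.
    by rewrite lt0n; apply/negP => /eqP f0; have := q_gt1; rewrite q_pfactor f0.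
  by rewrite q_pfactor dvdn_exp // dvdn_exp.
have : (p %| 1)%N.
  by rewrite -(dvdn_addr _ pd) subnK // expn_gt0 (ltnW q_gt1).
by rewrite dvdn1 => /eqP p1; rewrite p1 in p_pr.
Qed.

(* The eigenvalues of Symm^(N+M) g are those of Symm^N g and the full period
   a^N (b/a)^l, l < M, where a and b are the eigenvalues of g. If b/a has order
   o, then g^(o p) is scalar, so that w^(o p) is known for each eigenvalue w of
   W g, and this determines the period shifted by w. *)
Lemma rep_symm_period (W : rep E G) (i : int) j (N N' : nat) g : has_central_char iota W i ->
  (i + (p ^ j * N)%:Z = N'%:Z %[mod q%:Z - 1])%Z ->
  char_poly (rep_tens W (iter j (rep_frob pk) (rep_symm iota (N + (q ^ 2 - 1)))) g)
     * char_poly (rep_symm iota N' g) ^+ rdim W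
  = char_poly (rep_tens W (iter j (rep_frob pk) (rep_symm iota N)) g)
     * char_poly (rep_symm iota (N' + (q ^ 2 - 1)) g) ^+ rdim W.
Proof.
move=> cW iN; set M := (q ^ 2 - 1)%N.
have M0 : (0 < M)%N by rewrite subn_gt0 -{1}(exp1n 2) ltn_exp2r // q_gt1.
have [a [b [a0 b0 ab]]] := gl_trig g.
have [aM bM] := eigen_card ab a0 b0; rewrite -/M in aM bM.
pose u := b / a; have uM : u ^+ M = 1 by rewrite expr_div_n aM bM divr1.
have [o pu oM] := prim_order_exists M0 uM.
pose u' := u ^+ (p ^ j); have pu' : o.-primitive_root u'.
  by rewrite prim_root_exp_coprime // coprime_pq1.
pose a' := a ^+ (p ^ j).
have a'M : a' ^+ M = 1 by rewrite exprAC aM expr1n.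
have period n c v : v ^+ M = 1 -> geom_prod (n + M).+1 c v = geom_prod M c v * geom_prod n.+1 c
  v.
  by move=> vM; rewrite -addSn addnC geom_prodD vM mulr1.
have u'M : u' ^+ M = 1 by rewrite exprAC uM expr1n.
have tensE n : char_poly (rep_tens W (iter j (rep_frob pk) (rep_symm iota n)) g)
    = \prod_(w <- eigs (W g)) geom_prod n.+1 (w * a' ^+ n) u'.
  rewrite /= char_poly_tens; apply: eq_bigr => w _.
  set A := rep_mx (iter j _ _) g.
  have eA : char_poly A = geom_prod n.+1 (a' ^+ n) u' by exact: char_poly_symm_frob.
  have /(perm_big _) -> : perm_eq (eigs A) [seq a' ^+ n * u' ^+ i | i <- index_iota 0 n.+1].
    apply: prod_XsubC_eq; rewrite -char_poly_eigs eA big_map big_mkord.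
    by apply: eq_bigr.
  rewrite big_map big_mkord; by apply: eq_bigr => l _; rewrite mulrA.
have symmE n : char_poly (rep_symm iota n g) = geom_prod n.+1 (a ^+ n) u.
  by have := char_poly_symm_frob 0 n ab a0; rewrite expn0 !expr1.
rewrite !tensE !symmE !exprD aM a'M !mulr1 period //.
under eq_bigr => w _ do rewrite period //.
rewrite big_split /= exprMn [RHS]mulrA [X in X * _ = _]mulrC; congr (_ * _ * _).
have -> : geom_prod M (a ^+ N') u ^+ rdim W = \prod_(w <- eigs (W g)) geom_prod M (a ^+ N') u.
  by rewrite big_const_seq count_predT size_eigs iter_mulr_1.
apply: eq_big_seq => w ws.
have w0 : w != 0.
  apply: contraTneq ws => ->; rewrite mem_eigs; apply/eigenvalueP => -[v vW v0].
  case/negP: v0; have uW : W g \in unitmx by rewrite repr_mx_unit ?inE.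
  by rewrite -(mulmxK uW v) vW scale0r mul0mx.
have /dvdnP[t tE] := oM.
rewrite tE !(geom_prod_prim, pu, pu') //; rewrite ?expf_neq0 ?mulf_neq0 ?expf_neq0 //.
congr (('X^o - _%:P) ^+ t).
have abo : a ^+ o = b ^+ o.
  by have := prim_expr_order pu; rewrite expr_div_n => /divr1_eq.
have [c gc ic] := gl_scalar_pow ab abo.
have c0 : c != 0 by rewrite -(fmorph_eq0 iota) ic expf_neq0.
have wE : w ^+ (o * p) = iota c ^ i.
  exact: rep_eigs_pow ws (cW _ _ gc).
(* Both sides are o-th powers. Only (o p)-th powers can be read off the central characters, and
   injectivity of Frobenius recovers the equality. *)
apply: expp_inj; rewrite -![_ ^+ o ^+ p]exprM exprMn wE.
have -> : a' ^+ N ^+ (o * p) = iota c ^ (p ^ j * N)%:Z.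
  by rewrite ic -exprnP /a' -(exprM a (p ^ j)) exprAC.
have -> : a ^+ N' ^+ (o * p) = iota c ^ N'%:Z by rewrite ic -exprnP exprAC.
by rewrite -expfzDr ?fmorph_eq0 //; exact: iota_exprz_mod.
Qed.

End GL2Eigen.

(** * Dickson's exact sequence *)

Lemma eigs_scale (F : closedFieldType) n (c : F) (A : 'M[F]_n) :
  perm_eq (eigs (c *: A)) [seq a * c | a <- eigs A].
Proof.
have [P [T [uP tT PT]]] := trigonalize A.
have cT : char_poly (c *: A) = \prod_(i < n) ('X - (c * T i i)%:P).
  have tcT : is_trig_mx (c *: T).
    by apply/is_trig_mxP => i j ij; rewrite mxE (is_trig_mxP tT) ?mulr0.
  rewrite -(char_poly_intertwine (A := c *: T) uP); last first.
    by rewrite -scalemxAl -scalemxAr PT.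
  by rewrite char_poly_trig //; apply: eq_bigr => i _; rewrite mxE.
have pA : perm_eq (eigs A) [seq T i i | i <- enum 'I_n].
  apply: prod_XsubC_eq; rewrite -char_poly_eigs big_map big_enum /=.
  by rewrite -char_poly_trig //; apply/esym/(char_poly_intertwine uP).
apply: prod_XsubC_eq; rewrite -char_poly_eigs cT big_map (perm_big _ pA) big_map big_enum /=.
by apply: eq_bigr => i _; rewrite mulrC.
Qed.

Lemma char_poly_tens_scalar (F : closedFieldType) n (c : F) (A : 'M[F]_n) :
  char_poly (A *t (c%:M : 'M_1)) = char_poly (c *: A).
Proof.
rewrite char_poly_tens eigs_scalar [RHS]char_poly_eigs (perm_big _ (eigs_scale c A)) big_map.
by apply: eq_bigr => a _; rewrite big_seq1.
Qed.

Lemma det_mx2 (R : comNzRingType) (A : 'M[R]_2) : \det A = A 0 0 * A 1 1 - A 0 1 * A 1 0.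
Proof.
rewrite (expand_det_row _ 0) big_ord_recl big_ord1 /cofactor !det_mx11 !mxE.
have l0 : fintype.lift ord0 ord0 = 1 :> 'I_2 by apply: val_inj.
have l1 : fintype.lift 0 0 = 1 :> 'I_2 by apply: val_inj.
have l2 : fintype.lift 1 0 = 0 :> 'I_2 by apply: val_inj.
by rewrite !(l0, l1, l2) /= expr0 expr1 mul1r mulN1r mulrN.
Qed.

Definition mk2 (R : pzSemiRingType) (a b c d : R) : 'M[R]_2 :=
  \matrix_(i, j) if i == 0 then (if j == 0 then a else b) else (if j == 0 then c else d).

Lemma eq_mx2 (R : Type) (A B : 'M[R]_2) : A 0 0 = B 0 0 -> A 0 1 = B 0 1 ->
  A 1 0 = B 1 0 -> A 1 1 = B 1 1 -> A = B.
Proof.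
by move=> *; apply/matrixP => i j; case: (ord2P i) => ->; case: (ord2P j) => ->.
Qed.

Section GLPoints.
Variable k : finFieldType.
Local Notation G := {'GL_2[k]}.

Definition gl_of_mx (A : 'M[k]_2) (uA : A \in unitmx) : G := FinRing.Unit uA.

Lemma gl_mx_inj : injective (@gl_mx k). Proof. exact: val_inj. Qed.

(** Representatives of the cosets B g, that is, of the points of the projective line: the bottom row
    (1 : a) for [Some a], and (0 : 1) for [None]. *)
Definition point_mx (t : option k) : 'M[k]_2 :=
  if t is Some a then mk2 0 1 1 a else 1%:M.

Fact point_mx_unit t : point_mx t \in unitmx.
Proof.
case: t => [a|]; last exact: unitmx1.
by rewrite unitmxE det_mx2 !mxE /= mul0r mul1r sub0r unitrN unitr1.
Qed.
Definition point t : G := gl_of_mx (point_mx_unit t).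

Lemma point_cover (y : G) : exists t b, b \in @borel k /\ y = (b * point t)%g.
Proof.
pose t := if gl_mx y 1 0 == 0 then None else Some (gl_mx y 1 1 / gl_mx y 1 0).
exists t, (y * (point t)^-1)%g; rewrite mulgKV; split=> //; rewrite inE.
have : gl_mx (y * (point t)^-1)%g *m point_mx t = gl_mx y.
  by rewrite -[point_mx t]/(gl_mx (point t)) -gl_mxM mulgKV.
move: (gl_mx (y * _)) => b e.
have := congr1 (fun A : 'M_2 => A 1 0) e; have := congr1 (fun A : 'M_2 => A 1 1) e.
rewrite !mulmx2E /t; case: ifP => [/eqP -> |/negbT y0]; rewrite /= !mxE /=.
  by move=> _; rewrite mulr0 mulr1 addr0 => ->.
rewrite mulr0 !mulr1 add0r => + b1; rewrite b1 mulrCA mulfV // mulr1.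
by move/eqP; rewrite -subr_eq0 addrK.
Qed.
End GLPoints.

Section Dickson.
Variables (k : finFieldType) (E : closedFieldType) (iota : {rmorphism k -> E}).
Local Notation G := {'GL_2[k]}.
Local Notation q := #|k|.
Variables (p : nat) (pk : p \in [pchar k]).

Section PrincipalSeries.
Variable n : nat.
Local Notation ind := (ind_space (@borel k) (fun b => iota (gl_mx b 1 1) ^+ n)).

Lemma ind_eq0 (f : {ffun G -> E^o}) : f \in ind -> (forall t, f (point t) = 0) -> f = 0.
Proof.
move=> /ind_spaceP find f0; apply/ffunP => y; rewrite ffunE.
by have [t [b [bB ->]]] := point_cover y; rewrite find // f0 mulr0.
Qed.

Lemma dim_ind_le : (\dim ind <= q.+1)%N.
Proof.
pose M : 'M[E]_(\dim ind, #|{: option k}|) :=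
  \matrix_(l, j) ((vbasis ind)`_l : {ffun G -> E^o}) (point (enum_val j)).
have fM : row_free M.
  apply: inj_row_free => v vM.
  have f_in : \sum_l v 0 l *: (vbasis ind)`_l \in ind.
    by apply: memv_suml => l _; apply: memvZ; rewrite vbasis_mem // mem_nth // size_tuple.
  have f0 : \sum_l v 0 l *: (vbasis ind)`_l = 0.
    apply: (ind_eq0 f_in) => t; have /rowP/(_ (enum_rank t)) := vM; rewrite mxE [in RHS]mxE =>
      <-.
    by rewrite sum_ffunE; apply: eq_bigr => l _; rewrite !ffunE mxE enum_rankK.
  apply/rowP => l; rewrite [RHS]mxE.
  by have /freeP := basis_free (vbasisP ind) => /(_ (v 0) f0 l).
by move: fM; rewrite /row_free => /eqP <-; rewrite (leq_trans (rank_leq_col _)) // card_option.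
Qed.

End PrincipalSeries.

Section DicksonSequence.
Variable n : nat.
Local Notation N := (n + q.+1)%N.
Local Notation ind := (ind_space (@borel k) (fun b => iota (gl_mx b 1 1) ^+ N)).

(** The monomial x^(N-j) y^j at the bottom row (x, y) of the matrix. Left multiplication by an upper
    triangular [b] scales this row by [gl_mx b 1 1], so homogeneity of degree N puts it in the
    induced space. *)
Definition ev (j : nat) : {ffun G -> E^o} :=
  [ffun x => iota (gl_mx x 1 0) ^+ (N - j) * iota (gl_mx x 1 1) ^+ j].

Lemma gl_mxM10 (x y : G) : gl_mx (x * y)%g 1 0 = gl_mx x 1 0 * gl_mx y 0 0 + gl_mx x 1 1 *
  gl_mx y 1 0.
Proof. by rewrite gl_mxM mulmx2E. Qed.

Lemma gl_mxM11 (x y : G) : gl_mx (x * y)%g 1 1 = gl_mx x 1 0 * gl_mx y 0 1 + gl_mx x 1 1 *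
  gl_mx y 1 1.
Proof. by rewrite gl_mxM mulmx2E. Qed.

Lemma ev_ind j : (j <= N)%N -> ev j \in ind.
Proof.
move=> jN; apply/ind_spaceP => b x; rewrite inE => /eqP b10; rewrite !ffunE.
rewrite gl_mxM10 gl_mxM11 b10 !mul0r !add0r !rmorphM !exprMn.
by rewrite mulrACA -exprD subnK.
Qed.

Lemma rtrans_ev g (j : 'I_N.+1) : rtrans g (ev j)
  = \sum_(m < N.+1) symm_mx N (map_mx iota (gl_mx g)) m j *: ev m.
Proof.
have jN : (j <= N)%N by rewrite -ltnS.
apply/ffunP => x; rewrite sum_ffunE !ffunE gl_mxM10 gl_mxM11.
set u := gl_mx x 1 0; set v := gl_mx x 1 1.
(* Substitution in a binary form, obtained from [homog_lin] with constant polynomials as the two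
   variables. *)
have := homog_lin (iota u)%:P (iota v)%:P (iota (gl_mx g 0 0)) (iota (gl_mx g 0 1))
  (iota (gl_mx g 1 0)) (iota (gl_mx g 1 1)) (N - j) j.
rewrite /= subnK // => /(congr1 (fun r : {poly E} => r.[0])).
rewrite hornerM !horner_exp !hornerE => h.
rewrite !rmorphD !rmorphM /=.
transitivity ((homog (iota u)%:P (iota v)%:P N
  (((iota (gl_mx g 0 0))%:P + iota (gl_mx g 1 0) *: 'X) ^+ (N - j) *
   ((iota (gl_mx g 0 1))%:P + iota (gl_mx g 1 1) *: 'X) ^+ j)).[0]).
  by rewrite h; congr (_ ^+ _ * _ ^+ _); ring.
rewrite /homog horner_sum; apply: eq_bigr => m _.
rewrite !hornerE [RHS]ffunE [ev m x]ffunE [symm_mx _ _ m j]mxE !mxE.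
exact/esym/mulrA.
Qed.

Definition ev_mx : 'M[E]_(\dim ind, N.+1) := \matrix_(l, j) coord (vbasis ind) l (ev j).

Lemma ev_coord (j : 'I_N.+1) : ev j = \sum_l ev_mx l j *: (vbasis ind)`_l.
Proof.
rewrite [LHS](coord_vbasis (ev_ind _)) -1?ltnS //.
by apply: eq_bigr => l _; rewrite mxE.
Qed.

Lemma ev_mxJ g : ind_mx (@borel k) (fun b => iota (gl_mx b 1 1) ^+ N) g *m ev_mx
  = ev_mx *m symm_mx N (map_mx iota (gl_mx g)).
Proof.
apply/matrixP => l j; rewrite [LHS]mxE [RHS]mxE.
transitivity (coord (vbasis ind) l (rtrans g (ev j))).
  rewrite ev_coord !linear_sum; apply: eq_bigr => m _.
  by rewrite !linearZ /= [ind_mx _ _ _ _ _]mxE mulrC.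
rewrite rtrans_ev linear_sum; apply: eq_bigr => m _.
by rewrite linearZ /= [ev_mx _ _]mxE mulrC.
Qed.

(** On columns, multiplication from S_n(1) to S_N by Dickson's invariant x^q y - x y^q,
    dehomogenised to X - X^q. The arrows of the sequence are reversed in [ses_dickson] because [ses]
    acts on rows. *)
Definition dickson_mx : 'M[E]_(N.+1, n.+1) := \matrix_(i, j) ('X^j * ('X - 'X^q) : {poly E})`_i.

Lemma dickson_mxE (i : 'I_N.+1) (j : 'I_n.+1) :
  dickson_mx i j = (i == j.+1 :> nat)%:R - (i == (j + q)%N :> nat)%:R.
Proof. by rewrite mxE mulrBr -exprSr -exprD coefB !coefXn. Qed.

Lemma sum_dickson (V : lmodType E) (f : nat -> V) (j : 'I_n.+1) :
  \sum_(m < N.+1) dickson_mx m j *: f m = f j.+1 - f (j + q)%N.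
Proof.
have jn : (j <= n)%N by rewrite -ltnS.
have lt1 : (j.+1 < N.+1)%N by rewrite ltnS -addn1 leq_add.
have lt2 : (j + q < N.+1)%N by rewrite ltnS leq_add.
under eq_bigr => m _ do rewrite dickson_mxE scalerBl.
rewrite sumrB (bigD1 (Ordinal lt1)) //= eqxx scale1r big1 ?addr0 => [|m mj]; last first.
  by rewrite -[m == _ :> nat]/(m == Ordinal lt1) (negbTE mj) scale0r.
rewrite (bigD1 (Ordinal lt2)) //= eqxx scale1r big1 ?addr0 // => m mj.
by rewrite -[m == _ :> nat]/(m == Ordinal lt2) (negbTE mj) scale0r.
Qed.

(** The q-th power fixes coefficients from [k], so P^q Q - P Q^q is the determinant times X - X^q
    for the linear forms P, Q of the matrix. *)
Lemma dickson_mxJ g : symm_mx N (map_mx iota (gl_mx g)) *m dickson_mx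
  = dickson_mx *m (iota (\det (gl_mx g)) *: symm_mx n (map_mx iota (gl_mx g))).
Proof.
set A := map_mx iota (gl_mx g).
pose P : {poly E} := (A 0 0)%:P + A 1 0 *: 'X.
pose Q : {poly E} := (A 0 1)%:P + A 1 1 *: 'X.
apply/matrixP => l j; rewrite [LHS]mxE [RHS]mxE.
have jn : (j <= n)%N by rewrite -ltnS.
pose D : {poly E} := 'X - 'X^q.
have PQ : P ^+ q * Q - P * Q ^+ q = iota (\det (gl_mx g)) *: D.
  have lin_q (u v : k) : ((iota u)%:P + iota v *: 'X) ^+ q = (iota u)%:P + iota v *: 'X^q :>
    {poly E}.
    rewrite exprDn_pchar; last by rewrite (eq_pnat _ (pchar_poly _)) (pchar_nat_q iota pk).
    by rewrite -rmorphXn iotaX_card exprZn iotaX_card.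
  rewrite /P /Q !mxE !lin_q det_mx2 rmorphB !rmorphM /= /D -!mul_polyC.
  by rewrite rmorphB !rmorphM /=; ring.
transitivity (((P ^+ (n - j) * Q ^+ j) * (P ^+ q * Q - P * Q ^+ q))`_l).
  have := sum_dickson (fun m => (P ^+ (N - m) * Q ^+ m)`_l : E^o) j.
  have -> : (P ^+ (N - j.+1) * Q ^+ j.+1)`_l - (P ^+ (N - (j + q)) * Q ^+ (j + q))`_l
      = ((P ^+ (n - j) * Q ^+ j) * (P ^+ q * Q - P * Q ^+ q))`_l.
    have -> : (N - j.+1 = (n - j) + q)%N by rewrite addnS subSS -addnBAC.
    have -> : (N - (j + q) = (n - j).+1)%N by rewrite addnS -addSn subnDr subSn.
    rewrite -coefB; apply: (congr1 (fun r : {poly E} => r`_l)); rewrite !exprD !exprS; ring.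
  by move=> <-; apply: eq_bigr => m _; rewrite [symm_mx _ _ _ _]mxE mulrC.
rewrite PQ -scalerAr coefZ -/A; apply/esym.
transitivity (\sum_m iota (\det (gl_mx g)) * (symm_mx n A m j * ('X^m * D)`_l)).
  by apply: eq_bigr => m _; rewrite [dickson_mx _ _]mxE [fun_of_matrix (_ *: _) _ _]mxE mulrC
    mulrA.
rewrite -mulr_sumr; congr (_ * _).
have szl (u v : E) : (size (u%:P + v *: 'X)%R <= 2)%N by exact: size_lin.
have sPQ : (size (P ^+ (n - j) * Q ^+ j)%R <= n.+1)%N.
  apply: leq_trans (size_polyMleq _ _) _.
  have szX (r : {poly E}) m : (size r <= 2)%N -> (size (r ^+ m)%R <= m.+1)%N.
    move=> r2; apply: leq_trans (size_poly_exp_leq _ _) _.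
    by rewrite ltnS; case: (size r) r2 => [|[|[|]]] //= _; rewrite mul1n.
  have := leq_add (szX P (n - j)%N (szl _ _)) (szX Q j (szl _ _)).
  by rewrite addSn addnS subnK //; case: (size _ + size _)%N.
have -> : P ^+ (n - j) * Q ^+ j = \sum_(m < n.+1) symm_mx n A m j *: 'X^m.
  transitivity (\poly_(m < n.+1) (P ^+ (n - j) * Q ^+ j)`_m).
    apply/polyP => i; rewrite coef_poly; case: ltnP => // ni.
    by rewrite nth_default // (leq_trans sPQ).
  by rewrite poly_def; apply: eq_bigr => m _; rewrite mxE.
rewrite mulr_suml coef_sum; apply: eq_bigr => m _.
by rewrite -scalerAl coefZ.
Qed.

Lemma rVpoly_sum d (v : 'rV[E]_d) : rVpoly v = \sum_(m < d) v 0 m *: 'X^m.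
Proof.
rewrite /rVpoly poly_def; apply: eq_bigr => m _.
by rewrite insubT // => mlt; congr (v 0 _ *: _); apply: val_inj.
Qed.

Lemma size_dickson : size ('X - 'X^q : {poly E}) = q.+1.
Proof. by rewrite -opprB size_polyN size_polyDl size_polyXn // size_polyN size_polyX ltnS
  (q_gt1 k). Qed.

Lemma dickson_neq0 : 'X - 'X^q != 0 :> {poly E}.
Proof. by rewrite -size_poly_eq0 size_dickson. Qed.

Lemma rVpoly_dickson (w : 'rV[E]_n.+1) (i : 'I_N.+1) :
  (w *m dickson_mx^T) 0 i = (rVpoly w * ('X - 'X^q))`_i.
Proof.
rewrite rVpoly_sum mulr_suml coef_sum [LHS]mxE; apply: eq_bigr => m _.
by rewrite -scalerAl coefZ !mxE.
Qed.

Lemma dickson_full : row_full dickson_mx.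
Proof.
suff : row_free dickson_mx^T by rewrite /row_full /row_free mxrank_tr.
apply: inj_row_free => v vD.
have : rVpoly v * ('X - 'X^q) = 0.
  apply/polyP => i; rewrite coef0; have [iN|Ni] := ltnP i N.+1.
    by rewrite -(rVpoly_dickson _ (Ordinal iN)) vD mxE.
  rewrite nth_default //; apply: leq_trans (size_polyMleq _ _) _.
  rewrite size_dickson addnS /=; apply: leq_trans (ltnW Ni).
  by rewrite addnS -addSn leq_add2r size_poly.
move/eqP; rewrite mulf_eq0 (negbTE dickson_neq0) orbF => /eqP v0.
by rewrite -[v]rVpolyK v0 linear0.
Qed.

(** A form of degree N that vanishes at all points of the projective line over [k] is a multiple of
    Dickson's invariant: the affine points give the factor X^q - X, and the point at infinity kills
    the top coefficient, which bounds the degree of the quotient by n. *)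
Lemma ev_kernel (v : 'rV[E]_N.+1) : v *m ev_mx^T = 0 -> (v <= dickson_mx^T)%MS.
Proof.
move=> v0; have f0 : \sum_(m < N.+1) v 0 m *: ev m = 0.
  under eq_bigr => m _ do rewrite ev_coord scaler_sumr.
  rewrite exchange_big big1 //= => l _.
  have := congr1 (fun u : 'rV_(\dim ind) => u 0 l) v0; rewrite !mxE => e.
  rewrite -[RHS](scale0r (vbasis ind)`_l) -e scaler_suml.
  by apply: eq_bigr => m _; rewrite scalerA [ev_mx^T _ _]mxE.
have fx x : \sum_(m < N.+1) v 0 m * (iota (gl_mx x 1 0) ^+ (N - m) * iota (gl_mx x 1 1) ^+ m) =
  0.
  have := congr1 (fun f : {ffun G -> E^o} => f x) f0; rewrite sum_ffunE [RHS]ffunE => e.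
  by rewrite -[RHS]e; apply: eq_bigr => m _; rewrite !ffunE.
pose r := rVpoly v.
have rt (t : k) : root r (iota t).
  rewrite rootE -[X in _ == X](fx (point (Some t))) /r rVpoly_sum horner_sum.
  have -> : gl_mx (point (Some t)) 1 0 = 1 by rewrite mxE.
  have -> : gl_mx (point (Some t)) 1 1 = t by rewrite mxE.
  apply/eqP/eq_bigr => m _; rewrite hornerZ hornerXn rmorph1 expr1n.
  by rewrite mul1r.
have vN : v 0 ord_max = 0.
  rewrite -[RHS](fx (point None)) (bigD1 ord_max) //= big1 => [|m mN].
    have -> : gl_mx (point (@None k)) 1 1 = 1 by rewrite mxE.
    by rewrite subnn rmorph1 expr0 expr1n !mulr1 addr0.
  have -> : gl_mx (point (@None k)) 1 0 = 0 by rewrite mxE.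
  rewrite rmorph0 expr0n subn_eq0 leqNgt.
  have -> : (m < N)%N by rewrite ltn_neqAle -ltnS ltn_ord andbT; apply: contra mN => /eqP mN;
    apply/eqP/val_inj.
  by rewrite mul0r mulr0.
have sr : (size r <= N)%N.
  apply/leq_sizeP => i; rewrite leq_eqVlt => /predU1P[<-|Ni]; last first.
    by rewrite nth_default // (leq_trans (size_poly _ _)).
  by rewrite -[N]/(nat_of_ord (@ord_max N)) coef_rVpoly_ord.
have genE : 'X^q - 'X = \prod_(z <- [seq iota t | t <- enum k]) ('X - z%:P).
  rewrite big_map big_enum /= -[LHS]opprB -(map_polyXn iota) -(map_polyX iota) -rmorphB.
  rewrite -opprB rmorphN opprK /= finField_genPoly rmorph_prod; apply: eq_bigr => t _.
  by rewrite rmorphB /= map_polyX map_polyC.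
have : 'X^q - 'X %| r.
  rewrite genE; apply: uniq_roots_dvdp.
    by apply/allP => z /mapP[t _ ->].
  by rewrite uniq_rootsE map_inj_uniq ?enum_uniq //; exact: iota_inj.
case/dvdpP => h rh.
have sh : (size h <= n.+1)%N.
  have [->|h0] := eqVneq h 0; first by rewrite size_poly0.
  move: sr; rewrite rh size_mul // -?size_poly_eq0 -?[_ - 'X]opprB ?size_polyN ?size_dickson //.
  by rewrite !addnS /= -addSn leq_add2r.
apply/submxP; exists (poly_rV (- h)); apply/rowP => i.
rewrite rVpoly_dickson poly_rV_K ?size_polyN // mulNr -mulrN opprB -rh.
by rewrite coef_rVpoly_ord.
Qed.

Lemma ev_rank : (q.+1 <= \rank ev_mx)%N.
Proof.
have : (\rank (kermx ev_mx^T) <= n.+1)%N.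
  apply: leq_trans (rank_leq_row dickson_mx^T); apply: mxrankS.
  by apply/row_subP => i; apply: ev_kernel; rewrite -row_mul mulmx_ker row0.
rewrite mxrank_ker mxrank_tr leq_subLR; move: (\rank ev_mx) => r.
by rewrite -addSn addnC leq_add2r.
Qed.

(** Values at the q + 1 points bound the dimension above; the kernel of evaluation bounds it below
    by (N + 1) - (n + 1). *)
Lemma dim_princ_series : \dim ind = q.+1.
Proof.
apply/eqP; rewrite eqn_leq dim_ind_le.
exact: leq_trans ev_rank (rank_leq_row _).
Qed.

Lemma ev_free : row_free ev_mx.
Proof.
rewrite /row_free eqn_leq rank_leq_row.
exact: leq_trans (dim_ind_le N) ev_rank.
Qed.

Fact dickson_mx_repr :
  mx_repr [set: G] (fun g => iota (\det (gl_mx g)) *: symm_mx n (map_mx iota (gl_mx g))).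
Proof.
split=> [|g h _ _]; first by rewrite /gl_mx GL_1E det1 rmorph1 scale1r map_mx1 symm_mx1.
rewrite gl_mxM det_mulmx map_mxM symm_mxM rmorphM -scalemxAl -scalemxAr scalerA.
by [].
Qed.
Definition rep_symm_det : rep E G := Rep (MxRepresentation dickson_mx_repr).

Lemma ses_dickson : ses (princ_series iota N) (rep_symm iota N) rep_symm_det.
Proof.
exists ev_mx, dickson_mx; split; [exact: ev_free | exact: dickson_full | | |].
- apply: (@ses_of_rank _ _ (princ_series iota N) (rep_symm iota N) rep_symm_det).
  + exact: ev_free.
  + exact: dickson_full.
  + apply/matrixP => l j; rewrite mxE [RHS]mxE.
    have jn : (j <= n)%N by rewrite -ltnS.
    transitivity (coord (vbasis ind) l (ev j.+1 - ev (j + q))).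
      rewrite -sum_dickson linear_sum; apply: eq_bigr => m _.
      by rewrite linearZ /= [ev_mx _ _]mxE mulrC.
    (* Dickson's invariant vanishes at all points with coordinates in [k]. *)
    suff -> : ev j.+1 - ev (j + q) = 0 by rewrite linear0.
    apply/ffunP => x; rewrite !ffunE; apply/eqP; rewrite subr_eq0; apply/eqP.
    have -> : (N - j.+1 = (n - j) + q)%N by rewrite addnS subSS -addnBAC.
    have -> : (N - (j + q) = (n - j).+1)%N by rewrite addnS -addSn subnDr subSn.
    by rewrite !exprD !iotaX_card exprS exprSr; ring.
  + by rewrite /= dim_princ_series addnS -addSn addnC.
- exact: ev_mxJ.
- exact: dickson_mxJ.
Qed.

Lemma groth_cl_dickson (R : comNzRingType) :
  groth_cl R (rep_symm iota N) = groth_cl R (princ_series iota N)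
    + groth_cl R (twist iota (rep_symm iota n) 1).
Proof.
rewrite (groth_cl_ses R ses_dickson); congr (_ + _).
apply: (groth_cl_char_poly (pchar_iota iota pk)) => g.
by rewrite /= char_poly_tens_scalar.
Qed.
End DicksonSequence.
End Dickson.

(** * The ring of integers of K *)

Section PadicMatrices.
Variables (p : nat) (p_pr : prime p).
Local Notation Zp := (padic_int p_pr).

Lemma padic_trunc_lt (a : Zp) n : (a n < p ^ n)%N.
Proof. by rewrite -padic_mod ltn_mod expn_gt0 prime_gt0. Qed.

Lemma padic_addE (a b : Zp) n : (a + b) n = ((a n + b n) %% p ^ n)%N. Proof. by []. Qed.

Lemma padic_mulE (a b : Zp) n : (a * b) n = ((a n * b n) %% p ^ n)%N. Proof. by []. Qed.

Lemma padic_trunc_sum (I : Type) (r : seq I) (F : I -> Zp) n :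
  (\sum_(i <- r) F i : Zp) n = ((\sum_(i <- r) F i n) %% p ^ n)%N.
Proof.
elim: r => [|i r IH]; first by rewrite !big_nil.
by rewrite !big_cons padic_addE IH modnDmr.
Qed.

(** The quotient modulo p^n is read from the component of [a] modulo p^(n+1). *)
Lemma padic_div_p (a : Zp) : a 1%N = 0%N -> exists b : Zp, a = p%:R * b.
Proof.
move=> a1; have p0 : (0 < p)%N by exact: prime_gt0.
have pa n : (p %| a n.+1)%N.
  by have := padic_mod_le a (ltn0Sn n); rewrite expn1 a1 => /eqP.
have coh n : (a n.+1 %/ p = (a n.+2 %/ p) %% p ^ n)%N.
  apply/eqP; rewrite -(eqn_pmul2r p0) divnK // muln_modl // divnK // -expnSr.
  by rewrite -[n.+1]/(n.+1) -padic_coherent.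
exists (PadicSeq coh : Zp); apply: padic_eqP => n.
have pE m : ((p%:R : Zp) m = p %% p ^ m)%N.
  have h l : ((l%:R : Zp) m = l %% p ^ m)%N.
    elim: l => [//|l IH]; rewrite -addn1 natrD.
    by rewrite padic_addE IH modnDm.
  exact: h.
rewrite padic_mulE pE modnMml /=; by rewrite mulnC divnK // -padic_coherent.
Qed.

Variable d : nat.
Implicit Types A B : 'M[Zp]_d.+1.

Definition eqmod_mx n A B := forall i j, A i j n = B i j n.

Lemma eqmod_mx_mul n A A' B B' : eqmod_mx n A A' -> eqmod_mx n B B' ->
  eqmod_mx n (A * B) (A' * B').
Proof.
move=> eA eB i j; rewrite !mxE !padic_trunc_sum; congr (_ %% _)%N.
apply: eq_bigr => l _.
by rewrite !padic_mulE eA eB.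
Qed.

Lemma eqmod_mx_eq A B : (forall n, eqmod_mx n A B) -> A = B.
Proof. by move=> e; apply/matrixP => i j; apply: padic_eqP => n; exact: e. Qed.

(* A multiple of the period of the powers of any matrix modulo p^n, since among
   the first [mx_period_card n + 1] powers two coincide. *)
Definition mx_period_card n := #|{ffun 'I_d.+1 * 'I_d.+1 -> 'I_(p ^ n)}|.
Definition mx_period n := (\prod_(i < n.+1) (mx_period_card i)`!)%N.

Lemma mx_period_gt0 n : (0 < mx_period n)%N.
Proof. by rewrite prodn_gt0 // => i; exact: fact_gt0. Qed.

(** Each period divides the next, which makes the powers defining the p-adic limit coherent. *)
Lemma mx_periodS n : mx_period n.+1 = (mx_period n * (mx_period_card n.+1)`!)%N.
Proof. by rewrite /mx_period big_ord_recr. Qed.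

(** The gap between two coinciding powers divides the factorial inside [mx_period]. The bound on [a]
    places it beyond the preperiod, as [A] need not be invertible. *)
Lemma eqmod_mx_pow n A t a : (mx_period n <= a.+1)%N ->
  eqmod_mx n (A ^+ (a + mx_period n * t)) (A ^+ a).
Proof.
move=> le_a; pose h (i : 'I_(mx_period_card n).+1) : {ffun 'I_d.+1 * 'I_d.+1 -> 'I_(p ^ n)} :=
  [ffun ij => Ordinal (padic_trunc_lt ((A ^+ i) ij.1 ij.2) n)].
have : ~~ injectiveb h.
  apply/negP => /injectiveP /leq_card; rewrite card_ord.
  by rewrite -/(mx_period_card n) ltnn.
have {}le_a : (mx_period_card n <= a.+1)%N.
  apply: leq_trans le_a; rewrite /mx_period big_ord_recr /=.
  apply: leq_trans (fact_geq _) _; rewrite leq_pmull // prodn_gt0 // => i; exact: fact_gt0.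
have wlg (i j : 'I_(mx_period_card n).+1) : (i < j)%N -> h i = h j ->
    eqmod_mx n (A ^+ (a + mx_period n * t)) (A ^+ a).
  move=> ij hij.
  have eij : eqmod_mx n (A ^+ i) (A ^+ j).
    move=> l m; have /ffunP/(_ (l, m)) := hij; rewrite !ffunE => /(congr1 val).
    by [].
  have ia : (i <= a)%N by rewrite -ltnS (leq_trans _ le_a) // (leq_trans ij) // -ltnS.
  pose dl := (j - i)%N.
  have step b : (i <= b)%N -> eqmod_mx n (A ^+ (b + dl)) (A ^+ b).
    move=> ib; have -> : (b + dl = (b - i) + j)%N.
      by rewrite -{1}(subnK ib) -addnA subnKC // ltnW.
    rewrite -{2}(subnK ib) !exprD; by apply: eqmod_mx_mul.
  have steps s : eqmod_mx n (A ^+ (a + dl * s)) (A ^+ a).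
    elim: s => [|s IH]; first by rewrite muln0 addn0.
    rewrite mulnSr addnA => l m; rewrite step ?IH //.
    exact: leq_trans ia (leq_addr _ _).
  have dl0 : (0 < dl)%N by rewrite subn_gt0.
  have : (dl %| mx_period n)%N.
    rewrite /mx_period big_ord_recr /= dvdn_mull // dvdn_fact // dl0 /=.
    by rewrite leq_subLR; apply: leq_trans (leq_addl _ _); rewrite -ltnS.
  by case/dvdnP => s ->; rewrite mulnAC mulnC mulnA [(dl * _)%N]mulnC -mulnA mulnC -mulnA;
    exact: steps.
move=> /injectivePn[i [j ij hij]]; have [lt|gt|e] := ltngtP i j.
- exact: wlg lt hij.
- by apply: wlg gt _.
- by case/eqP: ij; exact: val_inj.
Qed.

(* D is the limit of the A^(mx_period n - 1), so that A D is an idempotent. *)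
Lemma padic_quasi_inverse (A : 'M[Zp]_d.+1) : exists D : 'M[Zp]_d.+1, exists2 m, (0 < m)%N &
  [/\ A * D = D * A, (A * D) * (A * D) = A * D & eqmod_mx 1 (A * D) (A ^+ m)].
Proof.
pose e n := (mx_period n).-1.
have eS n : (e n).+1 = mx_period n by rewrite /e prednK // mx_period_gt0.
have coh i j n : (A ^+ e n) i j n = ((A ^+ e n.+1) i j n.+1 %% p ^ n)%N.
  rewrite -padic_coherent; symmetry.
  have -> : e n.+1 = (e n + mx_period n * ((mx_period_card n.+1)`!).-1)%N.
    apply: succn_inj; rewrite eS -addSn eS mx_periodS -mulnS prednK // fact_gt0.
    by [].
  by apply: eqmod_mx_pow; rewrite eS.
pose D : 'M[Zp]_d.+1 := \matrix_(i, j) (PadicSeq (coh i j) : Zp).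
have Dn n : eqmod_mx n D (A ^+ e n) by move=> i j; rewrite mxE.
have ADn n : eqmod_mx n (A * D) (A ^+ mx_period n).
  by rewrite -eS exprS; exact: eqmod_mx_mul.
exists D, (mx_period 1); first exact: mx_period_gt0.
split=> //.
- apply: eqmod_mx_eq => n i j; rewrite ADn -eS exprSr; apply/esym.
  exact: eqmod_mx_mul.
- apply: eqmod_mx_eq => n i j; rewrite (eqmod_mx_mul (ADn n) (ADn n)) ADn -exprD.
  rewrite -{2}[mx_period n]muln1; apply: eqmod_mx_pow; exact: leqnSn.
Qed.
End PadicMatrices.

Section LocalRing.
Variables (p : nat) (p_pr : prime p) (K : fieldExtType (Qp p_pr)).
Local Notation Zp := (padic_int p_pr).
Local Notation OK := (OK K).

Fact OK_of_Zp_subproof (a : Zp) : Zp_K K a \in integral_pred (Zp_K K).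
Proof. apply/asboolP; exact: integral_id. Qed.
Definition OK_of_Zp (a : Zp) : OK := Intcl (OK_of_Zp_subproof a).

Fact OK_of_Zp_zmod : zmod_morphism OK_of_Zp.
Proof. by move=> a b; apply: val_inj; rewrite rmorphB /= rmorphB. Qed.
Fact OK_of_Zp_monoid : monoid_morphism OK_of_Zp.
Proof.
split=> [|a b]; apply: val_inj; first by rewrite rmorph1 /= rmorph1.
by rewrite rmorphM /= rmorphM.
Qed.
HB.instance Definition _ := GRing.isZmodMorphism.Build Zp OK OK_of_Zp OK_of_Zp_zmod.
HB.instance Definition _ := GRing.isMonoidMorphism.Build Zp OK OK_of_Zp OK_of_Zp_monoid.

Lemma OK_monic_root (x : OK) : exists2 f : {poly Zp}, f \is monic & root (map_poly OK_of_Zp f)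
  x.
Proof.
have /asboolP[f fm fx] := valP x; exists f => //.
apply/rootP/val_inj; rewrite rmorph0 -(rootP fx) -(horner_map (val : OK -> K)) /=.
congr (_.[_]); apply/polyP => i.
by rewrite coef_map_id0 ?rmorph0 // coef_map [RHS]coef_map.
Qed.

Section Companion.
Variables (d : nat) (f : {poly Zp}).
Definition companion : 'M[Zp]_d.+1 :=
  \matrix_(i, j) if (i < d)%N then ((i.+1 == j)%N)%:R else - f`_j.

Lemma companionE (S : comNzRingType) (phi : {rmorphism Zp -> S}) (x : S) :
  f \is monic -> size f = d.+2 -> root (map_poly phi f) x ->
  map_mx phi companion *m \col_(i < d.+1) x ^+ i = x *: \col_(i < d.+1) x ^+ i.
Proof.
move=> fm sf /rootP fx; apply/colP => i; rewrite !mxE -exprS.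
have [id|di] := ltnP i d.
  rewrite (bigD1 (Ordinal (id : (i.+1 < d.+1)%N))) //= big1 => [|j ij].
    by rewrite !mxE id eqxx rmorph1 mul1r addr0.
  rewrite !mxE id; case: eqP => [e|_]; last by rewrite rmorph0 mul0r.
  by case/eqP: ij; apply: val_inj.
have -> : i = d :> nat by apply/eqP; rewrite eqn_leq di -ltnS ltn_ord.
have : x ^+ d.+1 = - \sum_(j < d.+1) phi f`_j * x ^+ j.
  apply/eqP; rewrite -addr_eq0 addrC -[X in _ == X]fx.
  rewrite (@horner_coef_wide _ d.+2) ?(leq_trans (size_poly _ _)) ?sf //.
  rewrite [X in _ == X]big_ord_recr /= coef_map /=.
  have -> : f`_d.+1 = 1 by have := monicP fm; rewrite lead_coefE sf.
  by rewrite rmorph1 mul1r; apply/eqP; congr (_ + _); apply: eq_bigr => j _; rewrite coef_map.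
move=> ->; rewrite -sumrN; apply: eq_bigr => j _.
by rewrite !mxE ltnNge di /= rmorphN mulNr.
Qed.

Lemma companion_eigen (S : comNzRingType) (phi : {rmorphism Zp -> S}) (x : S) (w : 'cV[S]_d.+1)
  :
  map_mx phi companion *m w = x *: w -> w = w 0 0 *: \col_(i < d.+1) x ^+ i.
Proof.
move=> ew; apply/colP => i; rewrite !mxE.
case: i => i /=; elim: i => [|i IH] lti.
  by rewrite mulr1; congr (w _ _); apply: val_inj.
have lti' := ltnW lti; have := congr1 (fun u : 'cV_d.+1 => u (Ordinal lti') 0) ew.
rewrite !mxE (bigD1 (Ordinal lti)) //= big1 => [|j ij].
  rewrite !mxE /= -ltnS lti eqxx rmorph1 mul1r addr0 (IH lti') => ->.
  by rewrite exprS mulrCA.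
rewrite !mxE /= -ltnS lti; case: eqP => [e|_]; last by rewrite rmorph0 mul0r.
by case/eqP: ij; apply: val_inj.
Qed.
End Companion.

(** This takes the place of extending the valuation to K. The quasi-inverse [D] commutes with the
    companion matrix [C] of a monic equation of [x], so it preserves the eigenline of (1, x, ...,
    x^d) and acts on it by some [y] in O_K. That C D is idempotent and is a power of C modulo p then
    passes to [x * y]. *)
Lemma OK_quasi_inverse (x : OK) : exists y : OK, (x * y) * (x * y) = x * y /\
  forall (F : fieldType) (phi : {rmorphism OK -> F}), p \in [pchar F] ->
    exists2 m, (0 < m)%N & phi (x * y) = phi x ^+ m.
Proof.
have [f fm fx] := OK_monic_root x.
have [d sf] : exists d, size f = d.+2.
  case sf: (size f) => [|[|d]]; last by exists d.
  - by have := monic_neq0 fm; rewrite -size_poly_eq0 sf.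
  - have /size_poly1P[c c0 fc] : size f == 1%N by rewrite sf.
    move: fm; rewrite monicE fc lead_coefC => /eqP c1; move: fx.
    by rewrite fc c1 rmorph1 /root hornerC oner_eq0.
have [D [m m0 [CD CDid CD1]]] := padic_quasi_inverse (companion d f).
set C := companion d f in CD CDid CD1.
pose v := \col_(i < d.+1) x ^+ i.
pose C' := map_mx OK_of_Zp C; pose D' := map_mx OK_of_Zp D.
have Cv : C' *m v = x *: v by exact: companionE.
pose y := (D' *m v) 0 0.
have Dv : D' *m v = y *: v.
  apply: (companion_eigen (f := f) (phi := OK_of_Zp)).
  rewrite -/C -/C' mulmxA -[C' *m D']map_mxM -[C *m D]/(C * D) CD [map_mx _ _]map_mxM.
  by rewrite -mulmxA Cv -scalemxAr.
have CDv : C' *m D' *m v = (x * y) *: v by rewrite -mulmxA Dv -scalemxAr Cv scalerA mulrC.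
exists y; split.
  have EE : (C' *m D') *m (C' *m D') = C' *m D'.
    by rewrite -[C' *m D']map_mxM -map_mxM; congr map_mx; exact: CDid.
  move: (C' *m D') EE CDv => E' EE Ev.
  have : E' *m (E' *m v) = E' *m v by rewrite mulmxA EE.
  rewrite !Ev -scalemxAr Ev scalerA => /(congr1 (fun u : 'cV_d.+1 => u 0 0)).
  by rewrite !mxE expr0 !mulr1.
move=> F phi pF; exists m => //.
pose psi : {rmorphism Zp -> F} := phi \o OK_of_Zp.
have psi0 (a b : Zp) : a 1%N = b 1%N -> psi a = psi b.
  move=> ab; apply/eqP; rewrite -subr_eq0 -rmorphB.
  have [c ->] : exists c : Zp, a - b = p%:R * c.
    apply: padic_div_p; rewrite padic_addE ab -padic_addE subrr.
    by rewrite -[LHS]/(0 %% p ^ 1)%N mod0n.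
  by rewrite rmorphM rmorph_nat (pcharf0 pF) mul0r.
have psiCD : map_mx psi (C * D) = map_mx psi C ^+ m.
  rewrite -rmorphXn; apply/matrixP => i j; rewrite [LHS]mxE [RHS]mxE; apply: psi0.
  exact: CD1.
have phiv : map_mx phi v = \col_(i < d.+1) phi x ^+ i.
  by apply/colP => i; rewrite !mxE rmorphXn.
have psiC l : map_mx psi C ^+ l *m map_mx phi v = phi x ^+ l *: map_mx phi v.
  have C1 : map_mx psi C *m map_mx phi v = phi x *: map_mx phi v.
    rewrite phiv; apply: companionE => //.
    by rewrite map_poly_comp /= rmorph_root.
  elim: l => [|l IH]; first by rewrite !expr0 mul1mx scale1r.
  by rewrite exprSr -mulmxA C1 -scalemxAr IH scalerA -exprS.
have : map_mx phi (C' *m D' *m v) = phi (x * y) *: map_mx phi v by rewrite CDv map_mxZ.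
rewrite map_mxM -[C' *m D']map_mxM -map_mx_comp -[C *m D]/(C * D) psiCD psiC.
move=> /(congr1 (fun u : 'cV_d.+1 => u 0 0)); rewrite !mxE expr0 rmorph1 !mulr1.
by move=> ->.
Qed.

(** In a domain the idempotent [x * y] is 1 or 0. In the second case a power of [phi x] vanishes for
    every [phi]. Hence all morphisms to fields of characteristic p have the same kernel. *)
Lemma OK_local (x : OK) : (exists y, x * y = 1) \/
  forall (F : fieldType) (phi : {rmorphism OK -> F}), p \in [pchar F] -> phi x = 0.
Proof.
have [y [idem hphi]] := OK_quasi_inverse x.
have : val (x * y) * (val (x * y) - 1) = 0.
  by rewrite mulrBr mulr1 -rmorphM idem subrr.
move/eqP; rewrite mulf_eq0 => /orP[/eqP e0|]; last first.
  rewrite subr_eq0 => /eqP e1; left; exists y; apply: val_inj.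
  by rewrite e1 rmorph1.
right=> F phi pF; have [m m0 e] := hphi F phi pF.
have xy0 : x * y = 0 by apply: val_inj; rewrite e0 rmorph0.
by move/eqP: e; rewrite xy0 rmorph0 eq_sym expf_eq0 m0 => /eqP.
Qed.

Section Residue.
Variables (k : finFieldType) (red : {rmorphism OK -> k}).
Variable red_surj : forall a : k, exists x : OK, red x = a.
Variable pk : p \in [pchar k].

Lemma OK_unit (x : OK) : red x != 0 -> exists y, x * y = 1.
Proof. by case: (OK_local x) => // h; rewrite h ?eqxx. Qed.

Lemma red_eq0 (F : fieldType) (phi : {rmorphism OK -> F}) x :
  p \in [pchar F] -> red x = 0 -> phi x = 0.
Proof.
move=> pF rx; case: (OK_local x) => [[y xy]|]; last exact.
have := congr1 red xy; rewrite rmorphM rx mul0r rmorph1 => /eqP.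
by rewrite eq_sym oner_eq0.
Qed.
End Residue.
End LocalRing.

(** * Principal series are multiplicity free *)

Lemma char_poly_tr (F : comNzRingType) n (A : 'M[F]_n) : char_poly A^T = char_poly A.
Proof.
rewrite /char_poly -det_tr; congr (\det _).
by apply/matrixP => i j; rewrite !mxE eq_sym.
Qed.

Section Singer.
Variables (k : finFieldType) (E : closedFieldType) (iota : {rmorphism k -> E}).
Local Notation G := {'GL_2[k]}.
Local Notation q := #|k|.
Variables (p : nat) (pk : p \in [pchar k]).
Let M := (q ^ 2 - 1)%N.

Lemma torus_order_gt0 : (0 < M)%N.
Proof. by rewrite subn_gt0 -{1}(exp1n 2) ltn_exp2r // q_gt1. Qed.

Lemma torus_orderE : M = ((q - 1) * q.+1)%N.
Proof. by rewrite /M -{2}(exp1n 2) subn_sqr addn1. Qed.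

Lemma closed_prim_root n : n%:R != 0 :> E -> (0 < n)%N -> exists z : E, n.-primitive_root z.
Proof.
move=> nE n0; have [r] := closed_field_poly_normal ('X^n - 1 : {poly E}).
have mon : ('X^n - 1 : {poly E}) \is monic by exact: monicXnsubC.
rewrite (monicP mon) scale1r => rE.
have ur : uniq r by rewrite -separable_prod_XsubC -rE separable_Xn_sub_1.
have sr : size r = n.
  by have := size_XnsubC (1 : E) n0; rewrite rE size_prod_XsubC => -[].
have rr : all n.-unity_root r.
  by apply/allP => z zr; rewrite unity_rootE -subr_eq0 -[z ^+ n]hornerXn -(hornerC 1 z)
    -hornerN -hornerD rE -/(root _ _) root_prod_XsubC.
have /hasP[z _ pz] : has n.-primitive_root r by apply: has_prim_root; rewrite ?sr.
by exists z.
Qed.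

Lemma torus_order_neq0 : M%:R != 0 :> E.
Proof.
rewrite -(dvdn_pcharf (pchar_iota iota pk)); have := coprime_pq1 pk 1 (dvdnn M).
by rewrite expn1 prime_coprime // (pcharf_prime pk).
Qed.

Lemma fixed_frobq (x : E) : x ^+ q = x -> exists y, x = iota y.
Proof.
move=> xq; have : root (map_poly iota ('X^q - 'X)) x.
  by rewrite rmorphB /= map_polyXn map_polyX rootE !hornerE xq subrr.
rewrite finField_genPoly rmorph_prod /root horner_prod => /prodf_eq0[y _].
by rewrite rmorphB /= map_polyX map_polyC !hornerE subr_eq0 => /eqP ->; exists y.
Qed.

Lemma mulmx_trig_eigen (P T A : 'M[E]_2) (v : 'rV[E]_2) l : P \in unitmx -> is_trig_mx T ->
  P *m A = T *m P -> v != 0 -> v *m A = l *: v -> l = T 0 0 \/ l = T 1 1.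
Proof.
move=> uP tT PT v0 vA.
have : root (char_poly A) l by rewrite -eigenvalue_root_char; apply/eigenvalueP; exists v.
rewrite -(char_poly_intertwine uP (esym PT)) char_poly_trig // big_ord_recl big_ord1.
have -> : fintype.lift ord0 ord0 = 1 :> 'I_2 by apply: val_inj.
by rewrite rootM !root_XsubC => /orP[/eqP|/eqP]; [left|right].
Qed.

(* c is the p-th power of a generator of F_(q^2)^*: this still acts transitively
   on the projective line, as p is prime to q + 1. *)
Lemma singer_exists : exists c : G, (c ^+ M = 1)%g /\
  forall m, gl_mx (c ^+ m)%g 1 0 = 0 -> (q.+1 %| m)%N.
Proof.
have [z pz] := closed_prim_root torus_order_neq0 torus_order_gt0.
have z0 : z != 0.
  apply/eqP => z0; have /eqP := prim_expr_order pz.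
  by rewrite z0 expr0n gtn_eqF ?torus_order_gt0 // eq_sym oner_eq0.
have zqq : z ^+ q ^+ q = z.
  rewrite -exprM -[(q * q)%N]/(q ^ 2)%N -(@subnK 1 (q ^ 2)) -/M.
    by rewrite exprD (prim_expr_order pz) mul1r.
  by rewrite expn_gt0 (ltnW (q_gt1 k)).
have [t tE] : exists t, z + z ^+ q = iota t.
  by apply: fixed_frobq; rewrite exprDn_pchar ?(pchar_nat_q iota pk) // zqq addrC.
have [n nE] : exists n, z * z ^+ q = iota n.
  by apply: fixed_frobq; rewrite exprMn zqq mulrC.
(* The companion matrix of (X - z)(X - z^q), which has coefficients in [k]. *)
have uA : mk2 0 1 (- n) t \in unitmx.
  rewrite unitmxE det_mx2 !mxE /= mul0r mul1r sub0r opprK unitfE -(fmorph_eq0 iota) -nE.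
  by rewrite mulf_neq0 ?expf_neq0.
pose c0 := gl_of_mx uA.
have [P [T [uP tT T00 T11 PT]]] : exists P T : 'M[E]_2, [/\ P \in unitmx, is_trig_mx T,
    T 0 0 = z, T 1 1 = z ^+ q & P *m map_mx iota (gl_mx c0) = T *m P].
  pose P : 'M[E]_2 := mk2 (- z ^+ q) 1 0 1.
  pose T : 'M[E]_2 := mk2 z 0 z (z ^+ q).
  exists P, T; split; rewrite ?mxE //.
  - by rewrite unitmxE det_mx2 !mxE /= mulr1 mulr0 subr0 unitrN unitrX // unitfE.
  - by apply/is_trig_mxP => i j; case: (ord2P i) => ->; case: (ord2P j) => ->; rewrite ?mxE.
  - apply: eq_mx2; rewrite !mulmx2E !mxE /= ?rmorphN -?tE -?nE ?rmorph0 ?rmorph1; ring.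
have PTn m : P *m map_mx iota (gl_mx (c0 ^+ m)%g) = T ^+ m *m P.
  elim: m => [|m IH]; first by rewrite gl_mxX !expr0 map_mx1 mulmx1 mul1mx.
  by rewrite expgS gl_mxM map_mxM mulmxA PT -mulmxA IH mulmxA exprS.
have TX m : is_trig_mx (T ^+ m) /\ ((T ^+ m) 0 0 = z ^+ m /\ (T ^+ m) 1 1 = z ^+ q ^+ m).
  have [X00 X11 X01 _] := trig_mx2X m tT; rewrite X00 X11 T00 T11; split=> //.
  by apply/is_trig_mxP => i j; case: (ord2P i) => ->; case: (ord2P j) => ->.
(* The p-th power is taken because [gl_scalar_pow] controls only the exponent [M * p] of [c0]. *)
exists (c0 ^+ p)%g; split.
  have [|c cE ic] := gl_scalar_pow (o := M) (trig_eigen_pair pk uP tT PT).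
    by rewrite T00 T11 exprAC (prim_expr_order pz) expr1n.
  apply: gl_mx_inj; rewrite -expgM mulnC cE; move: ic.
  rewrite T00 exprM (prim_expr_order pz) expr1n => /eqP; rewrite fmorph_eq1 => /eqP ->.
  by rewrite /gl_mx GL_1E.
move=> m; rewrite -expgM => c10; set g := (c0 ^+ (p * m))%g in c10.
have [tX [X0 X1]] := TX (p * m)%N.
(* When the lower left entry vanishes, the row (0, 1) is an eigenvector whose eigenvalue lies in [k]
   and is z^e with e = p m or e = q p m. Its (q-1)-th power is 1, which forces q + 1 to divide e. *)
have ve : delta_mx 0 1 *m map_mx iota (gl_mx g) = iota (gl_mx g 1 1) *: (delta_mx 0 1 :
  'rV[E]_2).
  rewrite -rowE; apply/rowP => j; rewrite !mxE eqxx.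
  by case: (ord2P j) => ->; rewrite /= ?c10 ?rmorph0 ?mulr0 ?mulr1.
have v0 : (delta_mx 0 1 : 'rV[E]_2) != 0.
  by apply/eqP => /rowP/(_ 1)/eqP; rewrite !mxE !eqxx oner_eq0.
have d0 : gl_mx g 1 1 != 0.
  by apply: contraNneq (gl_mx_det g) => g11; rewrite det_mx2 c10 g11 !mulr0 subr0.
have pq1 : coprime q.+1 (p * q).
  rewrite coprimeMr; apply/andP; split.
    rewrite coprime_sym prime_coprime ?(pcharf_prime pk) //.
    have pq : (p %| q)%N.
      rewrite (q_pfactor pk) dvdn_exp // lt0n; apply/negP => /eqP f0.
      by have := q_gt1 k; rewrite (q_pfactor pk) f0.
    by apply/negP; rewrite -addn1 dvdn_addr // dvdn1 => /eqP p1; have := pcharf_prime pk;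
      rewrite p1.
  exact: coprimeSn.
have q0 : (0 < q - 1)%N by rewrite subn_gt0 q_gt1.
have div e : iota (gl_mx g 1 1) = z ^+ e -> (M %| e * (q - 1))%N.
  by move=> e1; rewrite (prim_order_dvd pz) exprM -e1 -rmorphXn fin_unit_expf ?rmorph1.
have div' e : iota (gl_mx g 1 1) = z ^+ e -> (q.+1 %| e)%N.
  by move/div; rewrite torus_orderE [(e * _)%N]mulnC dvdn_pmul2l.
have [l1|l1] := mulmx_trig_eigen uP tX (PTn _) v0 ve; move: l1; rewrite ?X0 ?X1 -?exprM.
  move/div'; rewrite Gauss_dvdr //; apply: coprime_dvdr pq1; exact: dvdn_mulr.
by move/div'; rewrite mulnA [(q * p)%N]mulnC Gauss_dvdr.
Qed.

Lemma borel_stab (g h : G) t b b' : b \in @borel k -> b' \in @borel k ->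
  g = (b * point t)%g -> h = (b' * point t)%g -> gl_mx (g * h^-1)%g 1 0 = 0.
Proof.
move=> bB b'B -> ->; rewrite invMg mulgA mulgK.
move: bB b'B; rewrite !inE => /eqP b10 /eqP b'10.
have := congr1 (fun A : 'M_2 => A 1 0) (gl_mxM (b * b'^-1)%g b').
rewrite mulgKV mulmx2E b10 b'10 mulr0 addr0 => /esym/eqP; rewrite mulf_eq0 => /orP[/eqP //|/eqP
  b'00].
by have := gl_mx_det b'; rewrite det_mx2 b'10 b'00 mulr0 mul0r subrr eqxx.
Qed.

(** The cosets B c^i for i <= q are distinct by [singer_exists], and there are only q + 1 cosets. *)
Lemma singer_cover : exists c : G, (c ^+ M = 1)%g /\
  forall y : G, exists b m, b \in @borel k /\ y = (b * c ^+ m)%g.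
Proof.
have [c [cM cdiv]] := singer_exists; exists c; split=> // y.
pose pt (i : 'I_q.+1) := projT1 (cid (point_cover (c ^+ i)%g)).
have ptP (i : 'I_q.+1) : exists b, b \in @borel k /\ (c ^+ i)%g = (b * point (pt i))%g.
  by rewrite /pt; case: cid.
have inj_pt : injective pt.
  move=> i j; wlog ij : i j / (i <= j)%N => [W e|].
    by case: (leqP i j) => [/W|/ltnW/W] => [/(_ e)|/(_ (esym e))].
  move=> e; have [b [bB bi]] := ptP i; have [b' [b'B b'j]] := ptP j.
  rewrite -e in b'j; have := borel_stab b'B bB b'j bi.
  rewrite -{1}(subnK ij) expgD mulgK => /cdiv; rewrite -/(is_true _).
  case: (posnP (j - i)) => [ji0 _|ji0 /(dvdn_leq ji0)].
    by apply: val_inj; apply/eqP; rewrite eqn_leq ij -subn_eq0 ji0.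
  by rewrite leqNgt (leq_ltn_trans (leq_subr _ _) (ltn_ord j)).
have [t [b [bB yE]]] := point_cover y.
have [i ti] : exists i, pt i = t.
  have /codomP[i ->] : t \in codom pt by apply: inj_card_onto; rewrite ?card_option ?card_ord.
  by exists i.
have [b' [b'B ciE]] := ptP i.
exists (b * b'^-1)%g, i; rewrite ciE mulgA mulgKV ti -yE; split=> //.
have pN : point None = 1%g :> G by apply: gl_mx_inj; rewrite /gl_mx GL_1E.
have -> : b = (b * point None)%g by rewrite pN mulg1.
have b'E : b' = (b' * point None)%g by rewrite pN mulg1.
by rewrite inE (borel_stab bB b'B erefl b'E).
Qed.

(** M is prime to p, so X^M - 1 is separable. *)
Lemma finite_order_diag d (A : 'M[E]_d) : A ^+ M = 1%:M ->
  exists2 P, P \in unitmx & exists D : 'rV_d, P *m A = diag_mx D *m P.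
Proof.
case: d A => [|d] A AM.
  by exists 1%:M; rewrite ?unitmx1 //; exists 0; apply/matrixP => -[].
have : diagonalizable A.
  have [r] := closed_field_poly_normal ('X^M - 1 : {poly E}).
  rewrite (monicP (monicXnsubC _ torus_order_gt0)) scale1r => rE.
  apply/diagonalizableP; exists r.
    by rewrite -separable_prod_XsubC -rE separable_Xn_sub_1 // torus_order_neq0.
  rewrite -rE; apply: mxminpoly_min.
  by rewrite rmorphB rmorph1 rmorphXn /= horner_mx_X AM subrr.
case=> P uP /diagonalizable_forPex[D /simmxP PD]; exists P => //; exists D.
exact: PD.
Qed.

(** The functional [w] is injective on every eigenspace, so eigenspaces are at most lines, while [A]
    is diagonalisable. Two basis eigenvectors with a common eigenvalue would have a nontrivial
    combination killed by [w]. *)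
Lemma uniq_eigs d (A : 'M[E]_d) (w : 'cV_d) : A ^+ M = 1%:M ->
  (forall (v : 'rV_d) l, v *m A = l *: v -> v *m w = 0 -> v = 0) -> uniq (eigs A).
Proof.
move=> AM eig1; have [P uP [D PD]] := finite_order_diag AM.
have pA : perm_eq (eigs A) [seq D 0 i | i <- enum 'I_d].
  apply: prod_XsubC_eq; rewrite -char_poly_eigs big_map big_enum /=.
  rewrite -(char_poly_intertwine uP (esym PD)) char_poly_trig ?diag_mx_is_trig //.
  by apply: eq_bigr => i _; rewrite mxE eqxx.
rewrite (perm_uniq pA) map_inj_uniq ?enum_uniq // => i j Dij; apply/eqP; apply/negPn/negP => ij.
have rP l : row l P *m A = D 0 l *: row l P.
  by rewrite -row_mul PD mul_diag_mx; apply/rowP => r; rewrite !mxE.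
pose a l := (row l P *m w) 0 0.
have aE l : row l P *m w = (a l)%:M by exact: mx11_scalar.
have w0 : a j *: row i P + (- a i) *: row j P = 0.
  apply: (eig1 _ (D 0 i)).
    by rewrite mulmxDl -!scalemxAl !rP -Dij scalerDr !scalerA ![D 0 i * _]mulrC.
  by rewrite mulmxDl -!scalemxAl !aE !scale_scalar_mx mulNr mulrC rmorphN /= subrr.
have : (a j *: delta_mx 0 i + (- a i) *: delta_mx 0 j : 'rV_d) = 0.
  by apply: (can_inj (mulmxK uP)); rewrite mulmxDl -!scalemxAl -!rowE w0 mul0mx.
move=> /rowP/(_ i); rewrite !mxE !eqxx (negbTE ij) mulr1 mulr0 addr0 => a0.
have : (delta_mx 0 j : 'rV_d) *m P = 0 *m P.
  by rewrite mul0mx -rowE; apply: (eig1 _ _ (rP j)); rewrite aE a0 raddf0.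
by move=> /(can_inj (mulmxK uP))/rowP/(_ j)/eqP; rewrite !mxE !eqxx oner_eq0.
Qed.

(* As G = B <[c]>, an eigenvector of c in the principal series is determined by
   its value at 1. *)
Lemma eigs_princ_uniq n (m : int) : exists c : G, uniq (eigs (twist iota (princ_series iota n)
  m c)).
Proof.
have [c [cM cover]] := singer_cover; exists c.
set V := princ_series iota n; set A := V c.
pose ind := ind_space (@borel k) (fun b => iota (gl_mx b 1 1) ^+ n).
pose fn (v : 'rV[E]_(\dim ind)) : {ffun G -> E^o} := \sum_l v 0 l *: (vbasis ind)`_l.
have fn_ind v : fn v \in ind.
  by apply: memv_suml => l _; apply: memvZ; rewrite vbasis_mem // mem_nth // size_tuple.
have fn_inj v : fn v = 0 -> v = 0.
  move=> f0; apply/rowP => l; rewrite [RHS]mxE.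
  by have /freeP := basis_free (vbasisP ind) => /(_ (v 0) f0 l).
have fnA (v : 'rV_(\dim ind)) : fn (v *m A^T) = rtrans c (fn v).
  rewrite /fn linear_sum /=.
  transitivity (\sum_l \sum_i (v 0 l * A i l) *: (vbasis ind)`_i).
    rewrite exchange_big; apply: eq_bigr => i _; rewrite mxE scaler_suml.
    by apply: eq_bigr => l _; rewrite [A^T _ _]mxE.
  apply: eq_bigr => l _; rewrite linearZ /=.
  have bV : (vbasis ind)`_l \in ind by rewrite vbasis_mem // mem_nth // size_tuple.
  rewrite [rtrans c _](coord_vbasis (ind_space_rtrans c bV)) scaler_sumr.
  by apply: eq_bigr => i _; rewrite scalerA [A _ _]mxE.
have eig1 v l : v *m A^T = l *: v -> fn v 1%g = 0 -> v = 0.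
  move=> vA f1; apply: fn_inj; apply/ffunP => y; rewrite [RHS]ffunE.
  have [b [j [bB ->]]] := cover y; have /ind_spaceP -> // := fn_ind v.
  have fc x : fn v (x * c)%g = l * fn v x.
    have := congr1 (fun f : {ffun G -> E^o} => f x) (fnA v); rewrite vA [RHS]ffunE => <-.
    by rewrite /fn; under eq_bigr => i _ do rewrite mxE -scalerA; rewrite -scaler_sumr ffunE.
  suff -> : fn v (c ^+ j)%g = 0 by rewrite mulr0.
  by elim: j => [|j IH]; rewrite ?expg0 // expgSr fc IH mulr0.
have AM : A^T ^+ M = 1%:M.
  have AX m' : A^T ^+ m' = (V (c ^+ m')%g)^T.
    elim: m' => [|m' IH]; first by rewrite expg0 repr_mx1 trmx1.
    by rewrite exprS IH expgSr repr_mxM ?in_setT // trmx_mul.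
  by rewrite AX cM repr_mx1 trmx1.
have uA : uniq (eigs A).
  have pA : perm_eq (eigs A^T) (eigs A).
    by apply: prod_XsubC_eq; rewrite -!char_poly_eigs char_poly_tr.
  rewrite -(perm_uniq pA).
  apply: (@uniq_eigs _ _ (\col_l ((vbasis ind)`_l : {ffun G -> E^o}) 1%g)) => // v l vA.
  move=> /matrixP/(_ 0 0); rewrite [LHS]mxE [RHS]mxE => v1; apply: (eig1 _ _ vA).
  apply: etrans v1; rewrite /fn sum_ffunE.
  by apply: eq_bigr => r _; rewrite ffunE [fun_of_matrix (\col_ _ _) _ _]mxE.
rewrite (perm_uniq (eigs_tens _ _)) eigs_scalar.
have -> : [seq a * b | a <- eigs (V c), b <- [:: iota (\det (gl_mx c)) ^ m]]
  = [seq a * iota (\det (gl_mx c)) ^ m | a <- eigs A].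
  by rewrite -/A; elim: (eigs A) => //= a s ->.
by rewrite map_inj_uniq //; apply: mulIf; rewrite expfz_neq0 // fmorph_eq0 gl_mx_det.
Qed.

(** A constituent occurring twice would give the element of [eigs_princ_uniq] a double
    eigenvalue. *)
Lemma princ_mult_le1 n (m : int) L : (mult (twist iota (princ_series iota n) m) L <= 1)%N.
Proof.
have [c uc] := eigs_princ_uniq n m; set V := twist _ _ _ in uc *.
rewrite leqNgt; apply/negP => m2.
have irrL : mx_irreducible L by apply: (mult_irr (pchar_iota iota pk) (ltnW m2)).
have := mult_char_poly_dvd (pchar_iota iota pk) V L c.
have /mx_irrP[L0 _] := irrL.
have : size (eigs (L c)) != 0%N by rewrite size_eigs -lt0n.
case eL: (eigs (L c)) => [//|z s] _.
have zL : 'X - z%:P %| char_poly (L c).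
  by rewrite dvdp_XsubCl -eigenvalue_root_char -mem_eigs eL mem_head.
move=> /(dvdp_trans (dvdp_exp2l _ m2)) /(dvdp_trans (dvdp_exp2r 2 zL)).
rewrite char_poly_eigs => h.
have nz : \prod_(z <- eigs (V c)) ('X - z%:P) != 0.
  by rewrite monic_neq0 // monic_prod_XsubC.
by move: h; rewrite -(mup_geq _ _ nz) mu_prod_XsubC (count_uniq_mem _ uc); case: (_ \in _).
Qed.
End Singer.

(** * Multiplicities and twists *)

Lemma castmx_intertwine (F : pzSemiRingType) d d' (e : d' = d) (A : 'M[F]_d) :
  castmx (esym e, esym e) A *m castmx (erefl d', e) 1%:M = castmx (erefl d', e) 1%:M *m A.
Proof. by subst d'; rewrite !castmx_id mul1mx mulmx1. Qed.

Lemma castmx_free (F : fieldType) d d' (e : d' = d) :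
  row_free (castmx (erefl d', e) (1%:M : 'M[F]_d')).
Proof. by subst d; rewrite castmx_id row_free_unit unitmx1. Qed.

Section Twist.
Variables (k : finFieldType) (E : closedFieldType) (iota : {rmorphism k -> E}).
Local Notation G := {'GL_2[k]}.
Local Notation q := #|k|.
Variables (p : nat) (pk : p \in [pchar k]).
Implicit Types V W L : rep E G.
Local Notation sim V W := (mx_rsim (rep_mx V) (rep_mx W)).

Lemma iota_det_neq0 (g : G) : iota (\det (gl_mx g)) != 0.
Proof. by rewrite fmorph_eq0 gl_mx_det. Qed.

Fact scal_mx_repr V (m : int) :
  mx_repr [set: G] (fun g => iota (\det (gl_mx g)) ^ m *: V g).
Proof.
split=> [|g h _ _]; first by rewrite /gl_mx GL_1E det1 rmorph1 exp1rz scale1r repr_mx1.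
rewrite gl_mxM det_mulmx rmorphM /= expfzMl repr_mxM ?in_setT //.
by rewrite -scalemxAl -scalemxAr scalerA.
Qed.
(** The twist on the same matrix size as [V]; the tensor product has size [rdim V * 1], which would
    force casts. *)
Definition scal_rep V m : rep E G := Rep (MxRepresentation (scal_mx_repr V m)).

Lemma twist_scal V m : sim (twist iota V m) (scal_rep V m).
Proof.
exists (castmx (erefl _, muln1 _) 1%:M) => [||g _]; first exact: muln1.
  exact: castmx_free.
by rewrite /= tens_mx_scalar castmx_intertwine.
Qed.

Lemma char_poly_twist V m g :
  char_poly (twist iota V m g) = char_poly (iota (\det (gl_mx g)) ^ m *: V g).
Proof. exact: char_poly_tens_scalar. Qed.

Lemma scal_sim V W a b a' b' : (a - b = a' - b' %[mod q%:Z - 1])%Z ->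
  sim (scal_rep V a) (scal_rep W b) -> sim (scal_rep V a') (scal_rep W b').
Proof.
move=> ab [B dVW fB homB]; exists B => // g _.
have d0 := iota_det_neq0 g; set c := iota _ in d0.
have cE : c ^ (a' - a) = c ^ (b' - b).
  apply: iota_exprz_mod; first exact: gl_mx_det.
  apply/eqP; rewrite eqz_mod_dvd; move/esym/eqP: ab; rewrite eqz_mod_dvd.
  by congr (_ %| _)%Z; ring.
have -> : scal_rep V a' g = c ^ (a' - a) *: scal_rep V a g.
  by rewrite /= -/c scalerA -expfzDr // subrK.
have -> : scal_rep W b' g = c ^ (b' - b) *: scal_rep W b g.
  by rewrite /= -/c scalerA -expfzDr // subrK.
rewrite cE -scalemxAl -scalemxAr.
by rewrite (homB g) ?in_setT.
Qed.

Lemma scal_irr V m : mx_irreducible (rep_mx V) -> mx_irreducible (rep_mx (scal_rep V m)).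
Proof.
move=> /mx_irrP[d0 irrV]; apply/mx_irrP; split=> // U /mxmoduleP modU; apply: irrV.
apply/mxmoduleP => g gG; have := modU g gG; rewrite /= -scalemxAr.
by rewrite (eqmx_scale _ _) // expfz_neq0 // iota_det_neq0.
Qed.

Lemma twist_irr V m : mx_irreducible (rep_mx V) -> mx_irreducible (rep_mx (twist iota V m)).
Proof. by move/(scal_irr m); apply: mx_rsim_irr; apply: mx_rsim_sym; exact: twist_scal. Qed.

Lemma mult_of_irr V L : mx_irreducible (rep_mx V) -> mult V L = `[< sim V L >] :> nat.
Proof.
move=> irrV; have [t [irrt cht _ ->]] := composition_factors (pchar_iota iota pk) V.
rewrite -(@count_irr_unique _ _ _ (pchar_iota iota pk) [:: V]) //= ?addn0 //.
  by move=> W; rewrite inE => /eqP ->.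
by move=> g; rewrite big_seq1 cht.
Qed.

(** Additivity in [V] reduces to irreducible [V], where both sides are the indicator of one and the
    same isomorphism. *)
Lemma mult_twist V L a b a' b' : (a - b = a' - b' %[mod q%:Z - 1])%Z ->
  mult (twist iota V a) (twist iota L b) = mult (twist iota V a') (twist iota L b').
Proof.
move=> ab; have [t [irrt _ grt _]] := composition_factors (pchar_iota iota pk) V.
have multE c d : (mult (twist iota V c) (twist iota L d))%:R
    = \sum_(s <- t) (mult (twist iota s c) (twist iota L d))%:R :> int.
  pose phi := fun s => (mult (twist iota s c) (twist iota L d))%:R : int.
  have phiD V1 V2 V3 : ses V1 V2 V3 -> phi V2 = phi V1 + phi V3.
    by move=> e; apply: (mult_additive _ (pchar_iota iota pk)); exact: ses_tensl.
  have := groth_fun_cl phiD V; rewrite -/(phi V) => <-; rewrite grt (groth_fun_sum phiD).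
  by apply: eq_bigr => s _; rewrite (groth_fun_cl phiD).
apply/eqP; rewrite -(eqr_nat int) !multE; apply/eqP; apply: eq_big_seq => s /irrt irrs.
rewrite !mult_of_irr; try exact: twist_irr.
congr (nat_of_bool _)%:R; apply/asboolP/asboolP => h.
all: apply: (mx_rsim_trans (twist_scal _ _)); apply: (mx_rsim_trans _ (mx_rsim_sym (twist_scal
  _ _))).
all: have := mx_rsim_trans (mx_rsim_trans (mx_rsim_sym (twist_scal _ _)) h) (twist_scal _ _).
all: by apply: scal_sim.
Qed.

End Twist.

Lemma tensmx_scalar (F : fieldType) m n (a b : F) :
  (a%:M : 'M_m) *t (b%:M : 'M_n) = (a * b)%:M.
Proof.
apply/matrixP => i j; case: (mxtens_indexP i) => i1 i2.
case: (mxtens_indexP j) => j1 j2; rewrite tensmxE !mxE.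
rewrite (inj_eq (can_inj (@mxtens_indexK m n))) xpair_eqE.
by case: (i1 == j1); case: (i2 == j2); rewrite /= ?mulr0n ?mulr1n ?mulr0 ?mul0r.
Qed.

Lemma eqz_modP (x y d : int) : (x = y %[mod d])%Z <-> exists t, x = y + t * d.
Proof.
split=> [/eqP|[t ->]]; last by rewrite addrC modzMDl.
by rewrite eqz_mod_dvd => /dvdzP[t e]; exists t; rewrite -e addrC subrK.
Qed.

(** This and the next two lemmas are the arithmetic of the bijection between the summands of P_N
    containing L_n(m) and the pairs counted by [omega]. *)
Lemma congr_diff (d i b m a n x N : int) : (i = b + m %[mod d])%Z -> (a + b * 2 = n %[mod d])%Z
  ->
  (x + i * 2 = N %[mod d])%Z -> (n + 2 * m = N %[mod d])%Z -> (x = a %[mod d])%Z.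
Proof.
move=> /eqz_modP[t1 e1] /eqz_modP[t2 e2] /eqz_modP[t3 e3] /eqz_modP[t4 e4].
by apply/eqz_modP; exists (t3 - t4 - t2 - t1 - t1); lra.
Qed.

Lemma congr_inj (d a b a' b' m n : int) : (a + b * 2 = n %[mod d])%Z -> (a' + b' * 2 = n %[mod
  d])%Z ->
  (b + m = b' + m %[mod d])%Z -> (a = a' %[mod d])%Z /\ (b = b' %[mod d])%Z.
Proof.
move=> /eqz_modP[t e] /eqz_modP[t' e'] /eqz_modP[u v].
by split; apply/eqz_modP; [exists (t - t' - u - u)|exists u]; lra.
Qed.

Lemma congr_surj (d a b i m n x N : int) : (a = x %[mod d])%Z -> (b = i - m %[mod d])%Z ->
  (x + i * 2 = N %[mod d])%Z -> (n + 2 * m = N %[mod d])%Z ->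
  (i = b + m %[mod d])%Z /\ (a + b * 2 = n %[mod d])%Z.
Proof.
move=> /eqz_modP[t1 e1] /eqz_modP[t2 e2] /eqz_modP[t3 e3] /eqz_modP[t4 e4].
by split; apply/eqz_modP; [exists (- t2)|exists (t1 + t2 + t2 + t3 - t4)]; lra.
Qed.

(** * Central characters and the coefficients of P_N *)

Section Central.
Variables (k : finFieldType) (E : closedFieldType) (iota : {rmorphism k -> E}).
Local Notation G := {'GL_2[k]}.
Local Notation q := #|k|.
Implicit Types V W L : rep E G.

Lemma finField_prim_root : exists z : k, (q - 1).-primitive_root z.
Proof.
have q0 : (0 < q - 1)%N by rewrite subn_gt0 q_gt1.
have /hasP[z _ pz] : has (q - 1).-primitive_root (enum (predC1 (0 : k))).
  apply: has_prim_root => //; last 2 first.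
  - exact: enum_uniq.
  - by rewrite -cardE cardC1 subn1.
  apply/allP => z; rewrite mem_enum inE => z0.
  by rewrite unity_rootE fin_unit_expf.
by exists z.
Qed.

Lemma iota_exprz_inj (x y : int) : (forall c : k, c != 0 -> iota c ^ x = iota c ^ y) ->
  (x = y %[mod q%:Z - 1])%Z.
Proof.
move=> xy; have [z pz] := finField_prim_root.
have z0 : z != 0.
  apply/eqP => z0; have /eqP := prim_expr_order pz.
  by rewrite z0 expr0n gtn_eqF ?subn_gt0 ?q_gt1 // eq_sym oner_eq0.
have iz0 : iota z != 0 by rewrite fmorph_eq0.
have main d : iota z ^ d = 1 -> (q%:Z - 1 %| d)%Z.
  have qE : q%:Z - 1 = (q - 1)%N%:Z by rewrite -subzn // ltnW // q_gt1.
  have pos (e : nat) : iota z ^+ e = 1 -> (q%:Z - 1 %| e%:Z)%Z.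
    by move/eqP; rewrite -rmorphXn fmorph_eq1 -(prim_order_dvd pz) qE.
  case: d => e; first exact: pos.
  rewrite NegzE -exprnN => /(congr1 GRing.inv); rewrite invrK invr1 => /pos.
  by rewrite rpredN.
apply/eqP; rewrite eqz_mod_dvd; apply: main.
by rewrite expfzDr // (xy z z0) -expfzDr // subrr.
Qed.

Definition gl_scalar (c : k) (c0 : c != 0) : G.
Proof.
by refine (@gl_of_mx k c%:M _); rewrite unitmxE det_scalar unitfE expf_neq0.
Defined.

Lemma gl_scalarE c (c0 : c != 0) : gl_mx (gl_scalar c0) = c%:M.
Proof. by []. Qed.

Lemma gl_mx_scalar_neq0 (g : G) c : gl_mx g = c%:M -> c != 0.
Proof.
by move=> gc; apply: contraNneq (gl_mx_det g) => c0; rewrite gc c0 det_scalar expr0n.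
Qed.

Lemma central_char_det m : has_central_char iota (rep_det iota m) (m * 2).
Proof.
move=> g a ga; rewrite /= ga det_scalar rmorphXn; congr (_%:M).
by rewrite exprnP exprz_exp mulrC.
Qed.

Lemma central_char_tens V W i j : has_central_char iota V i -> has_central_char iota W j ->
  has_central_char iota (rep_tens V W) (i + j).
Proof.
move=> Vi Wj g a ga; rewrite /= (Vi g a ga) (Wj g a ga).
rewrite expfzDr ?fmorph_eq0 ?(gl_mx_scalar_neq0 ga) //.
exact: tensmx_scalar.
Qed.

Lemma central_char_twist V i m : has_central_char iota V i ->
  has_central_char iota (twist iota V m) (i + m * 2).
Proof. by move=> Vi; apply: central_char_tens => //; exact: central_char_det. Qed.

Lemma central_char_symm n : has_central_char iota (rep_symm iota n) n%:Z.
Proof.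
move=> g a ga; rewrite /= ga; rewrite map_scalar_mx; move: (iota a) => b; apply/matrixP => i j.
have jn : (j <= n)%N by rewrite -ltnS.
rewrite !mxE /= !mulr1n !mulr0n scale0r addr0 add0r exprZn -rmorphXn mul_polyC scalerA -exprD
  subnK //.
by rewrite coefZ coefXn mulr_natr.
Qed.
Variables (p : nat) (pk : p \in [pchar k]).

Lemma central_char_frob V i j : has_central_char iota V i ->
  has_central_char iota (iter j (rep_frob pk) V) ((p ^ j)%N%:Z * i).
Proof.
move=> Vi; elim: j => [|j IH] g a ga; first by rewrite expn0 mul1r; exact: Vi.
rewrite /= (IH _ (a ^+ p)); last first.
  by rewrite /gl_mx /= -[GLval g]/(gl_mx g) ga map_scalar_mx.
by rewrite rmorphXn /= exprnP exprz_exp expnS PoszM mulrA.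
Qed.

Lemma digits_sum f n : (0 < p)%N -> (\sum_(i < f) p ^ i * (n %/ p ^ i %% p) = n %% p ^ f)%N.
Proof.
move=> p0; elim: f => [|f IH]; first by rewrite big_ord0 expn0 modn1.
rewrite big_ord_recr IH /= expnSr; have pf : (0 < p ^ f)%N by rewrite expn_gt0 p0.
have := divn_eq (n %/ p ^ f) p; rewrite -divnMA => e.
have h := divn_eq n (p ^ f); rewrite {1}e in h.
apply/esym; rewrite {1}h mulnDl -mulnA [(p * p ^ f)%N]mulnC -addnA modnMDl modn_small; first by
  rewrite addnC [(_ %% p * _)%N]mulnC.
by have := ltn_mod (n %/ p ^ f) p; have := ltn_mod n (p ^ f); rewrite p0 pf; nia.
Qed.

Lemma central_char_irr n m : (n < q)%N ->
  has_central_char iota (rep_irr iota pk n m) (n%:Z + 2 * m).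
Proof.
move=> nq; rewrite [2 * m]mulrC; apply: central_char_twist.
have p0 : (0 < p)%N by exact: prime_gt0 (pcharf_prime pk).
have nE : n = (\sum_(i < res_degree k p) p ^ i * (n %/ p ^ i %% p))%N.
  by rewrite digits_sum // -(q_pfactor pk) modn_small.
rewrite [X in has_central_char _ _ X%:Z]nE.
elim/big_ind2: _ => [|V i W j Vi Wj|i _].
- by move=> g a ga; rewrite expr0z.
- by rewrite PoszD; exact: central_char_tens.
- rewrite [Posz _]PoszM; apply: central_char_frob; exact: central_char_symm.
Qed.

Lemma central_char_princ n : has_central_char iota (princ_series iota n) n%:Z.
Proof.
move=> g a ga; set ind := ind_space (@borel k) (fun b => iota (gl_mx b 1 1) ^+ n).
rewrite /princ_series /=; apply/matrixP => i j; rewrite [LHS]mxE [RHS]mxE.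
have bV : (vbasis ind)`_j \in ind by rewrite vbasis_mem // mem_nth // size_tuple.
have -> : rtrans g (vbasis ind)`_j = iota a ^+ n *: (vbasis ind)`_j.
  apply/ffunP => x; rewrite !ffunE.
  have -> : (x * g = g * x)%g.
    by apply: gl_mx_inj; rewrite !gl_mxM ga scalar_mxC.
  have /ind_spaceP -> // := bV; last by rewrite inE ga mxE.
  by rewrite ga mxE eqxx mulr1n.
rewrite linearZ /= (coord_free j i (basis_free (vbasisP ind))).
by rewrite [j == i]eq_sym mulr_natr.
Qed.

Lemma mult_central_char V L i j : has_central_char iota V i -> has_central_char iota L j ->
  (0 < mult V L)%N -> (i = j %[mod q%:Z - 1])%Z.
Proof.
move=> Vi Lj m0; apply: iota_exprz_inj => c c0.
have /mx_irrP[d0 _] := mult_irr (pchar_iota iota pk) m0.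
have := mult_char_poly_dvd (pchar_iota iota pk) V L (gl_scalar c0).
rewrite (Vi _ _ (gl_scalarE c0)) (Lj _ _ (gl_scalarE c0)) !char_poly_scalar -exprM => h.
have : root (('X - (iota c ^ i)%:P) ^+ rdim V) (iota c ^ j).
  rewrite root_factor_theorem; apply: dvdp_trans h.
  by rewrite dvdp_exp // muln_gt0 d0.
have [->|V0] := posnP (rdim V); first by rewrite expr0 (negbTE (root1 _)).
by rewrite rootE horner_exp expf_eq0 V0 hornerXsubC subr_eq0 => /eqP.
Qed.

Lemma princ_series_eq n n' : (n = n' %[mod q - 1])%N -> princ_series iota n = princ_series iota
  n'.
Proof.
move=> nn'.
(* The matrix size depends on the induced space, so equality of spaces is substituted in the whole
   representation. The spaces agree because the entry [gl_mx b 1 1] is nonzero on the Borel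
   subgroup. *)
pose F (U : {vspace {ffun G -> E^o}}) := fun g => \matrix_(i, j) coord (vbasis U) i (rtrans g
  (vbasis U)`_j) : 'M_(\dim U).
have eqF U U' : U = U' -> forall (r : mx_repr [set: G] (F U)) (r' : mx_repr [set: G] (F U')),
    Rep (MxRepresentation r) = Rep (MxRepresentation r').
  by move=> <- r r'; congr Rep; congr MxRepresentation; exact: Prop_irrelevance.
apply: eqF; apply/vspaceP => u; apply/ind_spaceP/ind_spaceP => h b x bB; rewrite h //; congr (_
  * _).
all: have b0 : gl_mx b 1 1 != 0 by apply: contraNneq (gl_mx_det b) => b11; move: bB; rewrite
  inE det_mx2 b11 => /eqP ->; rewrite !mulr0 subrr.
all: rewrite !exprnP; apply: iota_exprz_mod => //.
all: have qE : q%:Z - 1 = (q - 1)%N%:Z by rewrite -subzn // ltnW // q_gt1.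
all: by rewrite qE !modz_nat nn'.
Qed.

Section Coefficient.
Variable R : comNzRingType.
Local Notation cl := (groth_cl R).
Local Notation gmul := (@groth_mul R E G).
Local Notation M := (q ^ 2 - 1)%N.

Lemma groth_cl_twist V m : cl (twist iota V m) = gmul (cl V) (cl (rep_det iota m)).
Proof. exact: groth_cl_tens. Qed.

Lemma groth_cl_twistD V a b : cl (twist iota (twist iota V a) b) = cl (twist iota V (a + b)).
Proof.
rewrite !groth_cl_twist -(groth_mulA (pchar_iota iota pk)); congr (gmul _ _).
rewrite -groth_cl_tens; apply: (groth_cl_char_poly (pchar_iota iota pk)) => g.
rewrite /= tensmx_scalar !char_poly_scalar expfzDr //.
exact: iota_det_neq0.
Qed.

Lemma groth_cl_twist_mod V a b : (a = b %[mod q%:Z - 1])%Z ->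
  cl (twist iota V a) = cl (twist iota V b).
Proof.
move=> ab; apply: (groth_cl_char_poly (pchar_iota iota pk)) => g.
by rewrite !char_poly_twist (iota_exprz_mod _ _ ab) // gl_mx_det.
Qed.

Lemma groth_cl_symmD n j :
  cl (rep_symm iota (n + j * q.+1)) = \sum_(i < j) cl (twist iota (princ_series iota (n + (j -
    i) * q.+1)) i%:Z)
     + cl (twist iota (rep_symm iota n) j%:Z).
Proof.
elim: j => [|j IH].
  rewrite big_ord0 add0r mul0n addn0; apply: (groth_cl_char_poly (pchar_iota iota pk)) => g.
  by rewrite char_poly_twist expr0z scale1r.
rewrite mulSn addnCA addnC (groth_cl_dickson _ pk) big_ord_recl subn0 -addrA; congr (_ + _).
  rewrite -addnA [(_ * _ + _)%N]addnC -mulSn; apply: (groth_cl_char_poly (pchar_iota iota pk))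
    => g.
  by rewrite char_poly_twist expr0z scale1r.
rewrite groth_cl_twist IH groth_mulDl; congr (_ + _).
  rewrite (groth_mulC (pchar_iota iota pk)) groth_mul_sumr; apply: eq_bigr => i _.
  rewrite (groth_mulC (pchar_iota iota pk)) -groth_cl_twist groth_cl_twistD subSS.
  by congr (cl (twist _ _ _)); rewrite /bump /= addrC.
by rewrite -groth_cl_twist groth_cl_twistD addrC.
Qed.

Definition symm_diff N := cl (rep_symm iota (N + M)) - cl (rep_symm iota N).

(** As M = (q - 1)(q + 1), Dickson's sequence is applied q - 1 times, and the remaining S_N(q - 1)
    is S_N again. *)
Lemma symm_diffE N : symm_diff N =
  \sum_(i < q - 1) cl (twist iota (princ_series iota (N + (q - 1 - i) * q.+1)) i%:Z).
Proof.
rewrite /symm_diff torus_orderE groth_cl_symmD.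
rewrite (@groth_cl_twist_mod _ (q - 1)%N%:Z 0); last first.
  have -> : q%:Z - 1 = (q - 1)%N%:Z by rewrite -subzn // ltnW // q_gt1.
  by rewrite !modz_nat modnn mod0n.
suff -> : cl (twist iota (rep_symm iota N) 0) = cl (rep_symm iota N) by rewrite addrK.
apply: (groth_cl_char_poly (pchar_iota iota pk)) => g.
by rewrite char_poly_twist expr0z scale1r.
Qed.

(** A pair (n', m') counted by [omega] satisfies n' + 2 m' = n mod q - 1, so m' determines it.
    Twisting by m sends it to the summand with index i = m' + m, and this reaches every summand that
    contains L_n(m). *)
Lemma groth_coef_symm_diff N n m : (n < q)%N ->
  groth_coef (rep_irr iota pk n m) (symm_diff N)
  = if (n%:Z + 2 * m == N%:Z %[mod q%:Z - 1])%Z then (omega iota pk n)%:R else 0.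
Proof.
move=> nq; set L := rep_irr _ _ _ _.
have Lc : has_central_char iota L (n%:Z + 2 * m) by exact: central_char_irr.
have mD V1 V2 V3 : ses V1 V2 V3 -> _ := mult_additive R (pchar_iota iota pk) L (V' := V1) (V :=
  V2) (V'' := V3).
rewrite groth_coefE symm_diffE (groth_fun_sum mD).
have qE : q%:Z - 1 = (q - 1)%N%:Z by rewrite -subzn // ltnW // q_gt1.
pose nn i := (N + (q - 1 - i) * q.+1)%N.
have nnE (i : nat) : (i < q - 1)%N -> ((nn i)%:Z + i%:Z * 2 = N%:Z %[mod q%:Z - 1])%Z.
  move=> iq; apply/eqP; rewrite eqz_mod_dvd; apply/dvdzP; exists (q%:Z + 1 - i%:Z).
  have := ltnW (q_gt1 k); rewrite /nn; nia.
case: ifP => [/eqP nN|/negP nN]; last first.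
  rewrite big1 // => i _; rewrite (groth_fun_cl mD).
  have := @mult_central_char (twist iota (princ_series iota (nn i)) i%:Z) L _ _
    (central_char_twist _ (central_char_princ _)) Lc.
  case: (mult _ _) => // d /(_ isT) e; case: nN; apply/eqP; rewrite -e.
  by apply: nnE.
under eq_bigr => i _ do rewrite (groth_fun_cl mD).
rewrite -natr_sum; congr (_%:R).
pose P i := (0 < mult (twist iota (princ_series iota (nn i)) i%:Z) L)%N.
(* Since principal series are multiplicity free, each multiplicity is the indicator [P i]. *)
transitivity (\sum_(i < q - 1) P i)%N.
  apply: eq_bigr => i _; rewrite /P.
  by case: mult (princ_mult_le1 iota pk (nn i) i%:Z L) => [|[]].
transitivity #|[set i : 'I_q.-1 | P i]%SET|.
  by rewrite -sum1dep_card [in RHS]big_mkcond subn1.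
rewrite /omega.
set S := (X in _ = #|pred_of_set X|).
have q1 : (0 < q.-1)%N by rewrite -subn1 subn_gt0 q_gt1.
have [res resE] : exists res : int -> 'I_q.-1, forall z, ((res z)%:Z = z %[mod q%:Z - 1])%Z.
  have Q0 : q.-1%:Z != 0 by rewrite -lt0n.
  have ge z : `|(z %% q.-1%:Z)%Z|%N = (z %% q.-1%:Z)%Z :> int by rewrite gez0_abs // modz_ge0.
  have lt z : (`|(z %% q.-1%:Z)%Z|%N < q.-1)%N by rewrite -ltz_nat ge ltz_pmod.
  by exists (fun z => Ordinal (lt z)) => z /=; rewrite ge qE subn1 modz_mod.
have res_inj (i j : 'I_q.-1) : (i%:Z = j%:Z %[mod q%:Z - 1])%Z -> i = j.
  move=> ij; apply: val_inj => /=.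
  by move: ij; rewrite qE subn1 !modz_nat !modn_small // => -[].
pose f (x : 'I_q.-1 * 'I_q.-1) := res (x.2%:Z + m).
have iQ (i : 'I_q.-1) : (i < q - 1)%N by rewrite subn1.
have inS x : x \in S -> (x.1%:Z + x.2%:Z * 2 = n%:Z %[mod q%:Z - 1])%Z.
  rewrite inE => /mult_central_char h.
  by rewrite (h _ _ (central_char_twist _ (central_char_princ _)) (central_char_irr 0 nq))
    mulr0 addr0.
have key (a b i : 'I_q.-1) : (i%:Z = b%:Z + m %[mod q%:Z - 1])%Z ->
    (a%:Z + b%:Z * 2 = n%:Z %[mod q%:Z - 1])%Z -> P i = ((a, b) \in S).
  move=> ib an; rewrite inE /= /P (@princ_series_eq (nn i) a); last first.
    have := congr_diff ib an (nnE i (iQ i)) nN.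
    by rewrite qE !modz_nat => -[].
  rewrite (@mult_twist _ _ _ _ pk _ _ i%:Z m b%:Z 0) // subr0.
  by have /eqz_modP[t1 e1] := ib; apply/eqz_modP; exists t1; rewrite e1 addrAC addrK.
suff -> : [set i : 'I_q.-1 | P i]%SET = (f @: S)%SET.
  rewrite card_in_imset // => -[a b] [a' b'] /inS /= e /inS /= e'.
  move=> /(congr1 (fun i : 'I_q.-1 => (i%:Z %% (q%:Z - 1))%Z)); rewrite !resE => v.
  by have [/res_inj -> /res_inj ->] := congr_inj e e' v.
apply/setP => i; rewrite !inE; apply/idP/imsetP => [Pi|[x xS ->]].
  have [e1 e2] := congr_surj (resE (nn i)%:Z) (resE (i%:Z - m)) (nnE i (iQ i)) nN.
  exists (res (nn i)%:Z, res (i%:Z - m)); first by rewrite -(key _ _ i).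
  by apply: res_inj; rewrite resE.
rewrite (@key x.1 x.2) ?resE //; first by case: x xS.
exact: inS.
Qed.
End Coefficient.

End Central.

(** * Ring morphisms from O_K to a field of characteristic p *)

Lemma fixed_frobp (k : finFieldType) p (pk : p \in [pchar k]) (c : k) :
  c ^+ p = c -> exists m : nat, c = m%:R.
Proof.
move=> cp; pose rs := [seq m%:R : k | m <- iota 0 p].
have p1 := prime_gt1 (pcharf_prime pk).
have [/mapP[m _ ->]|cN] := boolP (c \in rs); first by exists m.
have sP : size ('X^p - 'X : {poly k}) = p.+1.
  by rewrite size_polyDl ?size_polyXn // size_polyN size_polyX ltnS.
have P0 : 'X^p - 'X != 0 :> {poly k} by rewrite -size_poly_eq0 sP.
suff: false by []; have := @max_poly_roots _ _ (c :: rs) P0; rewrite sP /= size_map size_iota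
  ltnn; apply.
  rewrite rootE !hornerE cp subrr eqxx; apply/allP => z /mapP[m _ ->].
  by rewrite rootE !hornerE -(pFrobenius_autE pk) rmorph_nat subrr.
rewrite cN map_inj_in_uniq ?iota_uniq // => m m'; rewrite !mem_iota !add0n => mp m'p.
by move/(natr_inj_modp pk); rewrite !modn_small.
Qed.

Section ResidueMorphism.
Variables (p : nat) (p_pr : prime p) (K : fieldExtType (Qp p_pr)).
Local Notation OK := (OK K).
Variables (k : finFieldType) (red : {rmorphism OK -> k}).
Hypothesis red_surj : forall a : k, exists x : OK, red x = a.
Variable pk : p \in [pchar k].
Variables (E : closedFieldType) (iota : {rmorphism k -> E}).
Local Notation q := #|k|.

Lemma OK_morph_red (phi : {rmorphism OK -> E}) x y : red x = red y -> phi x = phi y.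
Proof.
move=> xy; apply/eqP; rewrite -subr_eq0 -rmorphB.
by rewrite (red_eq0 (red := red) _ (pchar_iota iota pk)) // rmorphB xy subrr.
Qed.

(* The polynomial with roots the Frobenius conjugates of a generator of k^* has
   coefficients in the prime field, so that a ring morphism permutes its roots. *)
Lemma OK_morphE (phi : {rmorphism OK -> E}) :
  exists j, forall x, phi x = iota (red x) ^+ (p ^ j).
Proof.
have [t pt] := finField_prim_root k; have [x0 x0t] := red_surj t.
pose F j : {poly k} := 'X - (t ^+ (p ^ j))%:P.
pose P := \prod_(j < res_degree k p) F j.
have frobP : map_poly (pFrobenius_aut pk) P = P.
  rewrite rmorph_prod.
  transitivity (\prod_(j < res_degree k p) F j.+1).
    by apply: eq_bigr => j _; rewrite rmorphB /= map_polyX map_polyC /= pFrobenius_autE -exprM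
      -expnSr.
  have Ff : F (res_degree k p) = F 0%N by rewrite /F -(q_pfactor pk) expf_card expn0 expr1.
  by rewrite /P; case: res_degree Ff => [|f] Ff; rewrite ?big_ord0 // big_ord_recr big_ord_recl
    /= Ff mulrC.
have /choice[m mE] i : exists m : nat, P`_i = m%:R.
  by apply: (fixed_frobp pk); rewrite -(pFrobenius_autE pk) -coef_map frobP.
pose Q : {poly OK} := \poly_(i < size P) (m i)%:R.
have mapQ (S : nzRingType) (psi : {rmorphism OK -> S}) : map_poly psi Q = \poly_(i < size P) (m
  i)%:R.
  apply/polyP => i; rewrite coef_map !coef_poly; case: ifP => _; last exact: rmorph0.
  exact: (rmorph_nat psi).
have redQ : map_poly red Q = P.
  by rewrite mapQ -[RHS]coefK; apply/polyP => i; rewrite !coef_poly mE.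
have phiQ : map_poly phi Q = map_poly iota P.
  have iE i : (m i)%:R = iota P`_i :> E by rewrite mE; exact/esym/(rmorph_nat iota).
  rewrite mapQ; apply/polyP => i; rewrite coef_poly [RHS]coef_map /= iE; case: ltnP => // Pi.
  by rewrite nth_default ?rmorph0.
have : root (map_poly iota P) (phi x0).
  rewrite -phiQ rootE horner_map (OK_morph_red phi (y := 0)) ?rmorph0 //.
  rewrite -horner_map x0t redQ horner_prod.
  have f0 : (0 < res_degree k p)%N.
    by rewrite lt0n; apply/negP => /eqP f0; have := q_gt1 k; rewrite (q_pfactor pk) f0.
  rewrite (bigD1 (Ordinal f0)) //= /F expn0 expr1 !hornerE subrr mul0r //.
rewrite rmorph_prod rootE horner_prod => /prodf_eq0[j _].
rewrite rmorphB /= map_polyX map_polyC !hornerE subr_eq0 /= rmorphXn => /eqP phix0.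
exists j => x; have [x0E|xn0] := eqVneq (red x) 0.
  rewrite x0E rmorph0 expr0n expn_eq0 -leqn0 leqNgt (prime_gt0 p_pr) /=.
  by rewrite (OK_morph_red phi (y := 0)) ?rmorph0.
have [i ri] := prim_rootP pt (fin_unit_expf xn0).
rewrite (OK_morph_red phi (y := x0 ^+ i)) ?rmorphXn /= ?phix0 ?ri ?x0t //.
by rewrite rmorphXn -!exprM mulnC.
Qed.

(** Entries are lifted one by one; the determinant of the lift is a unit because its reduction is
    nonzero and O_K is local. *)
Lemma gl2_red_surj (g : {'GL_2[k]}) : exists h, gl2_red red h = g.
Proof.
have /choice[s sE] := red_surj.
pose A : 'M[OK]_2 := map_mx s (gl_mx g).
have redA : map_mx red A = gl_mx g by apply/matrixP => i j; rewrite !mxE sE.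
have uA : A \in unitmx.
  rewrite unitmxE; apply/unitrPr; apply: (OK_unit pk (red := red)).
  by rewrite -det_map_mx redA gl_mx_det.
by exists (GL2OK uA); apply: gl_mx_inj.
Qed.
End ResidueMorphism.

(** * The estimate *)

Section Norm.
Variables (k : finFieldType) (E : closedFieldType) (iota : {rmorphism k -> E}).
Local Notation G := {'GL_2[k]}.
Local Notation q := #|k|.
Implicit Types V W L : rep E G.
Variables (p : nat) (pk : p \in [pchar k]).
Variable R : realType.
Local Notation cl := (groth_cl R).
Local Notation gmul := (@groth_mul R E G).
Local Notation M := (q ^ 2 - 1)%N.
Local Notation sdiff := (symm_diff iota R).
Let pE := pchar_iota iota pk.

Lemma dvdn_torus_order : (q - 1 %| M)%N.
Proof. by rewrite torus_orderE dvdn_mulr. Qed.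

Lemma groth_cl_symm_period W i j (N N' : nat) : has_central_char iota W i ->
  (i + (p ^ j * N)%:Z = N'%:Z %[mod q%:Z - 1])%Z ->
  gmul (cl W) (cl (iter j (rep_frob pk) (rep_symm iota (N + M))))
  = gmul (cl W) (cl (iter j (rep_frob pk) (rep_symm iota N))) + (rdim W)%:R *: sdiff N'.
Proof.
move=> Wi iN; have [] := @brauer_nesbitt _ _ _ pE
  (rep_tens W (iter j (rep_frob pk) (rep_symm iota (N + M))) :: nseq (rdim W) (rep_symm iota
    N'))
  (rep_tens W (iter j (rep_frob pk) (rep_symm iota N)) :: nseq (rdim W) (rep_symm iota (N' +
    M))).
  move=> g; rewrite !big_cons !big_nseq !iter_mulr_1.
  exact: (rep_symm_period pk g Wi iN).
move=> /(_ R) + _; rewrite !big_cons !big_nseq !iter_addr_0 !groth_cl_tens => e.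
by rewrite scaler_nat mulrnBl addrA -e addrK.
Qed.

Lemma groth_cl_symm_periods W i j (N N' : nat) b : has_central_char iota W i ->
  (i + (p ^ j * N)%:Z = N'%:Z %[mod q%:Z - 1])%Z ->
  gmul (cl W) (cl (iter j (rep_frob pk) (rep_symm iota (N + b * M))))
  = gmul (cl W) (cl (iter j (rep_frob pk) (rep_symm iota N))) + (b * rdim W)%:R *: sdiff N'.
Proof.
move=> Wi iN; elim: b => [|b IH]; first by rewrite mul0n addn0 scale0r addr0.
rewrite mulSn addnA addnAC (groth_cl_symm_period Wi (N' := N')); last first.
  rewrite -iN mulnDr PoszD addrA; have /dvdnP[t ->] := dvdn_torus_order.
  have -> : q%:Z - 1 = (q - 1)%N%:Z by rewrite -subzn // ltnW // q_gt1.
  by apply/eqz_modP; exists (p ^ j * (b * t))%N%:Z; rewrite -PoszM !mulnA.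
by rewrite IH -addrA -scalerDl -natrD [(_ * _ + _)%N]addnC -mulSn.
Qed.

Lemma ses_frob V' V V'' : ses V' V V'' ->
  ses (rep_frob pk V') (rep_frob pk V) (rep_frob pk V'').
Proof. by case=> f [s] [ff fs e fV sV]; exists f, s; split=> // g; [apply: fV|apply: sV]. Qed.

Variables (Nm : groth R E G -> R) (normN : is_groth_norm iota pk Nm).

Lemma norm0 : Nm 0 = 0.
Proof. by rewrite -(scale0r (0 : groth R E G)) (groth_normZ normN) normr0 mul0r. Qed.

Lemma norm_ge0 x : 0 <= Nm x.
Proof.
have := groth_normD normN x (-1 *: x).
rewrite scaleN1r subrr norm0 -scaleN1r (groth_normZ normN) normrN1 mul1r.
by move=> h; lra.
Qed.

Lemma norm_frob V j : Nm (cl (iter j (rep_frob pk) V)) = Nm (cl V).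
Proof.
elim: j => //= j IH; rewrite -(groth_lin_cl R _ ses_frob) (groth_norm_frob normN).
exact: IH.
Qed.

(** The axiom concerns a single twist by det, so [m] is first replaced by a natural number in the
    same class modulo q - 1. *)
Lemma norm_twist V m : Nm (cl (twist iota V m)) = Nm (cl V).
Proof.
have [t tm] : exists t : nat, (m = t%:Z %[mod q%:Z - 1])%Z.
  have Q0 : q%:Z - 1 != 0 by rewrite subr_eq0; apply/eqP => -[q1]; have := q_gt1 k; rewrite q1.
  exists `|(m %% (q%:Z - 1))%Z|%N; rewrite gez0_abs ?modz_ge0 // modz_mod //.
rewrite (groth_cl_twist_mod iota pk R V tm).
elim: t {tm} => [|t <-].
  rewrite [cl (twist _ _ _)](_ : _ = cl V) //; apply: (groth_cl_char_poly pE) => g.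
  by rewrite char_poly_twist expr0z scale1r.
by rewrite -[t.+1]addn1 PoszD -(groth_cl_twistD iota pk) groth_cl_twist (groth_norm_det normN).
Qed.

(* [W] acts on this element as dim W, which bounds dim W by the norm of [W]. *)
Definition eigen_elt := \sum_(N < q - 1) sdiff N.

(** The dimension functional takes the value (q - 1) M on it, which is nonzero in R. *)
Lemma eigen_elt_neq0 : eigen_elt != 0.
Proof.
apply/eqP => x0; have dD := @rdim_additive R E G.
have := congr1 (groth_fun (fun V => (rdim V)%:R)) x0.
rewrite (groth_fun0 dD) (groth_fun_sum dD).
under eq_bigr => N _ do rewrite (groth_funB dD) !(groth_fun_cl dD) /= -addSn natrD addrAC addrN
  add0r.
rewrite sumr_const card_ord -mulrnA => /eqP; rewrite pnatr_eq0 muln_eq0.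
by rewrite gtn_eqF ?torus_order_gt0 //= gtn_eqF // subn_gt0 q_gt1.
Qed.

(** By the period identity [W] sends [sdiff N] to dim W times [sdiff (N + t)], where t is the
    central character; the sum over all residues absorbs the shift. *)
Lemma groth_mul_eigen_elt W i : has_central_char iota W i ->
  gmul (cl W) eigen_elt = (rdim W)%:R *: eigen_elt.
Proof.
move=> Wi; rewrite groth_mul_sumr.
have Q0 : (0 < q - 1)%N by rewrite subn_gt0 q_gt1.
have qE : q%:Z - 1 = (q - 1)%N%:Z by rewrite -subzn // ltnW // q_gt1.
have [t ti] : exists t : nat, (i = t%:Z %[mod q%:Z - 1])%Z.
  exists `|(i %% (q%:Z - 1))%Z|%N; rewrite gez0_abs ?modz_ge0 // ?modz_mod // qE.
  by rewrite -lt0n.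
pose f (N : 'I_(q - 1)) : 'I_(q - 1) := Ordinal (ltn_pmod (t + N) Q0).
have injf : injective f.
  move=> N N' /(congr1 val) /= /eqP; rewrite eqn_modDl !modn_small // => /eqP.
  exact: val_inj.
rewrite scaler_sumr [RHS](reindex f) /=; last exact/onW_bij/injF_bij.
apply: eq_bigr => N _; have := @groth_cl_symm_period W i 0 N ((t + N) %% (q - 1))%N Wi.
rewrite expn0 mul1n => /(_ _)/wrap[]; last first.
  move=> h; have : sdiff N = -1 *: cl (rep_symm iota N) + cl (rep_symm iota (N + M)).
    by rewrite scaleN1r addrC.
  move=> ->; rewrite groth_mulDr groth_mulZr h scaleN1r addrA addNr.
  by rewrite add0r.
by rewrite qE modz_nat modn_mod -modz_nat PoszD -modzDml -qE ti modzDml.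
Qed.

Lemma rdim_le_norm W i : has_central_char iota W i -> (rdim W)%:R <= Nm (cl W).
Proof.
move=> Wi; have x0 : 0 < Nm eigen_elt.
  rewrite lt_neqAle norm_ge0 andbT eq_sym; apply/eqP => /(groth_norm_eq0 normN)/eqP.
  by rewrite (negbTE eigen_elt_neq0).
rewrite -(ler_pM2r x0) -[X in X * _ <= _](ger0_norm (ler0n _ _)) -(groth_normZ normN).
by rewrite -(groth_mul_eigen_elt Wi) (groth_normM normN).
Qed.

(** Norms over one period; the summand 1 makes the powers of the bound increase with the
    exponent. *)
Definition symm_bound : R := 1 + \sum_(a < M) (Nm (cl (rep_symm iota a)) + Nm (sdiff a)).

Lemma symm_bound_ge1 : 1 <= symm_bound.
Proof. by rewrite lerDl sumr_ge0 // => a _; rewrite addr_ge0 ?norm_ge0. Qed.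

Lemma norm_symm_small a : (a < M)%N -> Nm (cl (rep_symm iota a)) + Nm (sdiff a) <= symm_bound.
Proof.
move=> aM; rewrite /symm_bound (bigD1 (Ordinal aM)) //= addrCA lerDl addr_ge0 // sumr_ge0 // =>
  i _.
by rewrite addr_ge0 ?norm_ge0.
Qed.

(** The period identity with trivial [W] gives [S_(a + b M)] = [S_a] + b P_a, and b <= n. *)
Lemma norm_symm n : Nm (cl (rep_symm iota n)) <= symm_bound * n.+1%:R.
Proof.
have M0 : (0 < M)%N := torus_order_gt0 k.
rewrite (divn_eq n M) addnC; set a := (n %% M)%N; set b := (n %/ M)%N.
have aM : (a < M)%N by rewrite ltn_mod.
have c1 : has_central_char iota (rep1 E G) 0 by move=> g c _; rewrite expr0z.
have := @groth_cl_symm_periods (rep1 E G) 0 0 a a b c1.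
rewrite add0r expn0 mul1n muln1 => /(_ erefl) /=.
rewrite !(groth_mul1l pE) => ->.
have ha := norm_symm_small aM; have s1 := symm_bound_ge1.
have n1 := norm_ge0 (cl (rep_symm iota a)); have n2 := norm_ge0 (sdiff a).
apply: le_trans (groth_normD normN _ _) _; rewrite (groth_normZ normN) ger0_norm ?ler0n //.
apply: (@le_trans _ _ (symm_bound * b.+1%:R)).
  have b0 : 0 <= b%:R :> R := ler0n _ _.
  rewrite -natr1 mulrDr mulr1 addrC mulrC lerD //; last by lra.
  by rewrite ler_wpM2r //; lra.
rewrite ler_wpM2l ?ler_nat //; first by lra.
by rewrite ltnS (leq_trans _ (leq_addl _ _)) // leq_pmulr.
Qed.

End Norm.

(** From D x <= x^h one gets (D x)^(1/h) <= x; multiplying by (D x)^(1-1/h) and cancelling x gives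
    the claim. *)
Lemma prod_le_powR (R : realType) h (D x : R) : (0 < h)%N -> 0 < D -> 1 <= x -> D <= x ^+ h.-1
  ->
  D <= (D * x) `^ (1 - h%:R^-1).
Proof.
move=> h0 D0 x1 Dx; have x0 : 0 < x by lra.
have y0 : 0 < D * x by rewrite mulr_gt0.
have h0R : h%:R != 0 :> R by rewrite pnatr_eq0 -lt0n.
rewrite -(ler_pM2r x0).
have {1}-> : D * x = (D * x) `^ (1 - h%:R^-1) * (D * x) `^ (h%:R^-1).
  by rewrite -powRD ?subrK ?powRr1 ?ltW // (gt_eqF y0) implybT.
rewrite ler_wpM2l ?powR_ge0 //.
have : (D * x) `^ h%:R^-1 <= (x ^+ h) `^ h%:R^-1.
  apply: ge0_ler_powR; rewrite ?nnegrE ?invr_ge0 ?ler0n ?(ltW y0) ?exprn_ge0 ?(ltW x0) //.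
  by rewrite -(prednK h0) exprSr ler_pM2r.
by rewrite -powR_mulrn ?(ltW x0) // -powRrM mulfV // powRr1 ?(ltW x0).
Qed.

Section Estimate.
Variables (k : finFieldType) (E : closedFieldType) (iota : {rmorphism k -> E}).
Local Notation G := {'GL_2[k]}.
Local Notation q := #|k|.
Implicit Types V W L : rep E G.
Variables (p : nat) (pk : p \in [pchar k]).
Variable R : realType.
Local Notation cl := (groth_cl R).
Local Notation gmul := (@groth_mul R E G).
Local Notation M := (q ^ 2 - 1)%N.
Local Notation sdiff := (symm_diff iota R).
Let pE := pchar_iota iota pk.
Variables (Nm : groth R E G -> R) (normN : is_groth_norm iota pk Nm).
Local Notation sb := (symm_bound iota Nm).

Lemma int_mod_nat (i : int) : exists t : nat, (i = t%:Z %[mod q%:Z - 1])%Z.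
Proof.
have Q0 : q%:Z - 1 != 0 by rewrite subr_eq0; apply/eqP => -[q1]; have := q_gt1 k; rewrite q1.
by exists `|(i %% (q%:Z - 1))%Z|%N; rewrite gez0_abs ?modz_ge0 // modz_mod.
Qed.

Lemma omega_le n : (omega iota pk n <= q ^ 2)%N.
Proof.
apply: leq_trans (max_card _) _; rewrite card_prod !card_ord.
by rewrite -mulnn leq_mul // leq_pred.
Qed.

(** Write n0 + 1 = (a + 1) + b M with a < M. The b periods match the main term exactly. What remains
    is a coefficient bounded by [sb] times the norm of [W], and omega(n) dim W (a + 1) / M, bounded
    by q^2 times that norm. *)
Lemma coef_estimate W i j n0 n m : (n < q)%N -> has_central_char iota W i ->
  (n%:Z + 2 * m = i + (p ^ j * n0)%:Z %[mod q%:Z - 1])%Z ->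
  `|groth_coef (rep_irr iota pk n m) (gmul (cl W) (cl (iter j (rep_frob pk) (rep_symm iota
    n0))))
    - (omega iota pk n)%:R * (rdim W * n0.+1)%:R / M%:R| <= (sb + (q ^ 2)%:R) * Nm (cl W).
Proof.
move=> nq Wi nm; set L := rep_irr _ _ _ _; set om := omega _ _ _.
have M0 : (0 < M)%N := torus_order_gt0 k.
have MR : 0 < M%:R :> R by rewrite ltr0n.
have mD V1 V2 V3 : ses V1 V2 V3 -> _ := mult_additive R pE L (V' := V1) (V := V2) (V'' := V3).
set a := (n0 %% M)%N; set b := (n0 %/ M)%N; have nE : n0 = (a + b * M)%N by rewrite addnC
  -divn_eq.
have aM : (a < M)%N by rewrite ltn_mod.
have [N' iN'] := int_mod_nat (i + (p ^ j * a)%:Z).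
rewrite {1}nE (groth_cl_symm_periods pk R b Wi iN') groth_coefE (groth_funD mD) (groth_funZ mD)
  -groth_coefE.
rewrite -/L (groth_coef_symm_diff iota pk R N' m nq) ifT; last first.
  rewrite -iN' nm nE; apply/eqP; have /dvdnP[t tE] := dvdn_torus_order k.
  apply/eqz_modP; exists (p ^ j * (b * t))%N%:Z.
  have -> : q%:Z - 1 = (q - 1)%N%:Z by rewrite -subzn // ltnW // q_gt1.
  by rewrite -addrA; congr (_ + _); rewrite -PoszM -PoszD tE mulnDr !mulnA.
have cL : `|groth_coef L (gmul (cl W) (cl (iter j (rep_frob pk) (rep_symm iota a))))| <= sb *
  Nm (cl W).
  apply: le_trans (groth_norm_coef normN _ _ nq) _; apply: le_trans (groth_normM normN _ _) _.
  rewrite (norm_frob normN) mulrC ler_wpM2r ?(norm_ge0 normN) //.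
  by have := norm_symm_small normN aM; have := norm_ge0 normN (sdiff a); lra.
rewrite mulrDl; set c := groth_coef _ _ in cL *.
have -> : c + (b * rdim W)%:R * om%:R - om%:R * (rdim W * n0.+1)%:R / M%:R
    = c - om%:R * (rdim W)%:R * (a.+1%:R / M%:R).
  rewrite nE -addSn !natrM !natrD !natrM; field; exact: lt0r_neq0.
apply: le_trans (ler_normB _ _) _; apply: lerD => //.
have dW := rdim_le_norm normN Wi.
rewrite ger0_norm; last by rewrite !mulr_ge0 ?invr_ge0 ?ler0n.
apply: (@le_trans _ _ ((q ^ 2)%:R * (rdim W)%:R * 1)); last by rewrite mulr1 ler_wpM2l ?ler0n.
rewrite ler_pM ?mulr_ge0 ?invr_ge0 ?ler0n //.
  by rewrite ler_wpM2r ?ler0n // ler_nat omega_le.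
by rewrite ler_pdivrMr // mul1r ler_nat.
Qed.

HB.instance Definition _ := Monoid.isComLaw.Build (groth R E G) (cl (rep1 E G)) gmul
  (groth_mulA pE) (groth_mulC pE) (groth_mul1l pE).

Section Tensor.
Variables (I : finType) (nn j : I -> nat) (e : I -> int).
Definition symm_factor i : rep E G := twist iota (iter (j i) (rep_frob pk) (rep_symm iota (nn
  i))) (e i).
Definition symm_tensor (P : pred I) : rep E G := \big[@rep_tens E G/rep1 E G]_(i | P i)
  symm_factor i.

Lemma groth_cl_symm_tensor P : cl (symm_tensor P) = \big[gmul/cl (rep1 E G)]_(i | P i) cl
  (symm_factor i).
Proof. by rewrite /symm_tensor; apply: (big_morph (@groth_cl R E G)) => // V W; exact:
  groth_cl_tens. Qed.

Lemma rdim_frob l V : rdim (iter l (rep_frob pk) V) = rdim V.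
Proof. by elim: l. Qed.

Lemma rdim_symm_factor i : rdim (symm_factor i) = (nn i).+1.
Proof. by rewrite /= rdim_frob muln1. Qed.

Lemma rdim_symm_tensor P : rdim (symm_tensor P) = (\prod_(i | P i) (nn i).+1)%N.
Proof.
rewrite /symm_tensor (big_morph (@rdim E G) (id1 := 1%N) (op1 := muln)) //.
by apply: eq_bigr => i _; rewrite rdim_symm_factor.
Qed.

Definition symm_char i : int := (p ^ j i)%N%:Z * (nn i)%:Z + e i * 2.

Lemma central_char_factor i : has_central_char iota (symm_factor i) (symm_char i).
Proof. by apply: central_char_twist; apply: central_char_frob; exact: central_char_symm. Qed.

Lemma central_char_tensor P : has_central_char iota (symm_tensor P) (\sum_(i | P i) symm_char
  i).
Proof.
apply: (big_ind2 (fun V c => has_central_char iota V c)) => [g a _|V c V' c'|i _].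
- by rewrite expr0z.
- exact: central_char_tens.
- exact: central_char_factor.
Qed.

(** The factor [x] is kept so that the empty product contributes 1; the norm of the unit class may
    be larger. *)
Lemma norm_mul_tensor P x : Nm (gmul x (cl (symm_tensor P)))
  <= Nm x * \prod_(i | P i) (sb * (nn i).+1%:R).
Proof.
have s1 := symm_bound_ge1 normN.
suff : (forall x, Nm (gmul x (cl (symm_tensor P))) <= Nm x * \prod_(i | P i) (sb * (nn
  i).+1%:R))
  /\ 0 <= \prod_(i | P i) (sb * (nn i).+1%:R) by case.
apply: (big_ind2 (fun V c => (forall x, Nm (gmul x (cl V)) <= Nm x * c) /\ 0 <= c)).
- by split=> // y; rewrite (groth_mulC pE) (groth_mul1l pE) mulr1.
- move=> V c W d [Vc c0] [Wd d0]; split=> [y|]; last exact: mulr_ge0.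
  rewrite groth_cl_tens (groth_mulA pE); apply: le_trans (Wd _) _.
  by rewrite mulrA ler_wpM2r.
- move=> i _; split=> [y|]; last by rewrite mulr_ge0 ?ler0n //; lra.
  apply: le_trans (groth_normM normN _ _) _; rewrite ler_wpM2l ?(norm_ge0 normN) //.
  by rewrite (norm_twist normN) (norm_frob normN) (norm_symm normN).
Qed.

Lemma tensor_estimate h W w n m : (0 < h)%N -> (#|I| <= h)%N -> (n < q)%N ->
  has_central_char iota W w ->
  (n%:Z + 2 * m = w + \sum_i symm_char i %[mod q%:Z - 1])%Z ->
  `|groth_coef (rep_irr iota pk n m) (gmul (cl W) (cl (symm_tensor predT)))
    - (omega iota pk n)%:R * (rdim W * rdim (symm_tensor predT))%:R / M%:R|
  <= (sb + (q ^ 2)%:R) * sb ^+ h * Nm (cl W) * (rdim (symm_tensor predT))%:R `^ (1 - h%:R^-1).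
Proof.
move=> h0 Ih nq Ww nm; have s1 := symm_bound_ge1 normN.
have C1 : 1 <= sb + (q ^ 2)%:R by rewrite (le_trans s1) // lerDl ler0n.
have Wge := norm_ge0 normN (cl W).
have sbh : 1 <= sb ^+ h by rewrite exprn_ege1.
case: (pickP I) => [i1 _|I0]; last first.
  (* Without factors the trivial representation is read as Symm^0, to which [coef_estimate]
     applies. *)
  have S0 : cl (rep1 E G) = cl (iter 0 (rep_frob pk) (rep_symm iota 0)).
    apply: (groth_cl_char_poly pE) => g; congr char_poly.
    by apply/matrixP => i' j'; rewrite !ord1 !mxE /= !mul1r coef1.
  have TE : symm_tensor predT = rep1 E G by apply: big_pred0.
  rewrite TE /= powR1 mulr1 S0.
  have e0 : (n%:Z + 2 * m = w + (p ^ 0 * 0)%:Z %[mod q%:Z - 1])%Z.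
    by rewrite nm big_pred0 // muln0.
  apply: le_trans (coef_estimate nq Ww e0) _; rewrite -mulrA ler_wpM2l ?(le_trans _ C1) //.
  by rewrite ler_peMl.
pose i0 := [arg max_(i > i1) nn i]%N.
have i0max i : (nn i <= nn i0)%N by rewrite /i0; case: arg_maxnP => // x _; apply.
pose P := [pred i | i != i0].
(* All factors but the largest, together with its determinant twist, are absorbed into [W]. *)
pose W' := twist iota (rep_tens W (symm_tensor P)) (e i0).
have sumE : \sum_i symm_char i = symm_char i0 + \sum_(i | P i) symm_char i by rewrite (bigD1
  i0).
have W'c := central_char_twist (e i0) (central_char_tens Ww (central_char_tensor P)).
have clE : gmul (cl W) (cl (symm_tensor predT))
    = gmul (cl W') (cl (iter (j i0) (rep_frob pk) (rep_symm iota (nn i0)))).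
  rewrite !groth_cl_twist groth_cl_tens !groth_cl_symm_tensor (bigD1 i0) //= groth_cl_twist.
  by rewrite [X in gmul _ X]Monoid.mulmC [X in gmul _ (gmul _ X)]Monoid.mulmC !Monoid.mulmA.
pose D := (\prod_(i | P i) (nn i).+1)%N.
have dT : rdim (symm_tensor predT) = (D * (nn i0).+1)%N.
  by rewrite rdim_symm_tensor (bigD1 i0) //= mulnC.
have dW' : rdim W' = (rdim W * D)%N by rewrite /= muln1 rdim_symm_tensor.
have e' : (n%:Z + 2 * m = w + \sum_(i | P i) symm_char i + e i0 * 2 + (p ^ j i0 * nn i0)%:Z
  %[mod q%:Z - 1])%Z.
  by rewrite nm sumE /symm_char PoszM; congr (_ %% _)%Z; ring.
rewrite clE dT mulnA -dW'; apply: le_trans (coef_estimate nq W'c e') _.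
rewrite -!mulrA ler_wpM2l ?(le_trans _ C1) // (norm_twist normN) groth_cl_tens.
apply: le_trans (norm_mul_tensor _ _) _; rewrite mulrCA ler_wpM2l // big_split /= prodr_const.
have D0 : (0 < D)%N by apply: prodn_gt0.
have cP : #|P| = #|I|.-1 by rewrite cardC1.
have I0 : (0 < #|I|)%N by apply/card_gt0P; exists i1.
apply: ler_pM; rewrite ?exprn_ge0 ?prodr_ge0 // ?(le_trans _ s1) //.
  by rewrite cP ler_weXn2l // (leq_trans (leq_pred _)).
rewrite natrM -natr_prod -/D; apply: prod_le_powR; rewrite ?ltr0n ?ler1n //.
rewrite -natrX ler_nat; apply: (@leq_trans (\prod_(i | P i) (nn i0).+1)%N).
  by apply: leq_prod => i _; rewrite ltnS.
rewrite prod_nat_const cP leq_pexp2l // -ltnS !prednK //.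
Qed.
End Tensor.
End Estimate.

(** * Reduction of algebraic representations *)

Lemma map_symm_mx (A B : comNzRingType) (f : {rmorphism A -> B}) n (g : 'M[A]_2) :
  map_mx f (symm_mx n g) = symm_mx n (map_mx f g).
Proof.
apply/matrixP => i j; rewrite !mxE -coef_map rmorphM !rmorphXn !rmorphD /= !map_polyC
  !map_polyZ !map_polyX.
by [].
Qed.

Lemma map_tensmx (A B : comNzRingType) (f : {rmorphism A -> B}) m n r s
    (X : 'M[A]_(m, n)) (Y : 'M[A]_(r, s)) :
  map_mx f (X *t Y) = map_mx f X *t map_mx f Y.
Proof.
apply/matrixP => i j; case: (mxtens_indexP i) => i1 i2.
by case: (mxtens_indexP j) => j1 j2; rewrite mxE !tensmxE !mxE rmorphM.
Qed.

Lemma perm_eigs (F : closedFieldType) m n (A : 'M[F]_m) (B : 'M[F]_n) :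
  char_poly A = char_poly B -> perm_eq (eigs A) (eigs B).
Proof. by move=> AB; apply: prod_XsubC_eq; rewrite -!char_poly_eigs. Qed.

Lemma char_poly_tens_eq (F : closedFieldType) m n r s
    (A : 'M[F]_m) (B : 'M[F]_n) (A' : 'M[F]_r) (B' : 'M[F]_s) :
  char_poly A = char_poly A' -> char_poly B = char_poly B' ->
  char_poly (A *t B) = char_poly (A' *t B').
Proof.
move=> /perm_eigs AA' /perm_eigs BB'; rewrite !char_poly_tens (perm_big _ AA').
by apply: eq_bigr => a _; exact: perm_big.
Qed.

Lemma char_poly_scale_eq (F : closedFieldType) m n (c : F) (A : 'M[F]_m) (B : 'M[F]_n) :
  char_poly A = char_poly B -> char_poly (c *: A) = char_poly (c *: B).
Proof.
move=> /perm_eigs AB; rewrite !char_poly_eigs (perm_big _ (eigs_scale c A)).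
by rewrite (perm_big _ (eigs_scale c B)) !big_map; exact: perm_big.
Qed.

(** Semisimplification enters only through this invariant. *)
Lemma mfam_ss_char_poly T (F : fieldType) (r s : mfam T F) : mfam_ss r s ->
  forall g, char_poly (r g) = char_poly (s g).
Proof.
elim=> [{}r {}s g|d1 d2 a b b' c P Q {}r {}s _ _ IH uP uQ rE sE g] /=.
  by rewrite /char_poly !det_mx00.
rewrite rE sE !char_poly_conj // !char_poly_lblock.
by congr (_ * _); exact: IH.
Qed.

(** * Embeddings of K and their number *)

Section Dedekind.
Variables (K L : fieldType) (I : finType) (tau : I -> {rmorphism K -> L}).
Hypothesis tau_inj : forall i j, tau i =1 tau j -> i = j.

(** Descent on the support: for [y] separating two embeddings, the relation at [x * y] minus
    [tau i y] times the relation at [x] loses index [i] but keeps a nonzero coefficient at [j]. *)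
Lemma dedekind_independence (v : I -> L) :
  (forall x, \sum_i v i * tau i x = 0) -> forall i, v i = 0.
Proof.
have [n] := ubnP #|[set i | v i != 0]|; elim: n v => // n IH v vn v0 i.
apply/eqP/negPn/negP => vi.
have [[j [vj ij]]|none] := pselect (exists j, v j != 0 /\ j != i); last first.
  have := v0 1; rewrite (bigD1 i) //= rmorph1 mulr1 big1 ?addr0.
    by move/eqP; rewrite (negbTE vi).
  move=> j ji; have [->|vj] := eqVneq (v j) 0; first by rewrite mul0r.
  by case: none; exists j.
have [y yij] : exists y, tau j y != tau i y.
  apply: contrapT => no; move/eqP: ij; apply; apply: tau_inj => y.
  by apply/eqP/negPn/negP => yij; apply: no; exists y.
pose w l := v l * (tau l y - tau i y).
have : w j = 0.
  apply: IH => [|x].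
    rewrite ltnS in vn; apply: leq_trans vn; rewrite [X in (_ < X)%N](cardsD1 i) inE vi add1n
      ltnS.
    apply: subset_leq_card; apply/fintype.subsetP => l; rewrite !inE /w mulf_eq0 negb_or =>
      /andP[-> +].
    by rewrite andbT; apply: contra => /eqP ->; rewrite subrr.
  have := congr2 (fun a b => a - tau i y * b) (v0 (x * y)) (v0 x).
  rewrite mulr0 subr0 mulr_sumr -sumrB => h; apply: etrans h; apply: eq_bigr => l _.
  by rewrite /w rmorphM; ring.
by move/eqP; rewrite mulf_eq0 (negbTE vj) subr_eq0 (negbTE yij).
Qed.
End Dedekind.

Section Embeddings.
Variables (p : nat) (p_pr : prime p) (K : fieldExtType (Qp p_pr)).
Variables (Qb : fieldType) (jota : {rmorphism Qp p_pr -> Qb}).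
Local Notation OK := (OK K).
Local Notation OQb := (OQb jota).

(** More than h embeddings would satisfy a linear relation on a basis of K, hence on K by linearity
    over Q_p, against independence. *)
Lemma card_embeddings (I : finType) (tau : I -> {rmorphism K -> Qb}) :
  enum_embeddings jota tau -> (#|I| <= \dim {:K})%N.
Proof.
case=> emb inj _; rewrite leqNgt; apply/negP => dI.
pose B : 'M[Qb]_(#|I|, \dim {:K}) := \matrix_(i, l) tau (enum_val i) (vbasis {:K})`_l.
have : kermx B != 0.
  rewrite -mxrank_eq0 mxrank_ker -lt0n subn_gt0.
  exact: leq_ltn_trans (rank_leq_col _) dI.
case/rowV0Pn => v /sub_kermxP vB v0.
suff v0' i : v 0 (enum_rank i) = 0.
  case/eqP: v0; apply/rowP => i; rewrite [RHS]mxE.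
  by rewrite -(enum_valK i) v0'.
apply: (dedekind_independence inj (v := fun i => v 0 (enum_rank i))) => x.
rewrite (coord_vbasis (memvf x)).
under eq_bigr => l _ do rewrite rmorph_sum mulr_sumr.
rewrite exchange_big big1 //= => l _.
have := congr1 (fun u : 'rV_(\dim {:K}) => jota (coord (vbasis {:K}) l x) * u 0 l) vB.
rewrite /= [in RHS]mxE mulr0 mxE mulr_sumr => vl; rewrite -[RHS]vl.
rewrite (reindex (@enum_val I predT)) /=; last exact/onW_bij/enum_val_bij.
apply: eq_bigr => r _; rewrite enum_valK mxE -[coord _ _ _ *: _]mulr_algl rmorphM /= emb.
by rewrite mulrCA.
Qed.

Section Integers.
Variables (s : {rmorphism K -> Qb}) (sE : is_embedding jota s).

Fact OK_embed_subproof (x : OK) : s (val x) \in integral_pred (Zp_Qb jota).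
Proof.
have /asboolP[f fm fx] := valP x; apply/asboolP; exists f => //.
have -> : map_poly (Zp_Qb jota) f = map_poly s (map_poly (Zp_K K) f).
  by apply/polyP => i; rewrite !coef_map /= sE.
by rewrite rootE horner_map (rootP fx) rmorph0.
Qed.
Definition OK_embed (x : OK) : OQb := Intcl (OK_embed_subproof x).

Fact OK_embed_zmod : zmod_morphism OK_embed.
Proof. by move=> x y; apply: val_inj; rewrite rmorphB /= !rmorphB. Qed.
Fact OK_embed_monoid : monoid_morphism OK_embed.
Proof.
split=> [|x y]; apply: val_inj; first by rewrite rmorph1 /= !rmorph1.
by rewrite rmorphM /= !rmorphM.
Qed.
HB.instance Definition _ := GRing.isZmodMorphism.Build OK OQb OK_embed OK_embed_zmod.
HB.instance Definition _ := GRing.isMonoidMorphism.Build OK OQb OK_embed OK_embed_monoid.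
End Integers.
End Embeddings.

Section CentralScalar.
Variables (k : finFieldType) (E : closedFieldType) (iota : {rmorphism k -> E}).
Local Notation G := {'GL_2[k]}.
Local Notation q := #|k|.
Implicit Types V W L : rep E G.
Variables (p : nat) (pk : p \in [pchar k]).

Lemma finite_order_scalar d (A : 'M[E]_d) c : A ^+ (q ^ 2 - 1) = 1%:M ->
  char_poly A = ('X - c%:P) ^+ d -> A = c%:M.
Proof.
move=> AM Ac; have [P uP [D PD]] := finite_order_diag iota pk AM.
have Dc i : D 0 i = c.
  have : root (char_poly (diag_mx D)) (D 0 i).
    rewrite char_poly_trig ?diag_mx_is_trig // rootE horner_prod (bigD1 i) //=.
    by rewrite !hornerE !mxE eqxx mulr1n subrr mul0r.
  rewrite (char_poly_intertwine uP (esym PD)) Ac rootE horner_exp expf_eq0.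
  by rewrite hornerXsubC subr_eq0 => /andP[_ /eqP].
have Dd : diag_mx D = c%:M by apply/matrixP => i l; rewrite !mxE Dc.
by apply: (can_inj (mulKmx uP)); rewrite PD Dd scalar_mxC.
Qed.

Lemma rep_mxX V g n : V (g ^+ n)%g = V g ^+ n.
Proof.
elim: n => [|n IH]; first by rewrite expg0 repr_mx1.
by rewrite expgS repr_mxM ?in_setT // IH exprS.
Qed.

(** [U] is known only up to semisimplification, but scalar matrices have order prime to p: they act
    diagonalisably, and a single eigenvalue makes the action scalar. *)
Lemma central_char_char_poly V W i : has_central_char iota W i ->
  (forall g, char_poly (V g) = char_poly (W g)) -> has_central_char iota V i.
Proof.
move=> Wi VW g a ga.
have dVW : rdim V = rdim W.
  by apply/eqP; rewrite -eqSS -(size_char_poly (V 1%g)) VW size_char_poly.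
apply: finite_order_scalar.
  rewrite -rep_mxX; suff -> : (g ^+ (q ^ 2 - 1))%g = 1%g by rewrite repr_mx1.
  apply: gl_mx_inj; rewrite gl_mxX ga /gl_mx GL_1E -rmorphXn /=.
  by rewrite (torus_orderE k) exprM fin_unit_expf ?expr1n // (gl_mx_scalar_neq0 ga).
by rewrite VW (Wi g a ga) char_poly_scalar dVW.
Qed.

Lemma central_charP V i : has_central_char iota V i -> (0 < rdim V)%N ->
  (central_char iota V = i %[mod q%:Z - 1])%Z.
Proof.
move=> Vi d0; apply: (@iota_exprz_inj _ _ iota) => c c0.
rewrite /central_char; case: xgetP => [l _ Vl|/(_ i)//].
have := Vl _ _ (gl_scalarE c0); rewrite (Vi _ _ (gl_scalarE c0)).
by move=> /matrixP/(_ (Ordinal d0) (Ordinal d0)); rewrite !mxE eqxx !mulr1n.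
Qed.
End CentralScalar.

Lemma char_poly_map_inj (A B : comNzRingType) (f : {rmorphism A -> B}) n (X Y : 'M[A]_n) :
  injective f -> char_poly (map_mx f X) = char_poly (map_mx f Y) -> char_poly X = char_poly Y.
Proof. by move=> injf; rewrite -!map_char_poly; apply: map_inj_poly; rewrite ?rmorph0. Qed.

Section Reduction.
Variables (p : nat) (p_pr : prime p) (K : fieldExtType (Qp p_pr)).
Local Notation OK := (OK K).
Variables (k : finFieldType) (red : {rmorphism OK -> k}).
Hypothesis red_surj : forall a : k, exists x : OK, red x = a.
Variable pk : p \in [pchar k].
Variables (E : closedFieldType) (iota : {rmorphism k -> E}).
Variables (Qb : fieldType) (jota : {rmorphism Qp p_pr -> Qb}).
Variables (pi : {rmorphism OQb jota -> E}).
Variables (I : finType) (tau : I -> {rmorphism K -> Qb}).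
Hypothesis tau_emb : forall i, is_embedding jota (tau i).

Lemma gl_frobE j (g : {'GL_2[k]}) : 
  gl_mx (iter j (gl_frob pk) g) = map_mx (fun x => x ^+ (p ^ j)) (gl_mx g).
Proof.
elim: j => [|j IH]; first by apply/matrixP => i l; rewrite mxE expn0 expr1.
rewrite [iter _ _ _]/= /gl_mx /= -/(gl_mx _) IH; apply/matrixP => i l.
by rewrite !mxE pFrobenius_autE -exprM expnSr.
Qed.

(** The standard lattice: the formula of [alg_rep] already has entries in O_Qb. On it the embedding
    [tau i] reduces to the residue map followed by a power p^(j i), which also multiplies the
    determinant exponent [m i]. *)
Lemma alg_rep_lattice (n : I -> nat) (m : I -> int) : exists (j : I -> nat) (e : I -> int)
    (d : nat) (a : GL2_OK K -> 'M[OQb jota]_d),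
  alg_rep tau n m = MFam (fun g => map_mx val (a g)) /\
  forall g, char_poly (map_mx pi (a g)) = char_poly (symm_tensor iota pk n j e predT (gl2_red
    red g)).
Proof.
have /choice[j jE] i : exists j, forall x, pi (OK_embed (tau_emb i) x) = iota (red x) ^+ (p ^
  j).
  exact: (OK_morphE red_surj pk iota (pi \o OK_embed (tau_emb i))).
exists j, (fun i => (p ^ j i)%N%:Z * m i).
rewrite /alg_rep /symm_tensor.
apply: (big_ind2 (fun (V : mfam (GL2_OK K) Qb) (T : rep E {'GL_2[k]}) =>
  exists (d : nat) (a : GL2_OK K -> 'M[OQb jota]_d), V = MFam (fun g => map_mx val (a g)) /\
  forall g, char_poly (map_mx pi (a g)) = char_poly (T (gl2_red red g)))).
- exists 1%N, (fun=> 1%:M); split=> [|g]; last by rewrite map_mx1.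
  by congr MFam; apply: funext => g; rewrite map_mx1.
- move=> V T V' T' [d [a [-> aT]]] [d' [a' [-> aT']]].
  exists (d * d')%N, (fun g => a g *t a' g); split=> [|g].
    by congr MFam; apply: funext => g; rewrite map_tensmx.
  by rewrite map_tensmx; exact: char_poly_tens_eq.
move=> i _; set f := OK_embed (tau_emb i).
have uf (g : GL2_OK K) : \det (map_mx f g) \is a GRing.unit.
  by rewrite det_map_mx rmorph_unit //; case: g.
exists (n i).+1, (fun g => \det (map_mx f g) ^ m i *: symm_mx (n i) (map_mx f g)); split=> [|g].
  congr MFam; apply: funext => g.
  rewrite map_mxZ rmorphXz ?uf // map_symm_mx -det_map_mx.
  have -> // : map_mx val (map_mx f g) = map_mx (tau i) (map_mx val g).
  by apply/matrixP => r c; rewrite !mxE.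
rewrite map_mxZ rmorphXz ?uf // map_symm_mx -det_map_mx.
have -> : map_mx pi (map_mx f g) = map_mx iota (gl_mx (iter (j i) (gl_frob pk) (gl2_red red
  g))).
  by apply/matrixP => r c; rewrite gl_frobE !mxE jE rmorphXn.
rewrite char_poly_twist; set c := \det _ ^ _; set c' := _ ^ _.
have -> : c = c'.
  rewrite /c /c' det_map_mx.
  have -> : \det (gl_mx (iter (j i) (gl_frob pk) (gl2_red red g))) = \det (gl_mx (gl2_red red
    g)) ^+ (p ^ j i).
    elim: (j i) => [|l IH]; first by rewrite expn0 expr1.
    rewrite expnSr exprM -IH [iter _ _ _]/= /gl_mx /= det_map_mx.
    exact: pFrobenius_autE.
  by rewrite rmorphXn /= exprnP exprz_exp.
by apply: char_poly_scale_eq; rewrite char_poly_iter_frob.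
Qed.

Definition OQb_val : {rmorphism OQb jota -> Qb} := val : intcl (Zp_Qb jota) -> Qb.

(** Any two stable lattices give matrices conjugate over [Qb]. Their characteristic polynomials
    agree there, hence over the subring O_Qb, hence after reduction. *)
Lemma reduction_char_poly (U : rep E {'GL_2[k]}) : is_reduction red pi tau U ->
  exists (n j : I -> nat) (e : I -> int), forall y,
    char_poly (U y) = char_poly (symm_tensor iota pk n j e predT y).
Proof.
case=> n [m] [r] [s] [lr rs Us].
have [j [e [d [a [aE aT]]]]] := alg_rep_lattice n m.
exists n, j, e => y; have [g <-] := gl2_red_surj red_surj pk y.
rewrite -aT (mfam_ss_char_poly Us) -(mfam_ss_char_poly rs).
move: lr; rewrite aE => -[P] [A] [uP AE ->] /=.
have Aa : char_poly (A g) = char_poly (a g).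
  apply: (@char_poly_map_inj _ _ OQb_val _ _ _ val_inj).
  have AE1 := AE g; rewrite /= in AE1.
  have AE' : map_mx OQb_val (A g) = invmx P *m map_mx OQb_val (a g) *m P by exact: AE1.
  rewrite AE'.
  exact: char_poly_conj.
rewrite -(map_char_poly pi) -[RHS](map_char_poly pi).
by rewrite Aa.
Qed.
End Reduction.

Theorem corollary3p10 (R : realType) (p : nat) (p_pr : prime p)
    (* K / Q_p of degree h, with residue field k of cardinality q *)
    (K : fieldExtType (Qp p_pr)) (h : nat) (hK : \dim {:K} = h)
    (k : finFieldType) (red : {rmorphism OK K -> k})
    (red_surj : forall a : k, exists x : OK K, red x = a)
    (pk : p \in [pchar k]) (q : nat) (qk : #|k| = q)
    (* E is an algebraic closure of k *)
    (E : closedFieldType) (iota : {rmorphism k -> E})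
    (E_alg : forall x : E, algebraicOver iota x)
    (* the fixed norm on the Grothendieck ring of G = GL_2(k) *)
    (N : groth R E {'GL_2[k]} -> R) (normN : is_groth_norm iota pk N) :
  exists C : R,
    forall W : rep E {'GL_2[k]}, (exists i, has_central_char iota W i) ->
    (* an algebraic closure of Q_p, its residue field mapped to E, and the
       embeddings of K *)
    forall (Qb : closedFieldType) (jota : {rmorphism Qp p_pr -> Qb}),
      (forall x : Qb, algebraicOver jota x) ->
    forall (pi : {rmorphism OQb jota -> E})
      (I : finType) (tau : I -> {rmorphism K -> Qb}),
      enum_embeddings jota tau ->
    forall U : rep E {'GL_2[k]}, is_reduction red pi tau U ->
    forall (n : nat) (m : int), (n < q)%N ->
    let V := rep_tens W U in
    let a := (mult V (rep_irr iota pk n m))%:R : R in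
    let compat := (n%:Z + 2 * m == central_char iota V %[mod q%:Z - 1])%Z in
    (compat ->
      `|a - (omega iota pk n)%:R * (rdim V)%:R / (q ^ 2 - 1)%:R|
        <= C * N (groth_cl R W) * (rdim U)%:R `^ (1 - h%:R^-1))
    /\ (~~ compat -> a = 0).
Proof.
subst q; have s1 := symm_bound_ge1 normN; set sb := symm_bound iota N in s1.
have C0 : 0 <= (sb + (#|k| ^ 2)%:R) * sb ^+ h.
  have sb0 : 0 <= sb := le_trans ler01 s1.
  by apply: mulr_ge0; [apply: addr_ge0 => //; exact: ler0n | exact: exprn_ge0].
exists ((sb + (#|k| ^ 2)%:R) * sb ^+ h) => W [w Ww] Qb jota _ pi I tau tauP U Ured n m nq V a compat.
have h0 : (0 < h)%N by rewrite -hK adim_gt0.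
have Ih : (#|I| <= h)%N by rewrite -hK; exact: card_embeddings tauP.
have [emb _ _] := tauP.
have [nn [j [e UT]]] := reduction_char_poly red_surj pk iota emb Ured.
set T := symm_tensor iota pk nn j e predT in UT.
have pE := pchar_iota iota pk.
have clU : groth_cl R U = groth_cl R T by apply: (groth_cl_char_poly pE).
have clV : groth_cl R V = groth_mul (groth_cl R W) (groth_cl R T).
  by rewrite /V groth_cl_tens clU.
have dU : rdim U = rdim T.
  by apply/eqP; rewrite -eqSS -(size_char_poly (U 1%g)) UT size_char_poly.
set L := rep_irr iota pk n m in a *.
have mD V1 V2 V3 : ses V1 V2 V3 -> _ := mult_additive R pE L (V' := V1) (V := V2) (V'' := V3).
have aE : a = groth_coef L (groth_cl R V) by rewrite groth_coefE (groth_fun_cl mD).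
(* For [V = 0] every integer is a central character, so [central_char] carries no information; all
   terms vanish. *)
have [V0|Vpos] := posnP (rdim V).
  have a0 : a = 0 by rewrite aE groth_cl_dim0 // groth_coefE (groth_fun0 mD).
  split=> // _; rewrite a0 V0 mulr0 mul0r subr0 normr0.
  by apply: mulr_ge0; [apply: mulr_ge0 => //; exact: norm_ge0 normN _ | exact: powR_ge0].
set chi := w + \sum_i symm_char p nn j e i.
have Vchi : has_central_char iota V chi.
  apply: (central_char_char_poly pk (W := rep_tens W T)).
    by apply: central_char_tens => //; exact: central_char_tensor.
  by move=> g; exact: char_poly_tens_eq.
have cV := central_charP Vchi Vpos.
split=> [/eqP c|/negP c].
  rewrite aE clV dU /V [rdim (rep_tens _ _)]/= dU.
  have nchi : (n%:Z + 2 * m = w + \sum_i symm_char p nn j e i %[mod #|k|%:Z - 1])%Z.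
    by rewrite c cV.
  have est := tensor_estimate normN h0 Ih nq Ww nchi.
  rewrite -/T -/L -/sb in est.
  exact: est.
apply/eqP; rewrite /a pnatr_eq0 -leqn0 leqNgt; apply/negP => m0; apply: c.
rewrite /compat cV; apply/eqP/esym.
exact: (mult_central_char pk Vchi (central_char_irr iota pk m nq) m0).
Qed.
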